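(* Let $k\in\mathbb N$, $a=\pi/k$, $\alpha,\beta\in\{0,1\}$ and $q\in L_2(0,\pi)$ complex-valued. The problem $L(q,a,\alpha,\beta)$ has a countable set of eigenvalues $\{\lambda_n\}_{n\ge1}$ (counted with multiplicities) of the form $$\lambda_n=\Big(n-\frac{\alpha+\beta}{2}+\frac{\kappa_n}{n}\Big)^2,\qquad \{\kappa_n\}\in l_2.$$ Moreover, in the degenerate case a part of the eigenvalues degenerates in the following sense: (i) if $\alpha=\beta=0$: $\lambda_{kn}=(kn)^2$ for all $n\in\mathbb N$; (ii) if $\alpha=1$, $\beta=0$ and $k$ is odd: $\lambda_{k(n-1/2)+1/2}=k^2(n-\frac12)^2$ for all $n\in\mathbb N$; (iii) if $\alpha=\beta=1$ and $k$ is even: $\lambda_{k(n-1/2)+1}=k^2(n-\frac12)^2$ for all $n\in\mathbb N$.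
   Context: For $k\in\mathbb N$, $a=\pi/k$, $\alpha,\beta\in\{0,1\}$ and complex-valued $q\in L_2(0,\pi)$, $L(q,a,\alpha,\beta)$ denotes the boundary value problem $$-y''(x)+q(x)y(a)=\lambda y(x),\quad 0<x<\pi,\qquad y^{(\alpha)}(0)=y^{(\beta)}(\pi)=0,$$ with spectral parameter $\lambda=\rho^2$. Let $C(x,\lambda),S(x,\lambda)$ be the solutions of this equation with $C(a,\lambda)=S'(a,\lambda)=1$, $S(a,\lambda)=C'(a,\lambda)=0$. The characteristic function is $\Delta_{\alpha,\beta}(\lambda)=C^{(\alpha)}(0,\lambda)S^{(\beta)}(\pi,\lambda)-S^{(\alpha)}(0,\lambda)C^{(\beta)}(\pi,\lambda)$; the eigenvalues are its zeros (counted with multiplicities). The degenerate case means one of: (i) $\alpha=\beta=0$; (ii) $\alpha=1,\beta=0$, $k$ odd; (iii) $\alpha=\beta=1$, $k$ even. *)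

(* Defs.v *)
From HB Require Import structures.
From mathcomp Require Import all_boot all_order all_algebra.
From mathcomp Require Import all_classical all_reals all_analysis.
From mathcomp Require Import complex.

Set Implicit Arguments.
Unset Strict Implicit.
Unset Printing Implicit Defensive.

Import Order.TTheory GRing.Theory Num.Theory.
Import numFieldNormedType.Exports.
Local Open Scope classical_set_scope.
Local Open Scope ring_scope.

Section Defs.
Variable R : realType.

Local Notation mu := (@lebesgue_measure R).

Definition I0pi : set R := `[0%R, pi]%classic.

Definition cint (D : set R) (f : R -> R[i]) : R[i] :=
  Complex (\int[mu]_(x in D) complex.Re (f x))%R
          (\int[mu]_(x in D) complex.Im (f x))%R.

Definition oint (a b : R) (f : R -> R[i]) : R[i] :=
  if a <= b then cint `[a, b] f else - cint `[b, a] f.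

Definition L2_0pi (q : R -> R[i]) : Prop :=
  measurable_fun I0pi (fun x => complex.Re (q x)) /\
  measurable_fun I0pi (fun x => complex.Im (q x)) /\
  (\int[mu]_(x in I0pi) ((ComplexField.Normc.normc (q x)) ^+ 2)%:E < +oo)%E.

(* (y, dy) is a solution (y' = dy absolutely continuous) on [0, pi] of
     -y''(x) + q(x) y(a) = lam y(x),
   written in integrated form:  y(x) = y(a) + \int_a^x y',
   y'(x) = y'(a) + \int_a^x (q(t) y(a) - lam y(t)) dt. *)
Definition is_solution (q : R -> R[i]) (a : R) (lam : R[i]) (y dy : R -> R[i]) : Prop :=
  {within I0pi, continuous (fun x => complex.Re (y x))} /\
  {within I0pi, continuous (fun x => complex.Im (y x))} /\
  {within I0pi, continuous (fun x => complex.Re (dy x))} /\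
  {within I0pi, continuous (fun x => complex.Im (dy x))} /\
  forall x, I0pi x ->
    y x = y a + oint a x dy /\
    dy x = dy a + oint a x (fun t => q t * y a - lam * y t).

Definition char_fun (alpha beta : bool) (C dC S dS : R[i] -> R -> R[i]) (lam : R[i]) : R[i] :=
  (if alpha then dC lam 0 else C lam 0) * (if beta then dS lam pi else S lam pi)
  - (if alpha then dS lam 0 else S lam 0) * (if beta then dC lam pi else C lam pi).

Definition ccontinuous_at (g : R[i] -> R[i]) (z0 : R[i]) : Prop :=
  forall e : R, 0 < e -> exists2 d : R, 0 < d &
    forall z, ComplexField.Normc.normc (z - z0) < d ->
              ComplexField.Normc.normc (g z - g z0) < e.

(* z0 is a zero of order (multiplicity) m of f (m = 0 : not a zero) *)
Definition zero_order (f : R[i] -> R[i]) (z0 : R[i]) (m : nat) : Prop :=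
  exists g : R[i] -> R[i],
    (forall z, f z = (z - z0) ^+ m * g z) /\ g z0 != 0 /\ ccontinuous_at g z0.

Definition zeros_with_mult (f : R[i] -> R[i]) (lam : nat -> R[i]) : Prop :=
  forall mu0 : R[i], exists m : nat, zero_order f mu0 m /\
    exists s : seq nat, [/\ uniq s, size s = m &
      forall n, n \in s <-> ((0 < n)%N /\ lam n = mu0)].

Definition in_l2 (kappa : nat -> R[i]) : Prop :=
  exists M : R, forall N : nat,
    \sum_(1 <= n < N) (ComplexField.Normc.normc (kappa n)) ^+ 2 <= M.

End Defs.

(* Main.v *)
Require Import Defs.
From HB Require Import structures.
From mathcomp Require Import all_boot all_order all_algebra.
From mathcomp Require Import all_classical all_reals all_analysis.
From mathcomp Require Import complex measurable_realfun zify ring lra.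

(** Let [h] be the solution for [q = 0] that satisfies the left boundary
    condition, and [H] its right boundary value.  If [y] satisfies the equation
    and the left condition, then [z = H y - Delta h] satisfies both conditions,
    so its coefficients in the trigonometric eigenfunctions [phi_n] of the
    unperturbed problem are those of [q] divided by [lam - mu_n].  Evaluating
    the Fourier series of [z] at [a] gives
      [Delta = +- H (1 + sum_n b_n / (mu_n - lam))],
    with [b_n = w_n phi_n(a) <q, phi_n>] square summable, and [H] is an infinite
    product over the [mu_n] (Wallis integrals).  The zeros of the secular
    function [1 + sum_n b_n / (mu_n - lam)] that lie near [mu_n] for large [n]
    are found by a contraction; dividing each of them out against its pole
    [mu_n] preserves the shape of the secular function, and in the limit leaves
    a rational function with finitely many poles, whose zeros exist because
    [R[i]] is algebraically closed.  Hence [Delta] is a convergent product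
    [c prod_n (l_n - lam) / d_n], from which zeros and multiplicities are read
    off; [l_n = mu_n] whenever [phi_n(a) = 0], which is the degenerate case. *)

Set Implicit Arguments.
Unset Strict Implicit.
Unset Printing Implicit Defensive.
Import Order.TTheory GRing.Theory Num.Theory.
Import numFieldNormedType.Exports.
Local Open Scope ring_scope.

(** * Complex modulus, sequences and series *)

(** Asymptotic zero counting locates roots for large [n] without tying an index to each; here every
    root inherits the index of the pole that it replaces, and a pole with zero residue keeps its
    place, which makes the numbering exact from the start. The identity for [Delta] is derived off
    the real axis: there [h a] is nonzero and can be cancelled, and no denominator [mu_n - lam]
    vanishes. Continuity of [Delta] in [lam], obtained from a Lipschitz estimate for the solutions,
    then extends the product formula to all [lam]. The point [a] may be the endpoint [pi], where the
    kernel used for interior points degenerates; this forces a second kernel in the pointwise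
    Fourier expansion. Trigonometric functions of complex frequency are described by their
    differential equations and built from the given [Sf]. *)

Notation nc := ComplexField.Normc.normc.

Section ComplexNorm.
Variable R : realType.
Implicit Types x y z : R[i].

Lemma nc_ge0 z : 0 <= nc z.
Proof. by case: z => a b; exact: sqrtr_ge0. Qed.

Lemma ncM x y : nc (x * y) = nc x * nc y.
Proof. exact: ComplexField.Normc.normcM. Qed.

Lemma ncD x y : nc (x + y) <= nc x + nc y.
Proof. exact: le_normcD. Qed.

Lemma ncN x : nc (- x) = nc x.
Proof. exact: normcN. Qed.

Lemma ncBC x y : nc (x - y) = nc (y - x).
Proof. by rewrite -ncN opprB. Qed.

Lemma ncB x y : nc (x - y) <= nc x + nc y.
Proof. by rewrite -(ncN y); exact: ncD. Qed.

Lemma nc0 : nc (0 : R[i]) = 0.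
Proof. exact: ComplexField.Normc.normc0. Qed.

Lemma nc1 : nc (1 : R[i]) = 1.
Proof. exact: ComplexField.Normc.normc1. Qed.

Lemma ncV x : nc x^-1 = (nc x)^-1.
Proof. exact: ComplexField.Normc.normcV. Qed.

Lemma nc_eq0 x : (nc x == 0) = (x == 0).
Proof.
by apply/eqP/eqP => [/ComplexField.Normc.eq0_normc //|->]; exact: nc0.
Qed.

Lemma nc_gt0 x : (0 < nc x) = (x != 0).
Proof. by rewrite lt_neqAle nc_ge0 andbT eq_sym nc_eq0. Qed.

Lemma nc_real (r : R) : nc r%:C%C = `|r|.
Proof. by rewrite /= expr0n /= addr0 sqrtr_sqr. Qed.

Lemma nc_nat n : nc (n%:R : R[i]) = n%:R.
Proof.
have -> : (n%:R : R[i]) = (n%:R : R)%:C%C by rewrite rmorph_nat.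
by rewrite nc_real ger0_norm.
Qed.

Lemma nc_sum I (s : seq I) (P : pred I) (F : I -> R[i]) :
  nc (\sum_(i <- s | P i) F i) <= \sum_(i <- s | P i) nc (F i).
Proof.
elim/big_rec2: _ => [|i y x _ IH]; first by rewrite nc0.
by apply: le_trans (ncD _ _) _; rewrite lerD2l.
Qed.

Lemma nc_prod I (s : seq I) (P : pred I) (F : I -> R[i]) :
  nc (\prod_(i <- s | P i) F i) = \prod_(i <- s | P i) nc (F i).
Proof. by apply: (big_morph _ ncM nc1). Qed.

Lemma nc_geRe z : `|complex.Re z| <= nc z.
Proof.
case: z => a b /=; rewrite -[X in X <= _]sqrtr_sqr.
by rewrite ler_wsqrtr // lerDl sqr_ge0.
Qed.

Lemma nc_geIm z : `|complex.Im z| <= nc z.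
Proof.
case: z => a b /=; rewrite -[X in X <= _]sqrtr_sqr.
by rewrite ler_wsqrtr // lerDr sqr_ge0.
Qed.

Lemma complexRI z : z = (complex.Re z)%:C%C + 'i%C * (complex.Im z)%:C%C.
Proof. by case: z => a b; simpc. Qed.

Lemma nc_leD z : nc z <= `|complex.Re z| + `|complex.Im z|.
Proof.
rewrite {1}[z]complexRI; apply: le_trans (ncD _ _) _.
by rewrite ncM !nc_real /= expr0n /= add0r expr1n sqrtr1 mul1r.
Qed.

Lemma nc_sqr z : nc z ^+ 2 = complex.Re z ^+ 2 + complex.Im z ^+ 2.
Proof. by case: z => a b /=; rewrite sqr_sqrtr // addr_ge0 // sqr_ge0. Qed.

Lemma nc_distD x y z : nc (x - z) <= nc (x - y) + nc (y - z).
Proof. by rewrite -[x - z](subrKA y); exact: ncD. Qed.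

Lemma nc_subr_ge x y : nc x - nc y <= nc (x - y).
Proof. by rewrite lerBlDr -{1}(subrK y x); exact: ncD. Qed.

End ComplexNorm.

Section RealSums.
Variable R : realType.
Implicit Types v w : nat -> R.

(** For nonnegative terms a bound on the partial sums is summability, stated without naming the
    sum. *)
Definition bseries v := exists M : R, forall N, \sum_(i < N) v i <= M.

Lemma bseries_le v w : (forall n, v n <= w n) -> bseries w -> bseries v.
Proof.
move=> vw [M hM]; exists M => N; apply: le_trans (hM N).
by apply: ler_sum => i _; exact: vw.
Qed.

Lemma bseriesZ v (k : R) : 0 <= k -> bseries v -> bseries (fun n => k * v n).
Proof.
move=> k0 [M hM]; exists (k * M) => N.
by rewrite -mulr_sumr ler_wpM2l.
Qed.

Lemma bseriesD v w : bseries v -> bseries w ->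
  bseries (fun n => v n + w n).
Proof.
move=> [M hM] [M' hM']; exists (M + M') => N.
by rewrite big_split lerD.
Qed.

(** [N0] is an index whose partial sum is within [e] of the supremum, so the bound holds for every
    upper end [N] at once. *)
Lemma bseries_tail v : (forall n, 0 <= v n) -> bseries v ->
  forall e : R, 0 < e -> exists N0, forall N, \sum_(N0 <= i < N) v i < e.
Proof.
move=> v0 [M hM] e e0.
pose S := [set x | exists N, x = \sum_(i < N) v i]%classic.
have hS : has_sup S.
  split; first by exists 0; exists 0%N; rewrite big_ord0.
  by exists M => x [N ->].
have [x [N0 ->] hx] := sup_adherent e0 hS.
exists N0 => N; have [NN0|NN0] := leqP N N0; first by rewrite big_geq.
have h1 : \sum_(i < N) v i <= sup S by apply: sup_upper_bound => //; exists N.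
rewrite -!(big_mkord xpredT) in hx h1.
rewrite (big_cat_nat (n := N0)) //= in h1; last exact: ltnW.
lra.
Qed.

End RealSums.

Section ComplexSequences.
Variable R : realType.
Implicit Types (u v : nat -> R[i]) (x y l : R[i]).

Definition ccvg u l := forall e : R, 0 < e ->
  exists N, forall n, (N <= n)%N -> nc (u n - l) < e.

Lemma ccvg_cst l : ccvg (fun=> l) l.
Proof. by move=> e e0; exists 0%N => n _; rewrite subrr nc0. Qed.

Lemma eq_ccvg u v l : (forall n, u n = v n) -> ccvg u l -> ccvg v l.
Proof. by move=> uv hu e /hu [N hN]; exists N => n; rewrite -uv; exact: hN. Qed.

Lemma eq_ccvg_near u v l N0 : (forall n, (N0 <= n)%N -> u n = v n) ->
  ccvg u l -> ccvg v l.
Proof.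
move=> uv hu e /hu [N hN]; exists (maxn N N0) => n; rewrite geq_max => /andP[h1 h2].
by rewrite -uv //; exact: hN.
Qed.

Lemma ccvg_le u l (r : nat -> R) : (forall n, nc (u n - l) <= r n) ->
  (forall e : R, 0 < e -> exists N, forall n, (N <= n)%N -> r n < e) -> ccvg u l.
Proof.
move=> ur hr e /hr [N hN]; exists N => n /hN; exact: le_lt_trans.
Qed.

Lemma ccvgD u v x y : ccvg u x -> ccvg v y -> ccvg (fun n => u n + v n) (x + y).
Proof.
move=> hu hv e e0; have e2 : 0 < e / 2 by lra.
have [N hN] := hu _ e2; have [N' hN'] := hv _ e2.
exists (maxn N N') => n; rewrite geq_max => /andP[/hN h1 /hN' h2].
rewrite opprD addrACA; apply: le_lt_trans (ncD _ _) _; lra.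
Qed.

Lemma ccvg_bounded u l : ccvg u l -> exists2 M, 0 < M & forall n, nc (u n) <= M.
Proof.
move=> hu; have [N hN] := hu 1 ltr01.
exists (1 + nc l + \sum_(i < N) nc (u i)).
  rewrite -addrA ltr_pwDl // addr_ge0 ?nc_ge0 //.
  by apply: sumr_ge0 => *; exact: nc_ge0.
move=> n; have [nN|nN] := leqP N n.
  have := hN _ nN; have := nc_subr_ge (u n) l.
  have : 0 <= \sum_(i < N) nc (u i) by apply: sumr_ge0 => *; exact: nc_ge0.
  lra.
rewrite (bigD1 (Ordinal nN)) //=.
have : 0 <= \sum_(i < N | i != Ordinal nN) nc (u i).
  by apply: sumr_ge0 => *; exact: nc_ge0.
have := nc_ge0 l; lra.
Qed.

Lemma ccvg0_bM u v (M : R) : (forall n, nc (u n) <= M) -> ccvg v 0 ->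
  ccvg (fun n => u n * v n) 0.
Proof.
move=> hu hv e e0.
have M1 : 0 < `|M| + 1 by have := normr_ge0 M; lra.
have [N hN] := hv (e / (`|M| + 1)) (divr_gt0 e0 M1).
exists N => n /hN; rewrite !subr0 ncM ltr_pdivlMr // => h.
apply: le_lt_trans h; rewrite mulrC ler_wpM2l ?nc_ge0 //.
apply: le_trans (hu n) _; have := ler_norm M; lra.
Qed.

Lemma ccvg_sub0 u l : ccvg (fun n => u n - l) 0 -> ccvg u l.
Proof. by move=> h e /h [N hN]; exists N => n /hN; rewrite subr0. Qed.

Lemma ccvg_sub u l : ccvg u l -> ccvg (fun n => u n - l) 0.
Proof. by move=> h e /h [N hN]; exists N => n /hN; rewrite subr0. Qed.

Lemma ccvgZ u x k : ccvg u x -> ccvg (fun n => k * u n) (k * x).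
Proof.
move=> hu; apply: ccvg_sub0; apply: (eq_ccvg (u := fun n => k * (u n - x))).
  by move=> n; rewrite mulrBr.
exact: (@ccvg0_bM (fun=> k) _ (nc k)) (ccvg_sub hu).
Qed.

Lemma ccvgN u x : ccvg u x -> ccvg (fun n => - u n) (- x).
Proof.
move=> hu; rewrite -mulN1r; apply: eq_ccvg (ccvgZ (-1) hu) => n.
by rewrite mulN1r.
Qed.

Lemma ccvgB u v x y : ccvg u x -> ccvg v y -> ccvg (fun n => u n - v n) (x - y).
Proof. by move=> hu hv; apply: ccvgD => //; exact: ccvgN. Qed.

Lemma ccvgM u v x y : ccvg u x -> ccvg v y -> ccvg (fun n => u n * v n) (x * y).
Proof.
move=> hu hv; have [M _ hM] := ccvg_bounded hu.
apply: ccvg_sub0.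
apply: (eq_ccvg (u := fun n => u n * (v n - y) + y * (u n - x))).
  by move=> n; ring.
rewrite -(addr0 0); apply: ccvgD.
  exact: ccvg0_bM hM (ccvg_sub hv).
exact: (@ccvg0_bM (fun=> y) _ (nc y)) (ccvg_sub hu).
Qed.

Lemma ccvg_unique u x y : ccvg u x -> ccvg u y -> x = y.
Proof.
move=> hx hy; apply/eqP; rewrite -subr_eq0 -nc_eq0; apply: contraT => h.
have e0 : 0 < nc (x - y) / 2 by rewrite divr_gt0 // lt_neqAle eq_sym h nc_ge0.
have [N hN] := hx _ e0; have [N' hN'] := hy _ e0.
have := hN _ (leq_maxl N N'); have := hN' _ (leq_maxr N N').
have := nc_distD x (u (maxn N N')) y; rewrite [nc (x - u _)]ncBC; lra.
Qed.

Lemma ccvg_nc_le u x (M : R) : ccvg u x -> (forall n, nc (u n) <= M) -> nc x <= M.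
Proof.
move=> hx hM; rewrite leNgt; apply/negP => h.
have e0 : 0 < nc x - M by lra.
have [N hN] := hx _ e0; have := hN _ (leqnn N); have := hM N.
have := nc_subr_ge x (u N); rewrite ncBC; lra.
Qed.

Lemma ccvg_nc_ge u x (m : R) N0 : ccvg u x ->
  (forall n, (N0 <= n)%N -> m <= nc (u n)) -> m <= nc x.
Proof.
move=> hx hM; rewrite leNgt; apply/negP => h.
have e0 : 0 < m - nc x by lra.
have [N hN] := hx _ e0; have := hN _ (leq_maxl N N0).
have := hM _ (leq_maxr N N0).
have := nc_subr_ge (u (maxn N N0)) x; lra.
Qed.

Lemma ccvg_shift u l k : ccvg (fun n => u (n + k)%N) l <-> ccvg u l.
Proof.
split=> h e /h [N hN].
  exists (N + k)%N => n Nn.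
  have kn : (k <= n)%N by apply: leq_trans Nn; rewrite leq_addl.
  by rewrite -(subnK kn); apply: hN; rewrite leq_subRL // addnC.
by exists N => n Nn; apply: hN; apply: leq_trans Nn _; rewrite leq_addr.
Qed.

Lemma ccvg_sum (I : Type) (s : seq I) (F : I -> nat -> R[i]) (l : I -> R[i]) :
  (forall i, ccvg (F i) (l i)) ->
  ccvg (fun n => \sum_(i <- s) F i n) (\sum_(i <- s) l i).
Proof.
move=> h; elim: s => [|i s IH].
  by rewrite big_nil; apply: eq_ccvg (ccvg_cst 0) => n; rewrite big_nil.
rewrite big_cons; apply: eq_ccvg (ccvgD (h i) IH) => n.
by rewrite big_cons.
Qed.

End ComplexSequences.

(** * Absolutely convergent series and infinite products *)

Section SeriesAndProducts.
Variable R : realType.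
Implicit Types (u a b : nat -> R[i]) (c v : nat -> R).

Lemma real_cauchy (x : nat -> R) :
  (forall e : R, 0 < e -> exists N, forall n, (N <= n)%N -> `|x n - x N| < e) ->
  exists l : R, forall e : R, 0 < e ->
    exists N, forall n, (N <= n)%N -> `|x n - l| < e.
Proof.
move=> h.
have /cauchy_cvgP hc : cauchy (x @ \oo)%classic.
  apply: cauchy_exP => e e0; have [N hN] := h e e0.
  exists (x N); exists N => // n /= Nn; rewrite /ball /= distrC; exact: hN.
exists (lim (x @ \oo)%classic) => e e0.
have /cvgrPdist_lt/(_ e e0) [N _ hN] := hc.
by exists N => n Nn; rewrite distrC; exact: hN.
Qed.

Lemma complex_cauchy u :
  (forall e : R, 0 < e -> exists N, forall n, (N <= n)%N -> nc (u n - u N) < e) ->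
  exists l, ccvg u l.
Proof.
move=> h.
have [|x hx] := @real_cauchy (fun n => complex.Re (u n)).
  move=> e /h [N hN]; exists N => n /hN; apply: le_lt_trans.
  by apply: le_trans (nc_geRe _); rewrite raddfB.
have [|y hy] := @real_cauchy (fun n => complex.Im (u n)).
  move=> e /h [N hN]; exists N => n /hN; apply: le_lt_trans.
  by apply: le_trans (nc_geIm _); rewrite raddfB.
exists (Complex x y) => e e0; have e2 : 0 < e / 2 by lra.
have [N hN] := hx _ e2; have [N' hN'] := hy _ e2.
exists (maxn N N') => n; rewrite geq_max => /andP[/hN h1 /hN' h2].
apply: le_lt_trans (nc_leD _) _; rewrite !raddfB /=; lra.
Qed.

Lemma series_ccvg u v : (forall n, nc (u n) <= v n) -> bseries v ->
  exists s, ccvg (fun N => \sum_(i < N) u i) s.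
Proof.
move=> uv hv; apply: complex_cauchy => e e0.
have v0 n : 0 <= v n by apply: le_trans (uv n); exact: nc_ge0.
have [N hN] := bseries_tail v0 hv e0.
exists N => n Nn; rewrite -!(big_mkord xpredT u) (big_cat_nat (n := N)) //=.
rewrite addrAC subrr add0r; apply: le_lt_trans (nc_sum _ _ _) _.
by apply: le_lt_trans (hN n); apply: ler_sum => i _; exact: uv.
Qed.

Lemma series_nc_le u v s (M : R) : ccvg (fun N => \sum_(i < N) u i) s ->
  (forall n, nc (u n) <= v n) -> (forall N, \sum_(i < N) v i <= M) -> nc s <= M.
Proof.
move=> hs uv hM; apply: ccvg_nc_le hs _ => N.
apply: le_trans (nc_sum _ _ _) _; apply: le_trans (hM N).
by apply: ler_sum.
Qed.

Lemma prod_le_expR (I : Type) (s : seq I) (P : pred I) (c : I -> R) :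
  (forall i, 0 <= c i) ->
  0 <= \prod_(i <- s | P i) (1 + c i) <= expR (\sum_(i <- s | P i) c i).
Proof.
move=> c0; elim/big_rec2: _ => [|i y x _ /andP[h1 h2]].
  by rewrite expR0 ler01 lexx.
have h3 : 0 <= 1 + c i by rewrite addr_ge0.
rewrite expRD mulr_ge0 //= ler_pM //.
exact: expR_ge1Dx.
Qed.

Lemma nc_prod1D_le (I : Type) (s : seq I) (P : pred I) (a : I -> R[i]) (c : I -> R) :
  (forall i, nc (a i) <= c i) ->
  nc (\prod_(i <- s | P i) (1 + a i)) <= expR (\sum_(i <- s | P i) c i).
Proof.
move=> ac; rewrite nc_prod.
have c0 i : 0 <= c i by apply: le_trans (ac i); exact: nc_ge0.
have /andP[_] := prod_le_expR s P c0; apply: le_trans.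
apply: ler_prod => i _; rewrite nc_ge0 /=.
by apply: le_trans (ncD _ _) _; rewrite nc1 lerD2l.
Qed.

(** The partial products [P N] are at most [expR M] in modulus, so their increments [P N * a N] form
    an absolutely convergent series. *)
Lemma prod_ccvg a c : (forall n, nc (a n) <= c n) -> bseries c ->
  exists p, ccvg (fun N => \prod_(i < N) (1 + a i)) p.
Proof.
move=> ac [M hM].
pose P N := \prod_(i < N) (1 + a i).
have hP N : nc (P N) <= expR M.
  have h := @nc_prod1D_le 'I_N (index_enum 'I_N) xpredT a c (fun i => ac i).
  by apply: le_trans h _; rewrite ler_expR; exact: hM.
have [| |s hs] := @series_ccvg (fun n => P n * a n) (fun n => expR M * c n).
- by move=> n; rewrite ncM ler_pM ?nc_ge0.
- by apply: bseriesZ; [exact: expR_ge0 | exists M].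
exists (1 + s); apply: eq_ccvg (ccvgD (ccvg_cst 1) hs) => N.
elim: N => [|N IH]; first by rewrite !big_ord0 addr0.
by rewrite !big_ord_recr /= addrA IH /P; ring.
Qed.

(** Weierstrass's inequality. The bound [1 / 2] keeps [1 - c i] and the running lower bound
    nonnegative, so that they can be multiplied. *)
Lemma nc_prod_ge (I : Type) (s : seq I) (a : I -> R[i]) (c : I -> R) :
  (forall i, nc (a i) <= c i) -> \sum_(i <- s) c i <= 1 / 2 ->
  1 - \sum_(i <- s) c i <= nc (\prod_(i <- s) (1 + a i)).
Proof.
move=> ac; have c0 i : 0 <= c i by apply: le_trans (ac i); exact: nc_ge0.
elim: s => [|i s IH]; first by rewrite !big_nil nc1 subr0.
rewrite !big_cons => h.
have s0 : 0 <= \sum_(j <- s) c j by apply: sumr_ge0.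
have h2 : \sum_(j <- s) c j <= 1 / 2 by have := c0 i; lra.
have := IH h2; set p := nc _ => hp; rewrite ncM -/p.
have h3 : 1 - c i <= nc (1 + a i).
  have := nc_subr_ge 1 (- a i); rewrite nc1 ncN opprK; have := ac i; lra.
have := c0 i => ci0.
apply: le_trans (_ : (1 - c i) * (1 - \sum_(j <- s) c j) <= _); first by nra.
by apply: ler_pM => //; lra.
Qed.

(** Past an index where the tail of [c] is below [1 / 2] the remaining product has modulus at least
    [1 / 2], and the finitely many factors before it are nonzero. *)
Lemma prod_ccvg_neq0 a c p : (forall n, nc (a n) <= c n) -> bseries c ->
  (forall n, 1 + a n != 0) ->
  ccvg (fun N => \prod_(i < N) (1 + a i)) p -> p != 0.
Proof.
move=> ac hc a0 hp.
have c0 n : 0 <= c n by apply: le_trans (ac n); exact: nc_ge0.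
have h2 : 0 < 1 / 2 :> R by lra.
have [N0 hN0] := bseries_tail c0 hc h2.
rewrite -nc_gt0.
apply: lt_le_trans (_ : 0 < nc (\prod_(i < N0) (1 + a i)) * (1 / 2)) _.
  apply: mulr_gt0 => //; rewrite nc_gt0 prodf_seq_neq0.
  by apply/allP => i _ /=; exact: a0.
apply: (ccvg_nc_ge (N0 := N0) hp) => n N0n.
rewrite -!(big_mkord xpredT (fun i => 1 + a i)) [in leRHS](big_cat_nat (n := N0)) //= ncM.
apply: ler_wpM2l; first exact: nc_ge0.
have h := hN0 n.
apply: le_trans (nc_prod_ge ac (ltW h)); lra.
Qed.

(* Telescoping: replace one factor at a time. *)
Lemma nc_prod_sub_le (I : Type) (s : seq I) (a b : I -> R[i]) (c : I -> R) :
  (forall i, nc (a i) <= c i) -> (forall i, nc (b i) <= c i) ->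
  nc (\prod_(i <- s) (1 + a i) - \prod_(i <- s) (1 + b i)) <=
  expR (\sum_(i <- s) c i) * \sum_(i <- s) nc (a i - b i).
Proof.
move=> ac bc; have c0 i : 0 <= c i by apply: le_trans (ac i); exact: nc_ge0.
elim: s => [|i s IH]; first by rewrite !big_nil subrr nc0 mulr0.
rewrite !big_cons.
have -> : forall x y z w : R[i], (1 + x) * y - (1 + z) * w =
    (x - z) * y + (1 + z) * (y - w) by move=> x y z w; ring.
apply: le_trans (ncD _ _) _; rewrite [leRHS]mulrDr expRD !ncM.
have E := expR_ge1Dx (c i); have ci0 := c0 i.
have E0 := expR_ge0 (\sum_(j <- s) c j).
have S0 : 0 <= \sum_(j <- s) nc (a j - b j) by apply: sumr_ge0 => *; exact: nc_ge0.
apply: lerD.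
  rewrite mulrC ler_wpM2r ?nc_ge0 //.
  apply: le_trans (nc_prod1D_le s xpredT ac) _.
  by rewrite ler_peMl //; lra.
rewrite -mulrA ler_pM ?nc_ge0 //.
have := ncD 1 (b i); rewrite nc1; have := bc i; lra.
Qed.

End SeriesAndProducts.

Section FixedPoint.
Variable R : realType.

Lemma bseries_geom : bseries (fun n => (1 / 2 : R) ^+ n).
Proof.
exists 2 => N.
suff -> : \sum_(i < N) (1 / 2 : R) ^+ i = 2 - 2 * (1 / 2) ^+ N.
  have : 0 <= (1 / 2 : R) ^+ N by apply: exprn_ge0; lra.
  lra.
elim: N => [|N IH]; first by rewrite big_ord0 expr0; lra.
by rewrite big_ord_recr /= IH exprS; lra.
Qed.

(** Banach's argument with ratio [1 / 2]: the iterates of [T] from the centre [c] have increments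
    dominated by a geometric series. *)
Lemma contraction_fixpoint (T : R[i] -> R[i]) (c : R[i]) (r : R) :
  0 <= r -> (forall z, nc (z - c) <= r -> nc (T z - c) <= r) ->
  (forall z w, nc (z - c) <= r -> nc (w - c) <= r ->
     nc (T z - T w) <= 1 / 2 * nc (z - w)) ->
  exists2 z, nc (z - c) <= r & T z = z.
Proof.
move=> r0 Tr TL; pose x n := iter n T c.
have hx n : nc (x n - c) <= r.
  by elim: n => [|n IH]; [rewrite subrr nc0 | exact: Tr].
have hd n : nc (x n.+1 - x n) <= r * (1 / 2) ^+ n.
  elim: n => [|n IH]; first by rewrite expr0 mulr1; exact: hx 1%N.
  have := TL _ _ (hx n.+1) (hx n); rewrite exprS /=; lra.
have [s hs] := series_ccvg hd (bseriesZ r0 bseries_geom).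
have hz : ccvg x (c + s).
  apply: eq_ccvg (ccvgD (ccvg_cst c) hs) => n.
  elim: n => [|n IH]; first by rewrite big_ord0 addr0.
  by rewrite big_ord_recr /= addrA IH addrC subrK.
have hzr : nc (c + s - c) <= r.
  exact: ccvg_nc_le (ccvgB hz (ccvg_cst c)) hx.
exists (c + s) => //; apply: (ccvg_unique (u := fun n => x n.+1)).
  move=> e e0; have [N hN] := hz e e0; exists N => n Nn.
  have := TL _ _ (hx n) hzr; have := hN n Nn; have := nc_ge0 (x n - (c + s)).
  rewrite /=; lra.
by apply: eq_ccvg ((ccvg_shift x _ 1).2 hz) => n; rewrite addn1.
Qed.

End FixedPoint.

Section InverseSquares.
Variable R : realType.

(** The value 0 on the diagonal drops the excluded pole from a sum without a side condition. *)
Definition invdist (n m : nat) : R := if m == n then 0 else `|m%:R - n%:R|^-1.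

Lemma invdist_ge0 n m : 0 <= invdist n m.
Proof. by rewrite /invdist; case: eqP => // _; rewrite invr_ge0. Qed.

Lemma natr_dist_ge1 (m n : nat) : m != n -> 1 <= `|m%:R - n%:R| :> R.
Proof.
wlog mn : m n / (m < n)%N.
  by move=> H; case: ltngtP => // h _; [|rewrite distrC]; apply: H; rewrite ?ltn_eqF.
move=> _; rewrite distrC -natrB ?(ltnW mn) // ger0_norm //.
by rewrite ler1n subn_gt0.
Qed.

Lemma invdist_le1 n m : invdist n m <= 1.
Proof.
rewrite /invdist; case: eqP => // /eqP h.
by rewrite invf_le1 ?natr_dist_ge1 // (lt_le_trans ltr01) // natr_dist_ge1.
Qed.

(** Since [1 / d ^ 2 <= 2 / d - 2 / (d + 1)], the indices on either side of [n] telescope to at most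
    2. *)
Lemma sum_invdist_sqr n N : \sum_(m < N) invdist n m ^+ 2 <= 4.
Proof.
have step (d : nat) : (0 < d)%N ->
    2 / (d%:R + 1) + d%:R^-1 ^+ 2 <= 2 / d%:R :> R.
  move=> d0; have d1 : 1 <= d%:R :> R by rewrite ler1n.
  rewrite -subr_ge0.
  have -> : 2 / d%:R - (2 / (d%:R + 1) + d%:R^-1 ^+ 2) =
    (d%:R - 1) / (d%:R ^+ 2 * (d%:R + 1)) :> R.
    by field; apply/andP; split; lra.
  by apply: divr_ge0; nra.
have low k : (k <= n)%N ->
    \sum_(m < k) invdist n m ^+ 2 <= 2 / ((n - k)%:R + 1).
  clear N; elim: k => [|N IH] Nn; first by rewrite big_ord0 divr_ge0 // addr_ge0.
  rewrite big_ord_recr /=; have h0 : (0 < n - N)%N by rewrite subn_gt0.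
  have := IH (ltnW Nn); have := step _ h0.
  have -> : invdist n N = (n - N)%:R^-1.
    by rewrite /invdist ltn_eqF // distrC -natrB ?(ltnW Nn) // ger0_norm.
  have -> : (n - N.+1)%:R + 1 = (n - N)%:R :> R.
    by rewrite subnS -[in RHS](prednK h0) -natr1.
  lra.
have [Nn|nN] := leqP N n.
  apply: le_trans (low _ Nn) _; rewrite ler_pdivrMr ?ltr_wpDl //.
  have : 0 <= (n - N)%:R :> R by []. lra.
suff : \sum_(m < N) invdist n m ^+ 2 <= 4 - 2 / (N - n)%:R.
  have : 0 <= 2 / (N - n)%:R :> R by rewrite divr_ge0. lra.
elim: N nN => // N IH; rewrite ltnS leq_eqVlt big_ord_recr /=.
move=> /orP[/eqP nN|nN].
  rewrite -nN subSnn /invdist eqxx expr0n /= addr0.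
  by have := low n (leqnn n); rewrite subnn add0r !divr1; lra.
have h0 : (0 < N - n)%N by rewrite subn_gt0.
have := IH nN; have := step _ h0.
have -> : invdist n N = (N - n)%:R^-1.
  by rewrite /invdist gtn_eqF // -natrB ?(ltnW nN) // ger0_norm.
have -> : (N.+1 - n)%:R = (N - n)%:R + 1 :> R by rewrite subSn ?(ltnW nN) // natr1.
lra.
Qed.

End InverseSquares.

(** * Zeros of secular functions *)

Section Secular.
Variable R : realType.
Variables (mu : nat -> R) (b : nat -> R[i]).
Hypothesis gap : forall m n, `|m%:R - n%:R| * n%:R <= `|mu m - mu n|.
Hypothesis b2 : bseries (fun n => nc (b n) ^+ 2).

Notation muC n := (mu n)%:C%C.
Definition csum (u : nat -> R[i]) s := ccvg (fun N => \sum_(i < N) u i) s.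

Lemma nc_muB m n : nc (muC m - muC n) = `|mu m - mu n|.
Proof. by rewrite -rmorphB nc_real. Qed.

(** The factor [n] in [gap] drives all other poles away from [mu n] as [n] grows; the resulting
    [1 / n] makes the fixed-point map of [roots_near] a contraction for large [n]. *)
Lemma near_mu n m z : (0 < n)%N -> m != n -> nc (z - muC n) <= 1 / 2 ->
  muC m - z != 0 /\ nc (muC m - z)^-1 <= 2 / n%:R * invdist R n m.
Proof.
move=> n0 mn hz; have h1 := natr_dist_ge1 R mn.
have hn : 1 <= n%:R :> R by rewrite ler1n.
have h2 : `|m%:R - n%:R| * n%:R / 2 <= nc (muC m - z).
  have := gap m n; have := nc_distD (muC m) z (muC n); rewrite nc_muB; nra.
have h3 : 0 < `|m%:R - n%:R| * n%:R / 2 :> R by nra.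
have h4 := lt_le_trans h3 h2.
split; first by rewrite -nc_gt0.
rewrite ncV /invdist (negbTE mn).
have -> : 2 / n%:R * `|m%:R - n%:R|^-1 = (`|m%:R - n%:R| * n%:R / 2)^-1 :> R.
  by field; apply/andP; split; lra.
by rewrite lef_pV2 ?posrE.
Qed.

(** From [x * y <= x ^ 2 + y ^ 2] term by term, which makes the bound independent of [n]. *)
Lemma sum_b_invdist : exists2 K, 0 <= K &
  forall n N, \sum_(m < N) nc (b m) * invdist R n m <= K.
Proof.
have [M hM] := b2; exists (M + 4).
  by have := hM 0%N; rewrite big_ord0; lra.
move=> n N; apply: le_trans (lerD (hM N) (sum_invdist_sqr R n N)).
rewrite -big_split /=; apply: ler_sum => i _.
have := nc_ge0 (b i); have := invdist_ge0 R n i; nra.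
Qed.

Lemma b_small : exists N, forall n, (N <= n)%N -> nc (b n) <= 1 / 4.
Proof.
have h16 : 0 < 1 / 16 :> R by lra.
have [|N hN] := bseries_tail _ b2 h16; first by move=> n; exact: sqr_ge0.
exists N => n Nn; have := hN n.+1; rewrite big_nat_recr //=.
have : 0 <= \sum_(N <= i < n) nc (b i) ^+ 2.
  by apply: sumr_ge0 => i _; exact: sqr_ge0.
have := nc_ge0 (b n); nra.
Qed.

(** The secular sum without its [n]th term. The limit is picked by [xget]; [offsumP] shows that it
    exists near [mu n]. *)
Definition offsum n z : R[i] :=
  xget 0 [set s | csum (fun m => if m == n then 0 else b m / (muC m - z)) s]%classic.

Lemma offsumP n z : (0 < n)%N -> nc (z - muC n) <= 1 / 2 ->
  csum (fun m => if m == n then 0 else b m / (muC m - z)) (offsum n z).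
Proof.
move=> n0 hz; have [K K0 hK] := sum_b_invdist.
have [| |s hs] := @series_ccvg R
    (fun m => if m == n then 0 else b m / (muC m - z))
    (fun m => 2 / n%:R * (nc (b m) * invdist R n m)).
- move=> m; case: eqP => [_|/eqP mn].
    by rewrite nc0 !mulr_ge0 ?nc_ge0 ?invdist_ge0 ?invr_ge0.
  rewrite ncM mulrCA ler_wpM2l ?nc_ge0 //.
  by have [] := near_mu n0 mn hz.
- by apply: bseriesZ; [rewrite divr_ge0 | exists K => N; exact: hK].
exact: (xgetPex 0 (ex_intro _ s hs)).
Qed.

Lemma offsum_le K n z : (0 < n)%N -> nc (z - muC n) <= 1 / 2 ->
  (forall n N, \sum_(m < N) nc (b m) * invdist R n m <= K) ->
  nc (offsum n z) <= 2 / n%:R * K.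
Proof.
move=> n0 hz hK.
apply: (series_nc_le (offsumP n0 hz) (v := fun m => 2 / n%:R * (nc (b m) * invdist R n m))).
  move=> m; case: eqP => [_|/eqP mn].
    by rewrite nc0 !mulr_ge0 ?nc_ge0 ?invdist_ge0 ?invr_ge0.
  rewrite ncM mulrCA ler_wpM2l ?nc_ge0 //.
  by have [] := near_mu n0 mn hz.
by move=> N; rewrite -mulr_sumr ler_wpM2l ?divr_ge0.
Qed.

(** The difference of two resolvent terms carries two factors [invdist]: one is kept for the
    summation, the other is bounded by 1. *)
Lemma offsum_lip K n z w : (0 < n)%N ->
  nc (z - muC n) <= 1 / 2 -> nc (w - muC n) <= 1 / 2 ->
  (forall n N, \sum_(m < N) nc (b m) * invdist R n m <= K) ->
  nc (offsum n z - offsum n w) <= (2 / n%:R) ^+ 2 * K * nc (z - w).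
Proof.
move=> n0 hz hw hK.
have hsum := ccvgB (offsumP n0 hz) (offsumP n0 hw).
have {}hsum : csum (fun m => (if m == n then 0 else b m / (muC m - z)) -
   (if m == n then 0 else b m / (muC m - w))) (offsum n z - offsum n w).
  by apply: eq_ccvg hsum => N; rewrite sumrB.
have C0 : 0 <= (2 / n%:R) ^+ 2 * nc (z - w) by rewrite mulr_ge0 ?nc_ge0 ?sqr_ge0.
apply: (series_nc_le hsum
  (v := fun m => (2 / n%:R) ^+ 2 * nc (z - w) * (nc (b m) * invdist R n m))).
  move=> m; case: eqP => [_|/eqP mn].
    by rewrite subrr nc0 !mulr_ge0 ?sqr_ge0 ?nc_ge0 ?invdist_ge0 ?invr_ge0.
  have [z0 hz'] := near_mu n0 mn hz; have [w0 hw'] := near_mu n0 mn hw.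
  have -> : b m / (muC m - z) - b m / (muC m - w) =
     b m * (z - w) * ((muC m - z)^-1 * (muC m - w)^-1).
    by field; rewrite z0 w0.
  rewrite !ncM -mulrA.
  apply: le_trans (_ : nc (b m) * (nc (z - w) *
     ((2 / n%:R * invdist R n m) * (2 / n%:R * invdist R n m))) <= _).
    rewrite ler_wpM2l ?nc_ge0 // ler_wpM2l ?nc_ge0 //.
    by rewrite ler_pM ?nc_ge0.
  have h1 := invdist_le1 R n m; have h2 := invdist_ge0 R n m.
  have -> : nc (b m) * (nc (z - w) * (2 / n%:R * invdist R n m * (2 / n%:R * invdist R n m)))
    = ((2 / n%:R) ^+ 2 * nc (z - w)) * (nc (b m) * (invdist R n m * invdist R n m)).
    by ring.
  apply: ler_wpM2l => //; apply: ler_wpM2l; first exact: nc_ge0.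
  by rewrite ler_piMl.
by move=> N; rewrite -mulr_sumr [leRHS]mulrAC ler_wpM2l.
Qed.

(** Isolating the [n]th pole turns the secular equation into [z = mu n + b n / (1 + offsum n z)], a
    fixed-point equation on the disc of radius [1 / 2] around [mu n]. *)
Lemma roots_near : exists2 n0, (1 < n0)%N & exists lam : nat -> R[i],
  forall n, (n0 <= n)%N ->
  [/\ nc (lam n - muC n) <= 2 * nc (b n), nc (lam n - muC n) <= 1 / 2,
      b n = 0 -> lam n = muC n &
      b n != 0 -> lam n != muC n /\ csum (fun m => b m / (muC m - lam n)) (-1)].
Proof.
have [K K0 hK] := sum_b_invdist; have [N hN] := b_small.
(* Beyond [N] the residue is at most [1 / 4]; beyond [8 * K] both [offsum] and its Lipschitz
   constant are at most [1 / 2] on the disc. *)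
have [n0 n02 [n0N n0K]] : exists2 n0, (1 < n0)%N &
    (N <= n0)%N /\ (Num.truncn (8 * K + 1) < n0)%N.
  by exists (N + 2 + Num.truncn (8 * K + 1)).+1; lia.
exists n0 => //.
pose root n z := [/\ nc (z - muC n) <= 2 * nc (b n), nc (z - muC n) <= 1 / 2,
  b n = 0 -> z = muC n &
  b n != 0 -> z != muC n /\ csum (fun m => b m / (muC m - z)) (-1)].
suff H n : (n0 <= n)%N -> exists z, root n z.
  have [n|lam hlam] := @choice _ _ (fun n z => (n0 <= n)%N -> root n z).
    by have [/H [z hz]|_] := boolP (n0 <= n)%N; [exists z | exists 0].
  by exists lam => n; exact: hlam.
move=> hn.
have n1 : (0 < n)%N by lia.
have nK : 8 * K <= n%:R.
  have := truncnS_gt (8 * K + 1).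
  have : (Num.truncn (8 * K + 1)).+1%:R <= n%:R :> R by rewrite ler_nat; lia.
  lra.
have n1R : 2 <= n%:R :> R by rewrite ler_nat; lia.
have bn : nc (b n) <= 1 / 4 by apply: hN; lia.
have K2 : 2 / n%:R * K <= 1 / 2.
  by rewrite mulrAC ler_pdivrMr; lra.
pose T z := muC n + b n / (1 + offsum n z).
have h1 z : nc (z - muC n) <= 1 / 2 -> 1 / 2 <= nc (1 + offsum n z).
  move=> hz; have := nc_subr_ge 1 (- offsum n z); rewrite ncN nc1 opprK.
  have := offsum_le n1 hz hK; lra.
have hT2 z : nc (z - muC n) <= 1 / 2 -> nc (T z - muC n) <= 2 * nc (b n).
  move=> /h1 h; rewrite /T addrAC subrr add0r ncM ncV mulrC ler_wpM2r ?nc_ge0 //.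
  by rewrite -[2]invrK lef_pV2 ?posrE //; lra.
have [| | |z hz Tz] := @contraction_fixpoint R T (muC n) (1 / 2).
- lra.
- by move=> z /hT2; lra.
- move=> z w hz hw; have hz1 := h1 _ hz; have hw1 := h1 _ hw.
  have oz : 1 + offsum n z != 0 by rewrite -nc_gt0; lra.
  have ow : 1 + offsum n w != 0 by rewrite -nc_gt0; lra.
  have -> : T z - T w = b n * (offsum n w - offsum n z) *
      ((1 + offsum n z)^-1 * (1 + offsum n w)^-1).
    by rewrite /T; field; rewrite oz ow.
  rewrite !ncM !ncV ncBC.
  have i2 x : 1 / 2 <= x -> x^-1 <= 2 :> R.
    by move=> hx; rewrite -[2]invrK lef_pV2 ?posrE //; lra.
  have hl := offsum_lip n1 hz hw hK.
  have C2 : (2 / n%:R) ^+ 2 * K <= 1 / 2.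
    rewrite expr2 -mulrA; apply: le_trans (_ : 1 * (2 / n%:R * K) <= _); last by lra.
    apply: ler_wpM2r; first by rewrite mulr_ge0 ?divr_ge0.
    by rewrite ler_pdivrMr; lra.
  have D0 := nc_ge0 (z - w).
  (* [1 / 4] bounds [b n], [1 / 2] the Lipschitz constant of [offsum], and each 2 an inverse of
     [1 + offsum]; together they give the ratio [1 / 2]. *)
  apply: le_trans (_ : 1 / 4 * (1 / 2 * nc (z - w)) * (2 * 2) <= _); last by lra.
  have iz := i2 _ hz1; have iw := i2 _ hw1.
  have iz0 : 0 <= (nc (1 + offsum n z))^-1 by rewrite invr_ge0 nc_ge0.
  have iw0 : 0 <= (nc (1 + offsum n w))^-1 by rewrite invr_ge0 nc_ge0.
  apply: ler_pM; rewrite ?mulr_ge0 ?nc_ge0 //; last by apply: ler_pM.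
  apply: ler_pM; rewrite ?nc_ge0 //; apply: le_trans hl _.
  by apply: ler_wpM2r.
exists z; split => //.
- by rewrite -{1}Tz; exact: hT2.
- by move=> b0; rewrite -Tz /T b0 mul0r addr0.
move=> b0; have h := h1 _ hz.
have oz : 1 + offsum n z != 0 by rewrite -nc_gt0; lra.
have zE : z - muC n = b n / (1 + offsum n z) by rewrite -{1}Tz /T addrAC subrr add0r.
split; first by rewrite -subr_eq0 zE mulf_neq0 ?invr_eq0.
have hE : b n / (muC n - z) = - (1 + offsum n z).
  by rewrite -opprB zE; field; rewrite oz b0.
have -> : (-1 : R[i]) = offsum n z + - (1 + offsum n z) by ring.
apply: (eq_ccvg_near (N0 := n.+1)); last first.
  exact: ccvgD (offsumP n1 hz) (ccvg_cst (- (1 + offsum n z))).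
move=> M nM; rewrite (bigD1 (Ordinal nM)) //=.
rewrite [X in X - _ = _](bigD1 (Ordinal nM)) //= eqxx add0r hE addrC.
congr (_ + _).
by apply: eq_bigr => i; rewrite -val_eqE /= => /negbTE ->.
Qed.

End Secular.

Section MoreSums.
Variable R : realType.

Lemma invdistC n m : invdist R n m = invdist R m n.
Proof. by rewrite /invdist eq_sym distrC. Qed.

Lemma bseries_near (v w : nat -> R) N0 : (forall n, 0 <= w n) ->
  (forall n, (N0 <= n)%N -> v n <= w n) -> bseries w -> bseries v.
Proof.
move=> w0 vw [M hM]; exists (M + \sum_(i < N0) `|v i|) => N.
have S0 k : 0 <= \sum_(i < k) `|v i| by apply: sumr_ge0.
have [h|h] := leqP N N0.
  have M0 : 0 <= M by apply: le_trans (hM 0%N); rewrite big_ord0.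
  apply: le_trans (_ : \sum_(i < N0) `|v i| <= _); last by rewrite lerDr.
  rewrite -!(big_mkord xpredT (fun i => `|v i|)) -(big_mkord xpredT v).
  rewrite [leRHS](big_cat_nat (n := N)) //=; apply: ler_wpDr.
    by apply: sumr_ge0.
  by apply: ler_sum => i _; exact: ler_norm.
have := hM N; rewrite -!(big_mkord xpredT (fun i => `|v i|)).
rewrite -(big_mkord xpredT v) -(big_mkord xpredT w).
rewrite !(big_cat_nat (n := N0) (m := 0) (p := N)) ?(ltnW h) //=.
have : \sum_(0 <= i < N0) v i <= \sum_(0 <= i < N0) `|v i|.
  by apply: ler_sum => i _; exact: ler_norm.
have : 0 <= \sum_(0 <= i < N0) w i by apply: sumr_ge0.
have : \sum_(N0 <= i < N) v i <= \sum_(N0 <= i < N) w i.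
  by apply: ler_sum_nat => i /andP[h1 _]; exact: vw.
lra.
Qed.

End MoreSums.

(** * Exchanging the poles of the secular function for its roots *)

Section Removal.
Variable R : realType.
Variables (mu : nat -> R) (b : nat -> R[i]).
Hypothesis gap : forall m n, `|m%:R - n%:R| * n%:R <= `|mu m - mu n|.
Hypothesis b2 : bseries (fun n => nc (b n) ^+ 2).
Notation muC n := (mu n)%:C%C.
Variables (n0 : nat) (lam : nat -> R[i]).
Hypothesis n01 : (1 < n0)%N.
Hypothesis hlam : forall n, (n0 <= n)%N ->
  [/\ nc (lam n - muC n) <= 2 * nc (b n), nc (lam n - muC n) <= 1 / 2,
      b n = 0 -> lam n = muC n &
      b n != 0 -> lam n != muC n /\ csum (fun m => b m / (muC m - lam n)) (-1)].

(** For [n0 <= j], [1 + rfac m j] is [(mu j - mu m) / (lam j - mu m)], the factor that the residue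
    at [mu m] gains when the secular function is multiplied by [(mu j - z) / (lam j - z)]. If
    [lam m = mu m], then [0 / 0 = 0] makes [1 + rfac m m] equal to 1, harmlessly, because [b m] is 0
    in that case. *)
Definition rfac m j : R[i] :=
  if (j < n0)%N then 0 else (muC j - lam j) / (lam j - muC m).

(* [beta n m] is the residue at [mu m] once the roots [lam j], [n0 <= j < n],
   have been divided out; it vanishes for [n0 <= m < n]. *)
Definition beta n m : R[i] := b m * \prod_(j < n) (1 + rfac m j).

(** The diagonal term is [-1] or 0, which accounts for the summand [j == m]; off the diagonal the
    bound is summable uniformly in [m]. *)
Lemma rfac_le m j :
  nc (rfac m j) <= (j == m)%:R + 4 * (nc (b j) * invdist R m j).
Proof.
have p0 : 0 <= nc (b j) * invdist R m j.
  by apply: mulr_ge0; [exact: nc_ge0 | exact: invdist_ge0].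
rewrite /rfac; case: ltnP => [_|hj].
  by rewrite nc0 addr_ge0 // mulr_ge0.
have [h1 h2 _ _] := hlam hj.
have [->|jm] := eqVneq j m.
  have : 0 <= nc (b m) * invdist R m m by rewrite mulr_ge0 ?nc_ge0 ?invdist_ge0.
  rewrite mulr1n; have [->|ne] := eqVneq (lam m) (muC m); first by rewrite subrr mul0r nc0; lra.
  rewrite -[X in X / _]opprB mulNr divff ?subr_eq0 // ncN nc1; lra.
have j0 : (0 < j)%N by lia.
have mj : m != j by rewrite eq_sym.
have [d0 hd] := near_mu gap j0 mj h2.
rewrite add0r ncM ncBC -[X in nc X^-1]opprB invrN ncN.
have j1 : 1 <= j%:R :> R by rewrite ler1n.
have hd2 : nc (muC m - lam j)^-1 <= 2 * invdist R m j.
  apply: le_trans hd _; rewrite invdistC; apply: ler_wpM2r; first exact: invdist_ge0.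
  by rewrite ler_pdivrMr; lra.
have -> : 4 * (nc (b j) * invdist R m j) = (2 * nc (b j)) * (2 * invdist R m j).
  by ring.
by apply: ler_pM => //; exact: nc_ge0.
Qed.

Lemma sum_eq_nat (m N : nat) : \sum_(j < N) ((j : nat) == m)%:R <= 1 :> R.
Proof.
have [h|h] := ltnP m N.
  rewrite (bigD1 (Ordinal h)) //= eqxx big1 ?addr0 // => i.
  by rewrite -val_eqE /= => /negbTE ->.
by rewrite big1 // => i _; rewrite ltn_eqF // (leq_trans _ h).
Qed.

Lemma rfac_sum : exists K : R, forall m N,
  \sum_(j < N) ((j == m :> nat)%:R + 4 * (nc (b j) * invdist R m j)) <= K.
Proof.
have [K K0 hK] := sum_b_invdist b2; exists (1 + 4 * K) => m N.
rewrite big_split /= -mulr_sumr lerD ?sum_eq_nat //.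
by apply: ler_wpM2l => //; exact: hK.
Qed.

Lemma beta_le : exists2 E, 0 <= E & forall n m, nc (beta n m) <= E * nc (b m).
Proof.
have [K hK] := rfac_sum; exists (expR K); first exact: expR_ge0.
move=> n m; rewrite ncM mulrC ler_wpM2r ?nc_ge0 //.
have h := @nc_prod1D_le R 'I_n (index_enum 'I_n) xpredT _ _ (fun i => rfac_le m i).
by apply: le_trans h _; rewrite ler_expR; exact: hK.
Qed.

(** Far out [mu m] is at distance at least [m / 2] from [z], so the terms are dominated by
    [nc (b m) ^ 2] plus a multiple of [1 / m ^ 2]. A pole at [z] is one of the finitely many early
    terms and contributes [0^-1 = 0]. *)
Lemma bseries_b z : bseries (fun m => nc (b m) * nc (muC m - z)^-1).
Proof.
pose D := nc (z - muC 0%N).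
pose M0 := (Num.truncn (2 * D)).+1.
have hD0 : 0 <= D by exact: nc_ge0.
apply: (bseries_near (N0 := M0)
  (w := fun m => nc (b m) ^+ 2 + 4 * invdist R 0 m ^+ 2)).
- by move=> n; rewrite addr_ge0 ?sqr_ge0 // mulr_ge0 ?sqr_ge0.
- move=> m hm.
  have m2D : 2 * D <= m%:R.
    have := truncnS_gt (2 * D); have : M0%:R <= m%:R :> R by rewrite ler_nat.
    by rewrite /M0; lra.
  have m0 : (0 < m)%N by apply: leq_trans hm.
  have m1 : 1 <= m%:R :> R by rewrite ler1n.
  have h1 : m%:R / 2 <= nc (muC m - z).
    have := gap 0 m; rewrite distrC subr0 normr_nat => hg.
    have := nc_distD (muC m) z (muC 0%N); rewrite nc_muB distrC -/D; nra.
  have h2 : nc (muC m - z)^-1 <= 2 * invdist R 0 m.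
    rewrite ncV /invdist gtn_eqF // subr0 normr_nat.
    have -> : 2 / m%:R = (m%:R / 2)^-1 :> R by rewrite invf_div.
    by rewrite lef_pV2 ?posrE //; lra.
  have X0 := nc_ge0 (muC m - z)^-1; have B0 := nc_ge0 (b m).
  have h3 : nc (muC m - z)^-1 ^+ 2 <= 4 * invdist R 0 m ^+ 2 by nra.
  nra.
apply: bseriesD => //; apply: bseriesZ => //.
by exists 4 => N; exact: sum_invdist_sqr.
Qed.

Definition rsum n z : R[i] :=
  1 + xget 0 [set s | csum (fun m => beta n m / (muC m - z)) s]%classic.

Lemma rsumP n z : csum (fun m => beta n m / (muC m - z)) (rsum n z - 1).
Proof.
have [E E0 hE] := beta_le.
have [| |s hs] := @series_ccvg R (fun m => beta n m / (muC m - z))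
    (fun m => E * (nc (b m) * nc (muC m - z)^-1)).
- by move=> m; rewrite ncM mulrA ler_wpM2r ?nc_ge0.
- by apply: bseriesZ => //; exact: bseries_b.
rewrite /rsum addrAC subrr add0r.
exact: (xgetPex 0 (ex_intro _ s hs)).
Qed.

Lemma rsum_unique n z s :
  csum (fun m => beta n m / (muC m - z)) (s - 1) -> rsum n z = s.
Proof. by move=> h; apply: (addIr (-1)); exact: ccvg_unique (rsumP n z) h. Qed.

Definition numer n z : R[i] := \prod_(j < n) (if (j < n0)%N then 1 else muC j - z).
Definition denom n z : R[i] := \prod_(j < n) (if (j < n0)%N then 1 else lam j - z).

Variable F : R[i] -> R[i].
Hypothesis hF : forall z, (forall m, z != muC m) ->
  csum (fun m => b m / (muC m - z)) (F z - 1).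

Lemma lam_neq_mu n m : (n0 <= n)%N -> b n != 0 -> lam n != muC m.
Proof.
move=> hn bn; have [_ h2 _ /(_ bn) [h3 _]] := hlam hn.
have [->//|mn] := eqVneq m n.
have n1 : (0 < n)%N by lia.
have [] := near_mu gap n1 mn h2; rewrite subr_eq0 => h _.
by rewrite eq_sym.
Qed.

Lemma lam_inj n j : (n0 <= j)%N -> (j < n)%N -> lam j != lam n.
Proof.
move=> hj jn; have [_ hj2 _ _] := hlam hj.
have [_ hn2 _ _] := hlam (leq_trans hj (ltnW jn)).
have jn' : j != n by rewrite ltn_eqF.
have := gap j n; have := natr_dist_ge1 R jn' => h1.
have n2 : 2 <= n%:R :> R by rewrite ler_nat; lia.
rewrite -nc_muB => h2; rewrite -subr_eq0 -nc_gt0.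
have := nc_distD (muC j) (lam j) (muC n).
have := nc_distD (lam j) (lam n) (muC n).
rewrite [nc (muC j - lam j)]ncBC; nra.
Qed.

Lemma rsum_same n z : (forall m, beta n.+1 m = beta n m) -> rsum n.+1 z = rsum n z.
Proof.
move=> h; apply: rsum_unique; apply: eq_ccvg (rsumP n z) => N.
by apply: eq_bigr => i _; rewrite h.
Qed.

(** The factor [(mu n - z) / (lam n - z)] cancels the pole at [mu n], and no pole arises at [lam n]
    because the secular function vanishes there. The result is again 1 plus a sum over poles. *)
Lemma removal n z : (forall m, z != muC m) ->
  numer n z * F z = denom n z * rsum n z.
Proof.
elim: n z => [|n IH] z hz.
  rewrite /numer /denom !big_ord0 !mul1r; apply/esym/rsum_unique.
  apply: eq_ccvg (hF hz) => N; apply: eq_bigr => i _.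
  by rewrite /beta big_ord0 mulr1.
rewrite /numer /denom !big_ord_recr /= -/(numer n z) -/(denom n z).
case: ltnP => hn.
  rewrite !mulr1 IH // rsum_same // => m.
  by rewrite /beta big_ord_recr /= /rfac hn addr0 mulr1.
have [h1 h2 h3 h4] := hlam hn.
have [b0|b0] := eqVneq (b n) 0.
  rewrite rsum_same ?(h3 b0); first by rewrite mulrAC IH // mulrAC.
  move=> m; rewrite /beta big_ord_recr /= /rfac ltnNge hn /= h3 //.
  by rewrite subrr mul0r addr0 mulr1.
have [hne hs] := h4 b0.
have hnu m : lam n != muC m by exact: lam_neq_mu.
have F0 : F (lam n) = 0.
  by apply: (addIr (-1)); rewrite add0r; exact: ccvg_unique (hF hnu) hs.
(* The roots already divided out differ from [lam n], so the zero of [F] at [lam n] survives as a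
   zero of [rsum n]. *)
have den0 : denom n (lam n) != 0.
  rewrite /denom prodf_seq_neq0; apply/allP => j _ /=.
  case: ltnP => hj; first exact: oner_neq0.
  by rewrite subr_eq0 lam_inj.
have G0 : rsum n (lam n) = 0.
  have := IH _ hnu; rewrite F0 mulr0 => /esym/eqP.
  by rewrite mulf_eq0 (negbTE den0) => /eqP.
rewrite mulrAC IH // -!mulrA; congr (_ * _).
have [->|zn] := eqVneq z (lam n); first by rewrite G0 subrr !mul0r.
have zn' : lam n - z != 0 by rewrite subr_eq0 eq_sym.
suff -> : rsum n.+1 z = (muC n - z) / (lam n - z) * rsum n z by field.
apply: rsum_unique.
(* Since [rsum n (lam n)] is 0, its multiple supplies exactly the constant needed to write both
   sides as series; the identity then holds term by term. *)
have -> : (muC n - z) / (lam n - z) * rsum n z - 1 =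
  (muC n - z) / (lam n - z) * (rsum n z - 1) -
  (muC n - lam n) / (lam n - z) * (rsum n (lam n) - 1).
  by rewrite G0; field.
have := ccvgB (ccvgZ ((muC n - z) / (lam n - z)) (rsumP n z))
  (ccvgZ ((muC n - lam n) / (lam n - z)) (rsumP n (lam n))).
apply: eq_ccvg => N; rewrite !mulr_sumr -sumrB; apply: eq_bigr => m _.
rewrite /beta big_ord_recr /= /rfac ltnNge hn /=.
have m1 : muC m - z != 0 by rewrite subr_eq0 eq_sym.
have m2 : muC m - lam n != 0 by rewrite subr_eq0 eq_sym.
have m3 : lam n - muC m != 0 by rewrite subr_eq0.
by field; rewrite ?m1 ?m2 ?m3 ?zn'.
Qed.

Lemma beta_ccvg m : exists x, ccvg (fun n => beta n m) x.
Proof.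
have [K hK] := rfac_sum.
have [|p hp] := @prod_ccvg R (rfac m) _ (rfac_le m); first by exists K; exact: hK.
by exists (b m * p); exact: ccvgZ.
Qed.

Definition beta_lim m : R[i] := xget 0 [set x | ccvg (fun n => beta n m) x]%classic.

Lemma beta_limP m : ccvg (fun n => beta n m) (beta_lim m).
Proof. by have [x hx] := beta_ccvg m; exact: (xgetPex 0 (ex_intro _ x hx)). Qed.

Lemma beta_lim0 m : b m = 0 -> beta_lim m = 0.
Proof.
move=> b0; apply: ccvg_unique (beta_limP m) _.
by apply: eq_ccvg (ccvg_cst 0) => n; rewrite /beta b0 mul0r.
Qed.

Lemma beta_eq0 n m : (n0 <= m)%N -> (m < n)%N -> beta n m = 0.
Proof.
move=> hm mn; have [b0|b0] := eqVneq (b m) 0; first by rewrite /beta b0 mul0r.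
rewrite /beta (bigD1 (Ordinal mn)) //= /rfac ltnNge hm /=.
have h : lam m - muC m != 0 by rewrite subr_eq0 lam_neq_mu.
by rewrite -[X in X / _]opprB mulNr divff // subrr mul0r mulr0.
Qed.

(** Dominated convergence in three ranges: below [n0] finitely many residues converge, from [n0] to
    [N] they vanish, and beyond [N] the tail of [bseries_b] bounds them. *)
Lemma rsum_ccvg z :
  ccvg (fun N => rsum N z) (1 + \sum_(m < n0) beta_lim m / (muC m - z)).
Proof.
have [E E0 hE] := beta_le.
pose low N := \sum_(m < n0) beta N m / (muC m - z).
have hlow : ccvg low (\sum_(m < n0) beta_lim m / (muC m - z)).
  apply: ccvg_sum => m; rewrite mulrC; apply: eq_ccvg (ccvgZ _ (beta_limP m)) => n.
  exact: mulrC.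
suff h : ccvg (fun N => rsum N z - 1 - low N) 0.
  rewrite -[X in 1 + X]add0r.
  by apply: eq_ccvg (ccvgD (ccvg_cst 1) (ccvgD h hlow)) => N; ring.
move=> e e0.
have v0 m : 0 <= nc (b m) * nc (muC m - z)^-1 by rewrite mulr_ge0 ?nc_ge0.
have e1 : 0 < e / (E + 1) / 2 by rewrite !divr_gt0 //; lra.
have [N1 hN1] := bseries_tail v0 (bseries_b z) e1.
exists (maxn n0 N1) => N; rewrite geq_max => /andP[nN NN1].
rewrite subr0; apply: le_lt_trans (_ : e / 2 < _); last by lra.
pose u M := \sum_(m < M) beta N m / (muC m - z) - low N.
have hu : ccvg u (rsum N z - 1 - low N).
  by apply: ccvgB (rsumP N z) (ccvg_cst _).
suff hb M : nc (u (M + N)%N) <= e / 2.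
  exact: ccvg_nc_le ((ccvg_shift u _ N).2 hu) hb.
have -> : u (M + N)%N = \sum_(N <= m < M + N) beta N m / (muC m - z).
  rewrite /u /low -!(big_mkord xpredT (fun m => beta N m / (muC m - z))).
  rewrite (big_cat_nat (n := n0)) //=; last by lia.
  rewrite addrAC subrr add0r (big_cat_nat (n := N)) //=; last by lia.
  rewrite big_nat_cond big1 ?add0r // => i /andP[/andP[h1 h2] _].
  by rewrite beta_eq0 // mul0r.
apply: le_trans (nc_sum _ _ _) _.
apply: le_trans (_ : E * \sum_(N <= m < M + N) nc (b m) * nc (muC m - z)^-1 <= _).
  rewrite mulr_sumr; apply: ler_sum => m _.
  by rewrite ncM mulrA ler_wpM2r ?nc_ge0.
have h := hN1 (M + N)%N.
have h2 : \sum_(N <= m < M + N) nc (b m) * nc (muC m - z)^-1 <= e / (E + 1) / 2.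
  apply: ltW; apply: le_lt_trans h.
  rewrite [leRHS](big_cat_nat (n := N)) //=; last by lia.
  by rewrite lerDr sumr_ge0.
apply: le_trans (ler_wpM2l E0 h2) _.
have -> : E * (e / (E + 1) / 2) = e / 2 * (E / (E + 1)) by field; lra.
by rewrite ler_piMr ?ler_pdivrMr; lra.
Qed.

End Removal.

(** * Continuity of functions of the spectral parameter *)

Section Continuity.
Variable R : realType.
Implicit Types f g : R[i] -> R[i].

Lemma ccont_cst k z0 : ccontinuous_at (fun=> k : R[i]) z0.
Proof. by move=> e e0; exists 1 => // z _; rewrite subrr nc0. Qed.

Lemma ccont_lip f z0 (k d0 : R) : 0 < d0 ->
  (forall z, nc (z - z0) <= d0 -> nc (f z - f z0) <= k * nc (z - z0)) ->
  ccontinuous_at f z0.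
Proof.
move=> d00 h e e0.
have k1 : 0 < `|k| + 1 by have := normr_ge0 k; lra.
exists (Num.min d0 (e / (`|k| + 1))); first by rewrite lt_min d00 divr_gt0.
move=> z; rewrite lt_min ltr_pdivlMr // => /andP[h1 h2].
apply: le_lt_trans (h _ (ltW h1)) _.
have := nc_ge0 (z - z0); have := ler_norm k; nra.
Qed.

Lemma ccontM f g z0 : ccontinuous_at f z0 -> ccontinuous_at g z0 ->
  ccontinuous_at (fun z => f z * g z) z0.
Proof.
move=> hf hg e e0.
pose A := nc (f z0); pose B := nc (g z0).
have A0 : 0 <= A by exact: nc_ge0. have B0 : 0 <= B by exact: nc_ge0.
pose e1 := Num.min 1 (e / (A + B + 2)).
have e10 : 0 < e1 by rewrite lt_min ltr01 divr_gt0 //; lra.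
have [d hd1 hd] := hf _ e10; have [d' hd1' hd'] := hg _ e10.
exists (Num.min d d'); first by rewrite lt_min hd1.
move=> z; rewrite lt_min => /andP[/hd h1 /hd' h2].
have -> : f z * g z - f z0 * g z0 =
  (f z - f z0) * (g z - g z0) + (f z - f z0) * g z0 + f z0 * (g z - g z0) by ring.
apply: le_lt_trans (ncD _ _) _.
apply: le_lt_trans (lerD (ncD _ _) (lexx _)) _; rewrite !ncM -/A -/B.
have e1l : e1 <= 1 by rewrite /e1 ge_min lexx.
have e1r : e1 * (A + B + 2) <= e.
  by rewrite -ler_pdivlMr; [rewrite /e1 ge_min lexx orbT | lra].
have := nc_ge0 (f z - f z0); have := nc_ge0 (g z - g z0); nra.
Qed.

Lemma ccont_prod (I : Type) (s : seq I) (F : I -> R[i] -> R[i]) z0 :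
  (forall i, ccontinuous_at (F i) z0) ->
  ccontinuous_at (fun z => \prod_(i <- s) F i z) z0.
Proof.
move=> h; elim: s => [|i s IH].
  move=> e /(@ccont_cst 1 z0) [d d0 hd]; exists d => // z /hd.
  by rewrite !big_nil.
move=> e /(ccontM (h i) IH) [d d0 hd]; exists d => // z /hd.
by rewrite !big_cons.
Qed.

Lemma eq_ccont f g z0 : f =1 g -> ccontinuous_at f z0 -> ccontinuous_at g z0.
Proof. by move=> fg hf e /hf [d d0 hd]; exists d => // z /hd; rewrite !fg. Qed.

Lemma ccont_eq_nonreal f g z0 : ccontinuous_at f z0 -> ccontinuous_at g z0 ->
  (forall z, complex.Im z != 0 -> f z = g z) -> f z0 = g z0.
Proof.
move=> hf hg fg; apply/eqP; rewrite -subr_eq0 -nc_eq0; apply: contraT => h.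
have e0 : 0 < nc (f z0 - g z0) / 2.
  by rewrite divr_gt0 // lt_neqAle eq_sym h nc_ge0.
have [d d0 hd] := hf _ e0; have [d' d0' hd'] := hg _ e0.
pose t := Num.min d d'.
have t0 : 0 < t by rewrite lt_min d0.
(* [z0] is approached vertically; at most one of the shifts [t / 2] and [t / 3] can end on the real
   axis. *)
have [s s0 [st hs]] : exists2 s : R, 0 < s & s < t /\ complex.Im z0 + s != 0.
  have [E|E] := eqVneq (complex.Im z0 + t / 2) 0.
    by exists (t / 3); [lra | split; [lra | apply/eqP; lra]].
  by exists (t / 2); [lra | split=> //; lra].
pose z := z0 + 'i%C * s%:C%C.
have hz : nc (z - z0) = s.
  rewrite /z addrAC subrr add0r ncM nc_real /= expr0n expr1n add0r sqrtr1 mul1r.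
  exact: gtr0_norm.
have Iz : complex.Im z != 0.
  by rewrite /z; case: (z0) hs => x y /=; rewrite !mul0r mul1r add0r.
have : nc (z - z0) < t by rewrite hz.
rewrite lt_min => /andP[/hd h1 /hd' h2].
have := nc_distD (f z0) (f z) (g z0).
rewrite {2}(fg _ Iz) [nc (f z0 - f z)]ncBC; lra.
Qed.

End Continuity.

(** * Infinite products with prescribed zeros *)

Section InfiniteProduct.
Variable R : realType.
Variables (l d : nat -> R[i]) (L : R).
Hypothesis d0 : forall n, d n != 0.
Hypothesis dsum : bseries (fun n => nc (d n)^-1).
Hypothesis ld : forall n, nc (l n - d n) <= L.

(** As [l n - d n] is bounded, each factor is [1 + (l n - d n - z) / d n], summably close to 1 for
    every [z]. Keeping [d] separate from [l] allows some [l n] to be 0. *)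
Definition prodz z : R[i] :=
  xget 0 [set p | ccvg (fun N => \prod_(n < N) ((l n - z) / d n)) p]%classic.

Let dev z n := (l n - d n - z) / d n.

Lemma prodz_factor z n : (l n - z) / d n = 1 + dev z n.
Proof. by rewrite /dev; field; exact: d0. Qed.

Lemma dev_le (r : R) z n : nc z <= r -> nc (dev z n) <= (L + r) * nc (d n)^-1.
Proof.
move=> hz; rewrite ncM ler_wpM2r ?nc_ge0 //.
by apply: le_trans (ncB _ _) _; rewrite lerD.
Qed.

Lemma L_ge0 : 0 <= L.
Proof. exact: le_trans (nc_ge0 _) (ld 0). Qed.

Lemma dev_bseries (r : R) : 0 <= r -> bseries (fun n => (L + r) * nc (d n)^-1).
Proof. by move=> r0; apply: bseriesZ => //; rewrite addr_ge0 // L_ge0. Qed.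

Lemma prodzP z : ccvg (fun N => \prod_(n < N) ((l n - z) / d n)) (prodz z).
Proof.
have [p hp] := prod_ccvg (fun n => dev_le n (lexx (nc z))) (dev_bseries (nc_ge0 z)).
apply: (@xgetPex _ 0 [set p | ccvg (fun N => \prod_(n < N) ((l n - z) / d n)) p]%classic).
by exists p; apply: eq_ccvg hp => N; apply: eq_bigr => i _; rewrite prodz_factor.
Qed.

Lemma prodz_neq0 z : (forall n, l n != z) -> prodz z != 0.
Proof.
move=> h; apply: (prod_ccvg_neq0 (fun n => dev_le n (lexx (nc z))) (dev_bseries (nc_ge0 z))).
  by move=> n; rewrite -prodz_factor mulf_neq0 ?invr_eq0 // subr_eq0.
by apply: eq_ccvg (prodzP z) => N; apply: eq_bigr => i _; rewrite prodz_factor.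
Qed.

Lemma prodz_cont z0 : ccontinuous_at prodz z0.
Proof.
pose r := nc z0 + 1.
have r0 : 0 <= r by rewrite addr_ge0 // nc_ge0.
have [M hM] := dev_bseries r0; have [V hV] := dsum.
have M0 : 0 <= M by have := hM 0%N; rewrite big_ord0.
apply: (@ccont_lip _ _ _ (expR M * V) 1) => // z hz.
have zr : nc z <= r.
  by have := nc_subr_ge z z0; rewrite /r; lra.
have z0r : nc z0 <= r by rewrite /r; lra.
apply: (ccvg_nc_le (ccvgB (prodzP z) (prodzP z0))) => N.
have E w : \prod_(n < N) ((l n - w) / d n) = \prod_(n < N) (1 + dev w n).
  by apply: eq_bigr => n _; exact: prodz_factor.
rewrite !E.
have h := @nc_prod_sub_le R 'I_N (index_enum 'I_N) _ _ _
  (fun i => dev_le i zr) (fun i => dev_le i z0r).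
apply: le_trans h _; rewrite -mulrA; apply: ler_pM; rewrite ?expR_ge0 //.
- by apply: sumr_ge0 => i _; exact: nc_ge0.
- by rewrite ler_expR; exact: hM.
apply: le_trans (_ : nc (z - z0) * \sum_(n < N) nc (d n)^-1 <= _); last first.
  by rewrite mulrC ler_wpM2r ?nc_ge0.
rewrite mulr_sumr; apply: ler_sum => n _; rewrite -ncM ncBC.
by rewrite le_eqVlt; apply/orP; left; apply/eqP; congr nc; rewrite /dev; ring.
Qed.

End InfiniteProduct.

Section ProductZeros.
Variable R : realType.
Variables (l d : nat -> R[i]) (L : R).
Hypothesis d0 : forall n, d n != 0.
Hypothesis dsum : bseries (fun n => nc (d n)^-1).
Hypothesis ld : forall n, nc (l n - d n) <= L.

(** Summability of [1 / d n] sends [d n], hence [l n], to infinity: every value is taken finitely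
    often. *)
Lemma l_escapes (z0 : R[i]) : exists M, forall n, (M <= n)%N -> l n != z0.
Proof.
have e0 : 0 < (nc z0 + `|L| + 1)^-1.
  by rewrite invr_gt0; have := nc_ge0 z0; have := normr_ge0 L; lra.
have [|M hM] := bseries_tail _ dsum e0; first by move=> n; exact: nc_ge0.
exists M => n Mn; apply/eqP => E.
have := hM n.+1; rewrite big_nat_recr //=.
have : 0 <= \sum_(M <= i < n) nc (d i)^-1 by apply: sumr_ge0 => i _; exact: nc_ge0.
move=> h1 h2; have : nc (d n)^-1 < (nc z0 + `|L| + 1)^-1 by lra.
rewrite ncV ltf_pV2 ?posrE ?nc_gt0 //; last by rewrite -invr_gt0.
have := ld n; rewrite E ncBC; have := nc_subr_ge (d n) z0; have := ler_norm L; lra.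
Qed.

Lemma dsum_shift M : bseries (fun n => nc (d (n + M)%N)^-1).
Proof.
have [V hV] := dsum; exists V => N; apply: le_trans (hV (N + M)%N).
rewrite addnC big_split_ord /=.
rewrite [X in _ <= _ + X](eq_bigr (fun i : 'I_N => nc (d (i + M)%N)^-1)).
  by rewrite lerDr; apply: sumr_ge0 => *; exact: nc_ge0.
by move=> i _; rewrite addnC.
Qed.

Lemma prodz_shift M z : prodz l d z =
  (\prod_(n < M) ((l n - z) / d n)) * prodz (fun n => l (n + M)%N) (fun n => d (n + M)%N) z.
Proof.
have dM := dsum_shift M.
apply: ccvg_unique (prodzP d0 dsum ld z) _; apply/(ccvg_shift _ _ M).
have := ccvgZ (\prod_(n < M) ((l n - z) / d n))
  (prodzP (fun n => d0 (n + M)%N) dM (fun n => ld (n + M)%N) z).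
apply: eq_ccvg => N.
rewrite addnC big_split_ord /=; congr (_ * _).
by apply: eq_bigr => i _; rewrite addnC.
Qed.

Lemma prodz_zeros (f : R[i] -> R[i]) (c : R[i]) : c != 0 ->
  (forall z, f z = c * prodz l d z) -> forall z0, exists m, zero_order f z0 m /\
    exists s : seq nat, [/\ uniq s, size s = m & forall n, n \in s <-> l n = z0].
Proof.
move=> c0 hf z0; have [M hM] := l_escapes z0.
pose s := [seq n <- iota 0 M | l n == z0].
exists (size s); split; last first.
  exists s; split => //; first by rewrite filter_uniq ?iota_uniq.
  move=> n; rewrite mem_filter mem_iota add0n /=.
  split=> [/andP[/eqP //]|E]; rewrite E eqxx /=.
  by rewrite ltnNge; apply/negP => /hM; rewrite E eqxx.
have dM := dsum_shift M.
pose T := prodz (fun n => l (n + M)%N) (fun n => d (n + M)%N).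
(* A factor that vanishes at [z0] equals [(z - z0) * - (d n)^-1]; [h] keeps the cofactor there and
   the whole factor elsewhere. *)
pose h n z := if l n == z0 then - (d n)^-1 else (l n - z) / d n.
exists (fun z => c * ((\prod_(n <- iota 0 M) h n z) * T z)); split; last split.
- move=> z; rewrite hf (prodz_shift M) -/T [RHS]mulrCA; congr (_ * _).
  rewrite mulrA; congr (_ * _).
  rewrite -(big_mkord xpredT (fun n => (l n - z) / d n)) /index_iota subn0 /s.
  elim: (iota 0 M) => [|n t IH]; first by rewrite !big_nil expr0 mul1r.
  rewrite !big_cons IH /h /=; case: eqP => [E|_] /=; last by rewrite mulrCA.
  by rewrite exprS E; ring.
- rewrite !mulf_neq0 //.
    rewrite prodf_seq_neq0; apply/allP => n _ /=; rewrite /h; case: (l n =P z0) => [_|/eqP h'].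
      by rewrite oppr_eq0 invr_eq0.
    by rewrite mulf_neq0 ?invr_eq0 // subr_eq0.
  by apply: (prodz_neq0 (fun n => d0 (n + M)%N) dM (fun n => ld (n + M)%N)) => n; apply: hM; rewrite leq_addl.
apply: ccontM; first exact: ccont_cst.
apply: ccontM; last exact: prodz_cont (fun n => d0 (n + M)%N) dM (fun n => ld (n + M)%N) z0.
apply: ccont_prod => n; rewrite /h; case: eqP => _; first exact: ccont_cst.
apply: ccontM; last exact: ccont_cst.
apply: (@ccont_lip _ _ _ 1 1) => // z _; rewrite mul1r ncBC.
by rewrite le_eqVlt; apply/orP; left; apply/eqP; congr nc; ring.
Qed.

End ProductZeros.

(** * The finitely many remaining poles *)

Section LowRoots.
Variable R : realType.
Variables (mu : nat -> R[i]) (bt : nat -> R[i]) (n0 : nat).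

Lemma prod_subr_sign (I : Type) (s : seq I) (F : I -> R[i]) z :
  \prod_(i <- s) (F i - z) = (-1) ^+ size s * \prod_(i <- s) (z - F i).
Proof.
elim: s => [|i s IH]; first by rewrite !big_nil expr0 mulr1.
by rewrite !big_cons IH exprS; ring.
Qed.

(** Clearing denominators gives a monic polynomial whose degree is the number of nonzero residues.
    It has that many roots with multiplicity, and they are assigned to the poles with nonzero
    residue. *)
Lemma low_roots : exists nu : nat -> R[i],
  (forall m, bt m = 0 -> nu m = mu m) /\
  forall z, (forall m, z != mu m) ->
    \prod_(m < n0) (mu m - z) * (1 + \sum_(m < n0) bt m / (mu m - z)) =
    \prod_(m < n0) (nu m - z).
Proof.
pose t := [seq m <- iota 0 n0 | bt m != 0].
have ut : uniq t by rewrite filter_uniq ?iota_uniq.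
pose q m : {poly R[i]} := \prod_(x <- rem m t) ('X - (mu x)%:P).
pose P : {poly R[i]} := \prod_(x <- t) ('X - (mu x)%:P).
pose p : {poly R[i]} := P - \sum_(m <- t) bt m *: q m.
have szP : size P = (size t).+1 by rewrite /P size_prod_XsubC.
have szs : (size (\sum_(m <- t) bt m *: q m)%R < size P)%N.
  rewrite szP ltnS big_seq; apply: (leq_trans (size_sum _ _ _)).
  apply/bigmax_leqP_seq => m mt _; apply: leq_trans (size_scale_leq _ _) _.
  by rewrite /q size_prod_XsubC size_rem // prednK // lt0n size_eq0; case: t mt {ut q P p szP}.
have monp : p \is monic.
  rewrite monicE lead_coefDl ?size_polyN // -monicE; exact: monic_prod_XsubC.
have szp : size p = (size t).+1 by rewrite /p size_polyDl ?size_polyN // szP.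
have [r hr] := closed_field_poly_normal p.
move: hr; rewrite (monicP monp) scale1r => hr.
have szr : size r = size t.
  by apply: succn_inj; rewrite -szp hr size_prod_XsubC.
pose nu m := if m \in t then nth 0 r (index m t) else mu m.
have nu_t : [seq nu m | m <- t] = r.
  apply: (@eq_from_nth _ 0); rewrite size_map // => i it.
  by rewrite (nth_map 0%N) // /nu mem_nth // index_uniq // -szr.
exists nu; split.
  by move=> m b0; rewrite /nu mem_filter b0 eqxx.
move=> z hz.
have mz m : mu m - z != 0 by rewrite subr_eq0 eq_sym.
have split1 (F : nat -> R[i]) : \prod_(m < n0) F m =
    \prod_(m <- t) F m * \prod_(m <- iota 0 n0 | bt m == 0) F m.
  rewrite -(big_mkord xpredT F) /index_iota subn0 (bigID (fun m => bt m != 0)) /= big_filter.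
  by congr (_ * _); apply: eq_bigl => m; rewrite negbK.
have -> : \sum_(m < n0) bt m / (mu m - z) = \sum_(m <- t) bt m / (mu m - z).
  rewrite -(big_mkord xpredT (fun m => bt m / (mu m - z))) /index_iota subn0.
  rewrite (bigID (fun m => bt m != 0)) /= big_filter [X in _ + X]big1 ?addr0 //.
  by move=> m /negPn/eqP ->; rewrite mul0r.
rewrite (split1 (fun m => mu m - z)) (split1 (fun m => nu m - z)) mulrAC; congr (_ * _); last first.
  by apply: eq_bigr => m /eqP b0; rewrite /nu mem_filter b0 eqxx.
have E1 : \prod_(m <- t) (nu m - z) = (-1) ^+ size t * p.[z].
  rewrite -(big_map nu xpredT (fun x => x - z)) nu_t prod_subr_sign szr; congr (_ * _).
  by rewrite hr horner_prod; apply: eq_bigr => x _; rewrite hornerXsubC.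
rewrite E1 prod_subr_sign -mulrA; congr (_ * _).
rewrite /p hornerD hornerN horner_sum /P horner_prod mulrDr mulr1.
under [X in _ = X - _]eq_bigr do rewrite hornerXsubC.
congr (_ + _); rewrite mulr_sumr -sumrN big_seq [RHS]big_seq.
apply: eq_bigr => m mt; rewrite hornerZ /q horner_prod (big_rem m mt) /=.
under [in RHS]eq_bigr do rewrite hornerXsubC.
rewrite -[mu m - z]opprB; field.
by rewrite -oppr_eq0 opprB mz.
Qed.

End LowRoots.

Section SecularTheorem.
Variable R : realType.

Lemma split_low (w v d : nat -> R[i]) (n0 N : nat) z : (n0 <= N)%N ->
  \prod_(n < N) (((if (n < n0)%N then w n else v n) - z) / d n) =
  \prod_(n < n0) (w n - z) * (\prod_(n < N) (d n)^-1 *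
     \prod_(n < N) (if (n < n0)%N then 1 else v n - z)).
Proof.
move=> nN; rewrite big_split /= mulrCA mulrC; congr (_ * _).
rewrite -(subnKC nN) !big_split_ord /= mulrA; congr (_ * _).
  rewrite [X in _ = _ * X]big1 ?mulr1 => [|i _]; last by rewrite ltn_ord.
  by apply: eq_bigr => i _; rewrite ltn_ord.
by apply: eq_bigr => i _; rewrite ltnNge leq_addr.
Qed.

(** For nonreal [z] the identity of [removal], normalised by the [d n], passes to the limit, and
    [low_roots] absorbs the rational factor that is left. Continuity of both sides extends the
    product formula to every [z]. *)
Theorem secular_zeros (mu d : nat -> R) (b : nat -> R[i]) (f : R[i] -> R[i])
    (c : R[i]) (L : R) :
  (forall m n, `|m%:R - n%:R| * n%:R <= `|mu m - mu n|) ->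
  bseries (fun n => nc (b n) ^+ 2) ->
  (forall n, d n != 0) -> bseries (fun n => `|d n|^-1) ->
  (forall n, `|mu n - d n| <= L) -> c != 0 ->
  (forall z0, ccontinuous_at f z0) ->
  (forall z s, complex.Im z != 0 ->
     csum (fun m => b m / ((mu m)%:C%C - z)) s ->
     ccvg (fun N => c * \prod_(n < N) (((mu n)%:C%C - z) / (d n)%:C%C) * (1 + s)) (f z)) ->
  exists l : nat -> R[i],
    [/\ forall n, b n = 0 -> l n = (mu n)%:C%C,
        bseries (fun n => nc (l n - (mu n)%:C%C) ^+ 2) &
        forall z0, exists m, zero_order f z0 m /\
          exists s : seq nat, [/\ uniq s, size s = m & forall n, n \in s <-> l n = z0]].
Proof.
move=> gap b2 d0 dsum mud c0 fcont hf.
have [n0 n01 [lam hlam]] := roots_near gap b2.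
pose F z : R[i] := rsum mu b n0 lam 0 z.
have hF z : (forall m, z != (mu m)%:C%C) ->
    csum (fun m => b m / ((mu m)%:C%C - z)) (F z - 1).
  move=> _; apply: eq_ccvg (rsumP gap b2 n01 hlam 0 z) => N.
  by apply: eq_bigr => i _; rewrite /beta big_ord0 mulr1.
have [nu [nu0 hnu]] := low_roots (fun n => (mu n)%:C%C) (beta_lim mu b n0 lam) n0.
pose l n := if (n < n0)%N then nu n else lam n.
(* The zeros of the intermediate product, in which the low poles are not yet replaced. *)
pose l' n := if (n < n0)%N then (mu n)%:C%C else lam n.
have dC0 n : (d n)%:C%C != 0 by rewrite -nc_eq0 nc_real normr_eq0.
have dCsum : bseries (fun n => nc ((d n)%:C%C)^-1).
  by have [V hV] := dsum; exists V => N; under eq_bigr do rewrite ncV nc_real.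
have mudC n : nc ((mu n)%:C%C - (d n)%:C%C) <= L by rewrite -rmorphB nc_real.
have L0 : 0 <= L := le_trans (nc_ge0 _) (mudC 0%N).
have lamd n : (n0 <= n)%N -> nc (lam n - (d n)%:C%C) <= L + 1 / 2.
  move=> /hlam [_ h _ _]; have := nc_distD (lam n) (mu n)%:C%C (d n)%:C%C.
  have := mudC n; lra.
(* The low roots come without an estimate; the sum of their finitely many distances serves as
   one. *)
pose L' := L + 1 / 2 + \sum_(n < n0) nc (nu n - (d n)%:C%C).
have S0 : 0 <= \sum_(n < n0) nc (nu n - (d n)%:C%C).
  by apply: sumr_ge0 => *; exact: nc_ge0.
have ld n : nc (l n - (d n)%:C%C) <= L'.
  rewrite /l /L'; case: ltnP => h; last by have := lamd _ h; lra.
  rewrite (bigD1 (Ordinal h)) //=.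
  have : 0 <= \sum_(i < n0 | i != Ordinal h) nc (nu i - (d i)%:C%C).
    by apply: sumr_ge0 => *; exact: nc_ge0.
  lra.
have l'd n : nc (l' n - (d n)%:C%C) <= L'.
  rewrite /l' /L'; case: ltnP => h; last by have := lamd _ h; lra.
  have := mudC n; lra.
have prodE z : (forall m, z != (mu m)%:C%C) ->
    prodz l (fun n => (d n)%:C%C) z = prodz l' (fun n => (d n)%:C%C) z *
      (1 + \sum_(m < n0) beta_lim mu b n0 lam m / ((mu m)%:C%C - z)).
  move=> hz; apply: ccvg_unique (prodzP dC0 dCsum ld z) _.
  have hc := ccvgZ (1 + \sum_(m < n0) beta_lim mu b n0 lam m / ((mu m)%:C%C - z))
     (prodzP dC0 dCsum l'd z).
  rewrite mulrC; apply: (eq_ccvg_near (N0 := n0) _ hc) => N nN.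
  have sl w := split_low w lam (fun n => (d n)%:C%C) z nN.
  by rewrite /l /l' (sl nu) (sl (fun n => (mu n)%:C%C)) -hnu //; ring.
have fE z : complex.Im z != 0 -> f z = c * prodz l (fun n => (d n)%:C%C) z.
  move=> Iz; have hz m : z != (mu m)%:C%C.
    by apply: contraNneq Iz => ->.
  rewrite prodE // mulrA.
  have := hf z _ Iz (hF z hz); move/ccvg_unique; apply.
  have hc := ccvgM (ccvgZ c (prodzP dC0 dCsum l'd z)) (rsum_ccvg gap b2 n01 hlam z).
  apply: (eq_ccvg_near (N0 := n0) _ hc) => N nN.
  have := removal gap b2 n01 hlam hF N hz; rewrite /numer /denom => rem.
  have sl v := split_low (fun n => (mu n)%:C%C) v (fun n => (d n)%:C%C) z nN.
  rewrite /l' (sl lam).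
  have -> : \prod_(n < N) (((mu n)%:C%C - z) / (d n)%:C%C) = \prod_(n < N)
     (((if (n < n0)%N then (mu n)%:C%C else (mu n)%:C%C) - z) / (d n)%:C%C).
    by apply: eq_bigr => n _; case: ifP.
  rewrite (sl (fun n => (mu n)%:C%C)) (addrC 1) subrK -!mulrA; congr (_ * (_ * (_ * _))).
  by rewrite rem.
exists l; split.
- move=> n b0; rewrite /l; case: ltnP => h; first by apply: nu0; exact: beta_lim0.
  by have [_ _ -> ] := hlam n h.
- apply: (bseries_near (N0 := n0) (w := fun n => 4 * nc (b n) ^+ 2)).
  + by move=> n; rewrite mulr_ge0 // sqr_ge0.
  + move=> n hn; rewrite /l ltnNge hn /=; have [h _ _ _] := hlam n hn.
    have := nc_ge0 (lam n - (mu n)%:C%C); nra.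
  + exact: bseriesZ.
apply: (prodz_zeros dC0 dCsum ld c0) => z.
apply: ccont_eq_nonreal fE; first exact: fcont.
apply: ccontM; first exact: ccont_cst.
exact: (prodz_cont dC0 dCsum ld z).
Qed.

End SecularTheorem.

Local Open Scope classical_set_scope.
Local Open Scope ring_scope.

(** * Absolutely continuous functions as primitives *)

Section RealPrimitives.
Variable R : realType.
Local Notation mu := (@lebesgue_measure R).
Local Notation itg A f := (mu.-integrable A (EFin \o f)).
Implicit Types (f g u v : R -> R) (s t x p : R).

Lemma itg_sub p f s t : itg `[0, p]%classic f -> 0 <= s -> t <= p ->
  itg `[s, t]%classic f.
Proof.
move=> hf s0 tp; apply: integrableS hf => //.
apply: subset_itv; by rewrite bnd_simp.
Qed.

Lemma itgM_cont p f v : itg `[0, p]%classic f ->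
  {within `[0, p]%classic, continuous v} -> itg `[0, p]%classic (fun x => f x * v x).
Proof.
move=> hf hv; apply: (@integrableMl _ _ _ mu _ _ (EFin \o f) v) => //.
  by apply: subspace_continuous_measurable_fun.
have /compact_bounded[M [_ hM]] := continuous_compact hv (@segment_compact R 0 p).
by exists M; split; rewrite ?num_real // => y yM x xp; exact: hM.
Qed.

Lemma cont_bounded p v : {within `[0, p]%classic, continuous v} ->
  exists2 M, 0 <= M & forall x, 0 <= x <= p -> `|v x| <= M.
Proof.
move=> hv.
have /compact_bounded[M [_ hM]] := continuous_compact hv (@segment_compact R 0 p).
exists (`|M| + 1); first by rewrite addr_ge0.
move=> x xp; apply: hM; first by rewrite ltr_pwDr // ler_norm.
by exists x => //=; rewrite in_itv.
Qed.

Lemma itg_cont p v : {within `[0, p]%classic, continuous v} -> itg `[0, p]%classic v.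
Proof. by move=> hv; apply: continuous_compact_integrable => //; exact: segment_compact. Qed.

Lemma prim_diff p f s t : itg `[0, p]%classic f -> 0 <= s -> s <= t -> t <= p ->
  (\int[mu]_(x in `[0, t]) f x - \int[mu]_(x in `[0, s]) f x)%R =
  (\int[mu]_(x in `[s, t]) f x)%R.
Proof.
move=> hf s0 st tp.
rewrite Rintegral_itvB ?bnd_simp //; last by apply: itg_sub hf _ tp.
rewrite Rintegral_itv_obnd_cbnd //; apply: integrableS (itg_sub hf s0 tp) => //.
by apply: subset_itv; rewrite bnd_simp.
Qed.

(* [u] is absolutely continuous on [0, p] with derivative [f], stated through
   integrals only, so that no almost everywhere derivative is needed. *)
Definition racp p u f := itg `[0, p]%classic f /\
  forall x, 0 <= x <= p -> u x = u 0 + (\int[mu]_(t in `[0, x]) f t)%R.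

Lemma racp_diff p u f s t : racp p u f -> 0 <= s -> s <= t -> t <= p ->
  u t - u s = (\int[mu]_(x in `[s, t]) f x)%R.
Proof.
move=> [hf hu] s0 st tp; rewrite -(prim_diff hf s0 st tp).
rewrite (hu t) ?(hu s); first by ring.
  by rewrite s0 (le_trans st).
by rewrite (le_trans s0 st).
Qed.

Lemma racp_cont p u f : 0 <= p -> racp p u f -> {within `[0, p]%classic, continuous u}.
Proof.
move=> p0 [hf hu].
have hc := parameterized_integral_continuous p0 hf.
apply: (@subspace_eq_continuous _ _ _ (fun x => u 0 + (\int[mu]_(t in `[0, x]) f t)%R)).
  by move=> x; rewrite inE /= in_itv /= => xp; exact: (esym (hu x xp)).
by move=> x; apply: cvgD; [exact: cvg_cst | exact: hc].
Qed.

Lemma racp_cst p (k : R) : racp p (fun=> k) (fun=> 0).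
Proof.
split; first by apply: itg_cont => x; exact: cst_continuous.
by move=> x _; rewrite Rintegral_cst // mul0r addr0.
Qed.

Lemma racpD p u v f g : racp p u f -> racp p v g ->
  racp p (fun x => u x + v x) (fun x => f x + g x).
Proof.
move=> [hf hu] [hg hv]; split.
  by have := integrableD _ hf hg; apply.
move=> x /andP[x0 xp]; rewrite RintegralD //; first last.
- exact: itg_sub hg _ xp.
- exact: itg_sub hf _ xp.
by rewrite hu ?x0 // hv ?x0 //; ring.
Qed.

Lemma racpZ p (k : R) u f : racp p u f ->
  racp p (fun x => k * u x) (fun x => k * f x).
Proof.
move=> [hf hu]; split.
  by have := integrableZl _ k hf; apply.
move=> x /andP[x0 xp]; rewrite RintegralZl //; last exact: itg_sub hf _ xp.
by rewrite hu ?x0 //; ring.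
Qed.

Lemma eq_racp p u v f g : (forall x, 0 <= x <= p -> u x = v x) ->
  (forall x, 0 <= x <= p -> f x = g x) -> 0 <= p -> racp p u f -> racp p v g.
Proof.
move=> uv fg p0 [hf hu]; split.
  apply: eq_integrable hf => // x; rewrite inE /= in_itv /= => xp.
  by rewrite fg.
move=> x xp; rewrite -!uv ?lexx // hu //; congr (_ + _).
apply: eq_Rintegral => y; rewrite inE /= in_itv /= => /andP[y0 yx].
by rewrite fg // y0 (le_trans yx) //; case/andP: xp.
Qed.

Lemma integral_abs_small p f e : itg `[0, p]%classic f -> 0 < e ->
  exists2 d, 0 < d & forall s t, 0 <= s -> s <= t -> t <= p -> t - s < d ->
    (\int[mu]_(x in `[s, t]) `|f x|)%R < e.
Proof.
move=> hf e0.
pose fp := f \_ `[0, p].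
have hfp : itg setT fp.
  by rewrite -restrict_EFin; apply/integrable_restrict => //=; rewrite setTI.
have [d [d0 hd]] := integral_normr_continuous hfp e0.
exists d => // s t s0 st tp std.
have hm : (mu `[s, t]%classic < d%:E)%E.
  rewrite lebesgue_measure_itv /= lte_fin; case: (s < t) => /=; last by rewrite lte_fin.
  by rewrite -EFinD lte_fin.
apply: le_lt_trans (hd _ (measurable_itv _) hm).
rewrite le_eqVlt; apply/orP; left; apply/eqP.
apply: eq_Rintegral => y; rewrite inE /= in_itv /= => /andP[sy yt].
by rewrite /fp patchE mem_set //= in_itv /= (le_trans s0) //= (le_trans yt).
Qed.

End RealPrimitives.

(** * Product rule for primitives *)

Section RealProduct.
Variable R : realType.
Local Notation mu := (@lebesgue_measure R).
Local Notation itg A f := (mu.-integrable A (EFin \o f)).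
Implicit Types (f g u v W H : R -> R) (s t x p : R).

Lemma telescope_small_steps p W H (d e : R) : 0 < d ->
  (forall s t, 0 <= s -> s <= t -> t <= p -> t - s < d ->
     `|W t - W s| <= e * (H t - H s)) ->
  forall x, 0 <= x <= p -> `|W x - W 0| <= e * (H x - H 0).
Proof.
move=> d0 hW x /andP[x0 xp].
pose n := (Num.truncn (x / d)).+1.
have n0 : 0 < n%:R :> R by rewrite ltr0n.
have xd : x / n%:R < d.
  by rewrite ltr_pdivrMr // mulrC -ltr_pdivrMr //; exact: truncnS_gt.
have xn0 : 0 <= x / n%:R by rewrite divr_ge0 // ltW.
have key i : (i <= n)%N -> `|W (i%:R * (x / n%:R)) - W 0| <=
    e * (H (i%:R * (x / n%:R)) - H 0).
  elim: i => [_|i IH hi]; first by rewrite mul0r !subrr normr0 mulr0.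
  have hs : i.+1%:R * (x / n%:R) <= p.
    apply: le_trans xp; rewrite mulrA ler_pdivrMr // mulrC.
    by apply: ler_wpM2l => //; rewrite ler_nat.
  have ist : i%:R * (x / n%:R) <= i.+1%:R * (x / n%:R).
    by apply: ler_wpM2r => //; rewrite ler_nat.
  have := hW (i%:R * (x / n%:R)) (i.+1%:R * (x / n%:R)).
  have -> : i.+1%:R * (x / n%:R) - i%:R * (x / n%:R) = x / n%:R.
    by rewrite -mulrBl -natr1 addrAC subrr add0r mul1r.
  move=> /(_ (mulr_ge0 (ler0n _ _) xn0) ist hs xd) h1.
  have h2 := IH (ltnW hi).
  have -> : W (i.+1%:R * (x / n%:R)) - W 0 =
    (W (i.+1%:R * (x / n%:R)) - W (i%:R * (x / n%:R))) +
    (W (i%:R * (x / n%:R)) - W 0) by ring.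
  apply: le_trans (ler_normD _ _) _; apply: le_trans (lerD h1 h2) _.
  by rewrite -mulrDr addrA subrK.
have := key n (leqnn n).
by have -> : n%:R * (x / n%:R) = x by field; rewrite lt0r_neq0.
Qed.

(* On a short step the defect of the product formula is at most [e] times the
   integral of [|f| + |g|]; summing over a fine subdivision it vanishes. *)
Lemma racpM p u v f g : 0 <= p -> racp p u f -> racp p v g ->
  racp p (fun x => u x * v x) (fun x => f x * v x + u x * g x).
Proof.
move=> p0 hu hv; have [hf _] := hu; have [hg _] := hv.
have cu := racp_cont p0 hu; have cv := racp_cont p0 hv.
have hfv := itgM_cont hf cv; have hgu := itgM_cont hg cu.
have hG : itg `[0, p]%classic (fun x => f x * v x + u x * g x).
  apply: eq_integrable (integrableD _ hfv hgu) => // x _ /=.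
  by rewrite -EFinD (mulrC (u x)).
split => // x xp.
have := xp => /andP[x0 xp'].
pose W t := u t * v t - (\int[mu]_(y in `[0%R, t]) (f y * v y + u y * g y))%R.
have haf := integrable_norm hf; have hag := integrable_norm hg.
have haH : itg `[0, p]%classic (fun x => `|f x| + `|g x|).
  by have := integrableD _ haf hag; apply.
pose H t := (\int[mu]_(y in `[0%R, t]) (`|f y| + `|g y|))%R.
have W0 : W 0 = u 0 * v 0 by rewrite /W set_itv1 Rintegral_set1 subr0.
suff WE : W x = W 0 by rewrite -W0 -WE /W subrK.
apply/eqP; rewrite -subr_eq0 -normr_le0.
have H0 : 0 <= H x - H 0.
  by rewrite /H (prim_diff haH) //; apply: Rintegral_ge0 => y _; rewrite addr_ge0.
apply/ler_addgt0Pr => e e0; rewrite add0r.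
have e1 : 0 < e / (H x - H 0 + 1) by rewrite divr_gt0 //; lra.
have [d1 d10 hd1] := integral_abs_small hf e1.
have [d2 d20 hd2] := integral_abs_small hg e1.
have d0 : 0 < Num.min d1 d2 by rewrite lt_min d10.
suff hstep s t : 0 <= s -> s <= t -> t <= p -> t - s < Num.min d1 d2 ->
     `|W t - W s| <= e / (H x - H 0 + 1) * (H t - H s).
  apply: le_trans (telescope_small_steps d0 hstep xp) _.
  by rewrite mulrAC ler_pdivrMr; nra.
move=> s0 st tp; rewrite lt_min => /andP[std1 std2].
have If := itg_sub hf s0 tp; have Ig := itg_sub hg s0 tp.
have IG := itg_sub hG s0 tp.
(* Freezing [v] at [s] and [u] at [t] makes this increment an exact integral. The defect then
   contains only [v s - v y] and [u t - u y], both small on a short step. *)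
have E1 : u t * v t - u s * v s = (\int[mu]_(y in `[s, t]) (f y * v s + u t * g y))%R.
  rewrite RintegralD //; first last.
  - by have := integrableZl _ (u t) Ig; apply.
  - by have := integrableZr _ (v s) If; apply.
  rewrite RintegralZl // RintegralZr // -(racp_diff hu) // -(racp_diff hv) //; ring.
have IE : itg `[s, t]%classic (fun y => f y * v s + u t * g y).
  have := integrableD _ (integrableZr _ (v s) If) (integrableZl _ (u t) Ig).
  by apply.
have -> : W t - W s = (\int[mu]_(y in `[s, t]) (f y * (v s - v y) + (u t - u y) * g y))%R.
  rewrite [RHS](@eq_Rintegral _ _ _ mu _ (fun y => (f y * v s + u t * g y) - (f y * v y + u y * g y))); last first.
    by move=> y _; ring.
  rewrite RintegralB // -E1 /W -(prim_diff hG) //; ring.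
have ID : itg `[s, t]%classic (fun y => f y * (v s - v y) + (u t - u y) * g y).
  apply: eq_integrable (integrableB _ IE IG) => // y _ /=.
  by rewrite -EFinB; congr (_%:E); ring.
apply: le_trans (le_normr_Rintegral _ ID) _ => //.
have HE : H t - H s = (\int[mu]_(y in `[s, t]) (`|f y| + `|g y|))%R.
  exact: prim_diff haH s0 st tp.
rewrite HE.
have -> : e / (H x - H 0 + 1) * (\int[mu]_(y in `[s, t]) (`|f y| + `|g y|))%R =
    (\int[mu]_(y in `[s, t]) (e / (H x - H 0 + 1) * (`|f y| + `|g y|)))%R.
  by rewrite (RintegralZl _ _ (itg_sub haH s0 tp)).
apply: le_Rintegral => //.
- by have := integrable_norm ID; apply.
- by have := integrableZl _ (e / (H x - H 0 + 1)) (itg_sub haH s0 tp); apply.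
move=> y; rewrite /= in_itv /= => /andP[sy yt].
apply: le_trans (ler_normD _ _) _; rewrite !normrM mulrDr mulrC; apply: lerD.
  apply: ler_wpM2r => //; rewrite distrC (racp_diff hv) //; last exact: le_trans tp.
  have hgs := itg_sub hg s0 (le_trans yt tp).
  apply: le_trans (le_normr_Rintegral _ hgs) _ => //; apply: ltW.
  by apply: hd2 => //; [exact: le_trans tp | apply: le_lt_trans std2; rewrite lerB].
apply: ler_wpM2r => //; rewrite (racp_diff hu) //; last exact: le_trans sy.
have hfs := itg_sub hf (le_trans s0 sy) tp.
apply: le_trans (le_normr_Rintegral _ hfs) _ => //; apply: ltW.
by apply: hd1 => //; [exact: le_trans sy | apply: le_lt_trans std1; rewrite lerB].
Qed.

End RealProduct.

Section ComplexPrimitives.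
Variable R : realType.
Local Notation mu := (@lebesgue_measure R).
Local Notation itg A f := (mu.-integrable A (EFin \o f)).
Local Notation Re := complex.Re.
Local Notation Im := complex.Im.
Implicit Types (f g u v : R -> R[i]) (s t x p : R).

Lemma racp_derive p (u f : R -> R) : 0 <= p ->
  (forall x : R, is_derive x 1 u (f x)) -> continuous f -> racp p u f.
Proof.
move=> p0 hu cf.
have du x : derivable u x 1 by have [] := hu x.
have cu : continuous u.
  by move=> x; apply: differentiable_continuous; apply/derivable1_diffP.
split; first by apply: itg_cont; exact: continuous_subspaceT.
move=> x /andP[x0 xp]; move: x0; rewrite le_eqVlt => /orP[/eqP <-|x0].
  by rewrite set_itv1 Rintegral_set1 addr0.
rewrite /Rintegral (@continuous_FTC2 _ f u 0 x) //=; first by ring.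
- exact: continuous_subspaceT.
- split; first by move=> y _; exact: du.
    by apply: cvg_at_right_filter; exact: cu.
  by apply: cvg_at_left_filter; exact: cu.
- by move=> y _; rewrite derive1E; apply: derive_val.
Qed.

Definition cacp p u f := racp p (fun x => Re (u x)) (fun x => Re (f x)) /\
  racp p (fun x => Im (u x)) (fun x => Im (f x)).

Definition citg (A : set R) f := itg A (fun x => Re (f x)) /\ itg A (fun x => Im (f x)).

Lemma eq_cacp p u v f g : (forall x, 0 <= x <= p -> u x = v x) ->
  (forall x, 0 <= x <= p -> f x = g x) -> 0 <= p -> cacp p u f -> cacp p v g.
Proof.
move=> uv fg p0 [h1 h2]; split.
  by apply: eq_racp p0 h1 => x xp; rewrite ?uv ?fg.
by apply: eq_racp p0 h2 => x xp; rewrite ?uv ?fg.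
Qed.

Lemma cacp_real p (u f : R -> R) : racp p u f ->
  cacp p (fun x => (u x)%:C%C) (fun x => (f x)%:C%C).
Proof. by move=> h; split => //=; exact: racp_cst. Qed.

Lemma cacp_cst p (k : R[i]) : cacp p (fun=> k) (fun=> 0).
Proof. by split => //=; exact: racp_cst. Qed.

Lemma cacpD p u v f g : cacp p u f -> cacp p v g ->
  cacp p (fun x => u x + v x) (fun x => f x + g x).
Proof.
move=> [h1 h2] [h3 h4]; split.
  have := racpD h1 h3; congr racp; apply/funext => x; by rewrite raddfD.
have := racpD h2 h4; congr racp; apply/funext => x; by rewrite raddfD.
Qed.

Lemma cacpM p u v f g : 0 <= p -> cacp p u f -> cacp p v g ->
  cacp p (fun x => u x * v x) (fun x => f x * v x + u x * g x).
Proof.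
move=> p0 [h1 h2] [h3 h4].
have N w k : racp p w k -> racp p (fun x => - w x) (fun x => - k x).
  by move=> /(racpZ (-1)); congr racp; apply/funext => x; rewrite mulN1r.
split.
  have := racpD (racpM p0 h1 h3) (N _ _ (racpM p0 h2 h4)).
  apply: eq_racp => // x _; case: (u x) (v x) (f x) (g x) => ? ? [? ?] [? ?] [? ?] /=; ring.
have := racpD (racpM p0 h1 h4) (racpM p0 h2 h3).
apply: eq_racp => // x _; case: (u x) (v x) (f x) (g x) => ? ? [? ?] [? ?] [? ?] /=; ring.
Qed.

Lemma cacpZ p (k : R[i]) u f : 0 <= p -> cacp p u f ->
  cacp p (fun x => k * u x) (fun x => k * f x).
Proof.
move=> p0 /(cacpM p0 (cacp_cst p k)); apply: eq_cacp => // x _.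
by rewrite mul0r add0r.
Qed.

Lemma cacpN p u f : 0 <= p -> cacp p u f -> cacp p (fun x => - u x) (fun x => - f x).
Proof. by move=> p0 /(cacpZ (-1) p0); apply: eq_cacp => // x _; rewrite mulN1r. Qed.

Lemma cacpB p u v f g : 0 <= p -> cacp p u f -> cacp p v g ->
  cacp p (fun x => u x - v x) (fun x => f x - g x).
Proof. by move=> p0 hu hv; apply: cacpD => //; exact: cacpN. Qed.

Lemma cacp_sub p p' u f : p' <= p -> cacp p u f -> cacp p' u f.
Proof.
move=> pp [[h1 h2] [h3 h4]]; split; split.
- exact: itg_sub h1 _ pp.
- by move=> x /andP[x0 xp]; apply: h2; rewrite x0 (le_trans xp).
- exact: itg_sub h3 _ pp.
- by move=> x /andP[x0 xp]; apply: h4; rewrite x0 (le_trans xp).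
Qed.

Lemma cacp_citg p u f : cacp p u f -> citg `[0, p] f.
Proof. by move=> [[? _] [? _]]. Qed.

Lemma cacp_val p u f x : cacp p u f -> 0 <= x <= p -> u x - u 0 = cint `[0, x] f.
Proof.
move=> [[_ h1] [_ h2]] xp; have := h1 x xp; have := h2 x xp; rewrite /cint.
by case: (u x) (u 0) => ? ? [? ?] /= -> ->; simpc; congr Complex; ring.
Qed.

Lemma eq_cint (A : set R) f g : (forall x, A x -> f x = g x) -> cint A f = cint A g.
Proof.
move=> fg; rewrite /cint; congr Complex; apply: eq_Rintegral => x.
  by rewrite inE => /fg ->.
by rewrite inE => /fg ->.
Qed.

Lemma cacp_const p u f : 0 <= p -> cacp p u f -> (forall x, 0 <= x <= p -> f x = 0) ->
  forall x, 0 <= x <= p -> u x = u 0.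
Proof.
move=> p0 hu f0 x xp; apply/eqP; rewrite -subr_eq0 (cacp_val hu xp).
rewrite (@eq_cint _ _ (fun=> 0)); last first.
  move=> y; rewrite /= in_itv /= => /andP[y0 yx]; rewrite f0 //.
  by rewrite y0 (le_trans yx) //; case/andP: xp.
by rewrite /cint /= Rintegral_cst // mul0r.
Qed.

Lemma citg_sub p f s t : citg `[0, p] f -> 0 <= s -> t <= p -> citg `[s, t] f.
Proof. by move=> [h1 h2] s0 tp; split; [exact: itg_sub h1 _ _|exact: itg_sub h2 _ _]. Qed.

Lemma cacp_cont p u f : 0 <= p -> cacp p u f ->
  {within `[0, p], continuous (fun x => Re (u x))} /\
  {within `[0, p], continuous (fun x => Im (u x))}.
Proof. by move=> p0 [h1 h2]; split; [exact: racp_cont h1|exact: racp_cont h2]. Qed.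

Lemma cacp_bounded p u f : 0 <= p -> cacp p u f ->
  exists2 M, 0 <= M & forall x, 0 <= x <= p -> nc (u x) <= M.
Proof.
move=> p0 /(cacp_cont p0) [/cont_bounded [M M0 hM] /cont_bounded [N N0 hN]].
exists (M + N); first exact: addr_ge0.
by move=> x xp; apply: le_trans (nc_leD _) _; rewrite lerD ?hM ?hN.
Qed.

Lemma citgM p f v g : 0 <= p -> citg `[0, p] f -> cacp p v g ->
  citg `[0, p] (fun x => f x * v x).
Proof.
move=> p0 [h1 h2] /(cacp_cont p0) [c1 c2].
split.
  apply: eq_integrable (integrableB _ (itgM_cont h1 c1) (itgM_cont h2 c2)) => //.
  by move=> x _ /=; rewrite -EFinB; congr (_%:E); case: (f x) (v x) => ? ? [].
apply: eq_integrable (integrableD _ (itgM_cont h1 c2) (itgM_cont h2 c1)) => //.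
move=> x _ /=; rewrite -EFinD; congr (_%:E); case: (f x) (v x) => ? ? [? ?] /=; ring.
Qed.

Lemma citgD s t f g : citg `[s, t] f -> citg `[s, t] g ->
  citg `[s, t] (fun x => f x + g x).
Proof.
move=> [h1 h2] [h3 h4]; split.
  apply: eq_integrable (integrableD _ h1 h3) => // x _ /=.
  by rewrite raddfD.
apply: eq_integrable (integrableD _ h2 h4) => // x _ /=.
by rewrite raddfD.
Qed.

Lemma citgZ s t (k : R[i]) f : citg `[s, t] f ->
  citg `[s, t] (fun x => k * f x).
Proof.
move=> [h1 h2]; split.
  apply: eq_integrable (integrableB _ (integrableZl _ (Re k) h1) (integrableZl _ (Im k) h2)) => //.
  by move=> x _ /=; rewrite -!EFinM -EFinB; congr (_%:E); case: (k) (f x) => ? ? [].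
apply: eq_integrable (integrableD _ (integrableZl _ (Re k) h2) (integrableZl _ (Im k) h1)) => //.
by move=> x _ /=; rewrite -!EFinM -EFinD; congr (_%:E); case: (k) (f x) => ? ? [].
Qed.

Lemma cintD s t f g : citg `[s, t] f -> citg `[s, t] g ->
  cint `[s, t] (fun x => f x + g x) = cint `[s, t] f + cint `[s, t] g.
Proof.
move=> [h1 h2] [h3 h4]; rewrite /cint; simpc; congr Complex.
  by rewrite -RintegralD //; apply: eq_Rintegral => x _; rewrite raddfD.
by rewrite -RintegralD //; apply: eq_Rintegral => x _; rewrite raddfD.
Qed.

Lemma cintZ s t (k : R[i]) f : citg `[s, t] f ->
  cint `[s, t] (fun x => k * f x) = k * cint `[s, t] f.
Proof.
move=> [h1 h2]; case: k => a b; rewrite /cint; simpc; congr Complex.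
  rewrite -(RintegralZl a) // -(RintegralZl b) // -RintegralB //; last 2 first.
  - by have := integrableZl _ a h1; apply.
  - by have := integrableZl _ b h2; apply.
  by apply: eq_Rintegral => x _; case: (f x).
rewrite -(RintegralZl a) // -(RintegralZl b) // -RintegralD //; last 2 first.
- by have := integrableZl _ a h2; apply.
- by have := integrableZl _ b h1; apply.
by apply: eq_Rintegral => x _; case: (f x).
Qed.

Lemma cintB s t f g : citg `[s, t] f -> citg `[s, t] g ->
  cint `[s, t] (fun x => f x - g x) = cint `[s, t] f - cint `[s, t] g.
Proof.
move=> hf hg.
have -> : (fun x => f x - g x) = (fun x => f x + (-1) * g x).
  by apply/funext => x; rewrite mulN1r.
by rewrite cintD ?cintZ ?mulN1r //; exact: citgZ.
Qed.

(** The factor 2 comes from estimating the real and imaginary parts separately. *)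
Lemma nc_cint_le s t f (h : R -> R) : citg `[s, t] f -> itg `[s, t] h ->
  (forall x, s <= x <= t -> nc (f x) <= h x) ->
  nc (cint `[s, t] f) <= 2 * (\int[mu]_(x in `[s, t]) h x)%R.
Proof.
move=> [h1 h2] hh fh; apply: le_trans (nc_leD _) _.
rewrite mulr_natl mulr2n; apply: lerD.
  apply: le_trans (le_normr_Rintegral _ h1) _ => //; apply: le_Rintegral => //.
    by have := integrable_norm h1; apply.
  by move=> x; rewrite /= in_itv /= => /fh; exact: le_trans (nc_geRe _).
apply: le_trans (le_normr_Rintegral _ h2) _ => //; apply: le_Rintegral => //.
  by have := integrable_norm h2; apply.
by move=> x; rewrite /= in_itv /= => /fh; exact: le_trans (nc_geIm _).
Qed.

Lemma cacp_diff p u f s t : cacp p u f -> 0 <= s -> s <= t -> t <= p ->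
  u t - u s = cint `[s, t] f.
Proof.
move=> [h1 h2] s0 st tp; rewrite /cint -(racp_diff h1) // -(racp_diff h2) //.
by case: (u t) (u s) => ? ? [? ?]; simpc.
Qed.

End ComplexPrimitives.

(** * Solutions of the equation and their dependence on the parameter *)

Section Solutions.
Variable R : realType.
Local Notation mu := (@lebesgue_measure R).
Local Notation itg A f := (mu.-integrable A (EFin \o f)).
Local Notation Re := complex.Re.
Local Notation Im := complex.Im.
Implicit Types (q f y dy h dh F G S dS : R -> R[i]) (s t x p a : R).

Lemma itg_cst p (k : R) : itg `[0, p] (fun=> k).
Proof. by apply: itg_cont => x; exact: cst_continuous. Qed.

(** Square integrability implies integrability on a bounded interval because [|w| <= w ^ 2 + 1]. *)
Lemma L2_component (w : R -> R) q :
  (measurable_fun (@I0pi R) w) ->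
  (forall x, w x ^+ 2 <= nc (q x) ^+ 2) -> L2_0pi q ->
  itg (@I0pi R) (fun x => w x ^+ 2) /\ itg (@I0pi R) w.
Proof.
move=> mw wq [mRe [mIm hq]].
have mI : measurable (@I0pi R : set (measurableTypeR R)) by exact: measurable_itv.
have mq : measurable_fun (@I0pi R) (fun x => nc (q x) ^+ 2).
  apply: (eq_measurable_fun (fun x => Re (q x) ^+ 2 + Im (q x) ^+ 2)).
    by move=> x _; rewrite nc_sqr.
  by apply: measurable_funD; apply: measurable_funX.
have iq : itg (@I0pi R) (fun x => nc (q x) ^+ 2).
  apply/integrableP; split; first exact/measurable_EFinP.
  apply: le_lt_trans hq; rewrite le_eqVlt; apply/orP; left; apply/eqP.
  by apply: eq_integral => x _ /=; rewrite ger0_norm // sqr_ge0.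
have iw2 : itg (@I0pi R) (fun x => w x ^+ 2).
  apply: (le_integrable mI _ _ iq).
    by apply/measurable_EFinP; exact: measurable_funX.
  by move=> x _ /=; rewrite lee_fin !ger0_norm ?sqr_ge0.
split => //.
have i1 : itg (@I0pi R) (fun x => w x ^+ 2 + 1).
  have := integrableD mI iw2 (itg_cst pi 1).
  by apply.
apply: (le_integrable mI _ _ i1); first exact/measurable_EFinP.
move=> x _ /=; rewrite lee_fin [leRHS]ger0_norm; last by rewrite addr_ge0 ?sqr_ge0.
rewrite -[w x ^+ 2]real_normK ?num_real //.
have := sqr_ge0 (`|w x| - 1 / 2); rewrite expr2; nra.
Qed.

Lemma L2_Re q : L2_0pi q -> itg (@I0pi R) (fun x => Re (q x) ^+ 2) /\ itg (@I0pi R) (fun x => Re (q x)).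
Proof.
move=> hq; apply: (L2_component (q := q)) => //; first by case: hq.
by move=> x; rewrite nc_sqr lerDl sqr_ge0.
Qed.

Lemma L2_Im q : L2_0pi q -> itg (@I0pi R) (fun x => Im (q x) ^+ 2) /\ itg (@I0pi R) (fun x => Im (q x)).
Proof.
move=> hq; apply: (L2_component (q := q)) => //; first by case: hq => [_ []].
by move=> x; rewrite nc_sqr lerDr sqr_ge0.
Qed.

Lemma L2_citg q : L2_0pi q -> citg `[0, pi] q.
Proof. by move=> hq; split; [case: (L2_Re hq)|case: (L2_Im hq)]. Qed.

Lemma oint_prim p a x f : citg `[0, p] f -> 0 <= a <= p -> 0 <= x <= p ->
  oint a x f = cint `[0, x] f - cint `[0, a] f.
Proof.
move=> [h1 h2] /andP[a0 ap] /andP[x0 xp]; rewrite /oint /cint.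
have [ax|/ltW xa] := leP a x.
  by rewrite -(prim_diff h1 a0 ax xp) -(prim_diff h2 a0 ax xp); simpc.
by rewrite -(prim_diff h1 x0 xa ap) -(prim_diff h2 x0 xa ap); simpc; congr Complex; ring.
Qed.

Lemma cacp_oint p a (u f : R -> R[i]) : 0 <= p -> citg `[0, p] f -> 0 <= a <= p ->
  (forall x, 0 <= x <= p -> u x = u a + oint a x f) -> cacp p u f.
Proof.
move=> p0 hf ha hu.
have z0 : cint `[0, 0] f = 0 by rewrite /cint set_itv1 !Rintegral_set1.
have h x : 0 <= x <= p -> u x = u 0 + cint `[0, x] f.
  move=> xp; rewrite (hu x) // (hu 0) ?lexx // !(oint_prim hf) ?lexx //.
  by rewrite z0; ring.
have [h1 h2] := hf; split; split => // x xp; rewrite (h x xp).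
  by case: (u 0) => ? ?; rewrite /cint; simpc.
by case: (u 0) => ? ?; rewrite /cint; simpc.
Qed.

Lemma solution_cacp q a (lam : R[i]) y dy : L2_0pi q -> 0 <= a <= pi ->
  is_solution q a lam y dy ->
  cacp pi y dy /\ cacp pi dy (fun x => q x * y a - lam * y x).
Proof.
move=> hq ha [c1 [c2 [c3 [c4 hs]]]].
have p0 : 0 <= pi :> R := pi_ge0 R.
have hs' x : 0 <= x <= pi -> y x = y a + oint a x dy /\
    dy x = dy a + oint a x (fun t => q t * y a - lam * y t).
  by move=> xp; apply: hs; rewrite /I0pi /= in_itv.
have iy : citg `[0, pi] y by split; apply: itg_cont.
have idy : citg `[0, pi] dy by split; apply: itg_cont.
have iq := L2_citg hq.
split; apply: (cacp_oint p0 _ ha) => //.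
- by move=> x /hs' [].
- have -> : (fun x => q x * y a - lam * y x) = (fun x => y a * q x + (- lam) * y x).
    by apply/funext => x; ring.
  by apply: citgD; apply: citgZ.
- by move=> x /hs' [].
Qed.

(** The derivative of a Wronskian. When [F] and [G] contain the same multiple of [y] and [h], these
    terms cancel and only the source is left under the integral. *)
Lemma lagrange_identity p y dy F h dh G : 0 <= p ->
  cacp p y dy -> cacp p dy F -> cacp p h dh -> cacp p dh G ->
  cacp p (fun x => y x * dh x - dy x * h x) (fun x => y x * G x - F x * h x).
Proof.
move=> p0 h1 h2 h3 h4.
have := cacpB p0 (cacpM p0 h1 h4) (cacpM p0 h2 h3).
by apply: eq_cacp => // x _; ring.
Qed.

(** With [lam = rho ^ 2] these are [cos(rho x)] and [sin(rho x) / rho], characterised by their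
    equations; no square root of [lam] is chosen, and [lam = 0] is included. *)
Definition trig_pair p (lam : R[i]) (c s : R -> R[i]) := cacp p s c /\
  cacp p c (fun x => - lam * s x) /\ c 0 = 1 /\ s 0 = 0.

Lemma trig_pair_sqr p lam (c s : R -> R[i]) : 0 <= p -> trig_pair p lam c s ->
  forall x, 0 <= x <= p -> c x ^+ 2 + lam * s x ^+ 2 = 1.
Proof.
move=> p0 [hs [hc [c0 s0]]] x xp.
have h := cacpD (cacpM p0 hc hc) (cacpZ lam p0 (cacpM p0 hs hs)).
have := cacp_const p0 h _ xp; rewrite /= c0 s0 !expr2 => -> //; first by ring.
by move=> t _; ring.
Qed.

(** As [S] is [sin(rho (x - a)) / rho] and [dS] is [cos(rho (x - a))], these are the addition
    formulas that move the base point from [a] to 0. *)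
Lemma trig_pair_of_solution p a lam S dS : 0 <= p -> 0 <= a <= p ->
  cacp p S dS -> cacp p dS (fun x => - lam * S x) -> S a = 0 -> dS a = 1 ->
  trig_pair p lam (fun x => dS x * dS 0 + lam * S x * S 0)
                  (fun x => S x * dS 0 - S 0 * dS x).
Proof.
move=> p0 ha hS hdS Sa dSa.
have E : dS 0 * dS 0 + lam * S 0 * S 0 = 1.
  have h := cacpD (cacpM p0 hdS hdS) (cacpZ lam p0 (cacpM p0 hS hS)).
  have := cacp_const p0 h _ ha; rewrite /= Sa dSa => E.
  rewrite -mulrA -E; first by ring.
  by move=> t _; ring.
split; last split; last by rewrite E; split => //; ring.
- have := cacpB p0 (cacpZ (dS 0) p0 hS) (cacpZ (S 0) p0 hdS).
  by apply: eq_cacp => // x _; ring.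
- have := cacpD (cacpZ (dS 0) p0 hdS) (cacpZ (lam * S 0) p0 hS).
  by apply: eq_cacp => // x _; ring.
Qed.

Lemma cacp_dist_le p (u f : R -> R[i]) (B : R) a x : 0 <= B -> cacp p u f ->
  0 <= a <= p -> 0 <= x <= p ->
  (forall t, 0 <= t <= p -> nc (f t) <= B) -> nc (u x - u a) <= 2 * p * B.
Proof.
move=> B0 hu; wlog ax : a x / a <= x.
  move=> H ha hx hB; have [ax|/ltW xa] := leP a x; first exact: H.
  by rewrite ncBC; exact: H.
move=> /andP[a0 ap] /andP[x0 xp] hB; rewrite (cacp_diff hu) //.
have hf := citg_sub (cacp_citg hu) a0 xp.
have hc : itg `[a, x] (fun=> B).
  exact: itg_sub (itg_cst p B) a0 xp.
apply: le_trans (nc_cint_le hf hc _) _.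
  by move=> t /andP[at_ tx]; apply: hB; rewrite (le_trans a0) // (le_trans tx).
have hm : fine (mu `[a, x]%classic) = x - a.
  rewrite lebesgue_measure_itv /= lte_fin; case: ltP => h //=.
  by have -> : x = a; [apply/eqP; rewrite eq_le h | rewrite subrr].
have -> : (\int[mu]_(t in `[a, x]) B)%R = B * (x - a) by rewrite -hm Rintegral_cst.
rewrite -mulrA ler_wpM2l // mulrC ler_wpM2r //; lra.
Qed.

(* Variation of constants, with the unknown supremum absorbed for small
   [m - lam]. *)
Lemma solution_lip p a (q : R -> R[i]) (lam y0 : R[i]) (c s y dy : R -> R[i]) : 0 <= p -> 0 <= a <= p ->
  trig_pair p lam c s ->
  cacp p y dy -> cacp p dy (fun x => q x * y0 - lam * y x) ->
  exists K d : R, [/\ 0 <= K, 0 < d & forall m u du, nc (m - lam) <= d ->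
    cacp p u du -> cacp p du (fun x => q x * y0 - m * u x) ->
    u a = y a -> du a = dy a -> forall x, 0 <= x <= p ->
    nc (u x - y x) <= K * nc (m - lam) /\ nc (du x - dy x) <= K * nc (m - lam)].
Proof.
move=> p0 ha tcs hy hdy; have [hs [hc [c0 s0]]] := tcs.
have cs1 := trig_pair_sqr p0 tcs.
have [Mc Mc0 hMc] := cacp_bounded p0 hc; have [Ms Ms0 hMs] := cacp_bounded p0 hs.
have [My My0 hMy] := cacp_bounded p0 hy.
(* [g x t] is [sin(rho (x - t)) / rho] and [k x t] is [cos(rho (x - t))], the kernels that recover
   [D x] and [dD x] from the source; [dg] and [dk] are their derivatives in [t]. *)
pose g x t := s x * c t - c x * s t.
pose dg x t := - lam * s x * s t - c x * c t.
pose k x t := c x * c t + lam * s x * s t.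
pose dk x t := - lam * c x * s t + lam * s x * c t.
have hg x : cacp p (g x) (dg x).
  have := cacpB p0 (cacpZ (s x) p0 hc) (cacpZ (c x) p0 hs).
  by apply: eq_cacp => // t _; rewrite /g /dg; ring.
have hdg x : cacp p (dg x) (fun t => - lam * g x t).
  have := cacpB p0 (cacpZ (- lam * s x) p0 hs) (cacpZ (c x) p0 hc).
  by apply: eq_cacp => // t _; rewrite /g /dg; ring.
have hk x : cacp p (k x) (dk x).
  have := cacpD (cacpZ (c x) p0 hc) (cacpZ (lam * s x) p0 hs).
  by apply: eq_cacp => // t _; rewrite /k /dk; ring.
have hdk x : cacp p (dk x) (fun t => - lam * k x t).
  have := cacpD (cacpZ (- lam * c x) p0 hs) (cacpZ (lam * s x) p0 hc).
  by apply: eq_cacp => // t _; rewrite /k /dk; ring.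
pose B := 2 * Mc * Ms + Mc * Mc + nc lam * Ms * Ms.
have l0 := nc_ge0 lam.
have B0 : 0 <= B by rewrite /B !addr_ge0 ?mulr_ge0.
have hgB x t : 0 <= x <= p -> 0 <= t <= p -> nc (g x t) <= B.
  move=> xp tp; apply: le_trans (ncB _ _) _; rewrite !ncM /B.
  have := ler_pM (nc_ge0 _) (nc_ge0 _) (hMs x xp) (hMc t tp).
  have := ler_pM (nc_ge0 _) (nc_ge0 _) (hMc x xp) (hMs t tp).
  have : 0 <= Mc * Mc + nc lam * Ms * Ms by rewrite !addr_ge0 ?mulr_ge0.
  nra.
have hkB x t : 0 <= x <= p -> 0 <= t <= p -> nc (k x t) <= B.
  move=> xp tp; apply: le_trans (ncD _ _) _; rewrite !ncM /B.
  have h1 := ler_pM (nc_ge0 _) (nc_ge0 _) (hMc x xp) (hMc t tp).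
  have h2 := ler_wpM2l l0 (ler_pM (nc_ge0 _) (nc_ge0 _) (hMs x xp) (hMs t tp)).
  have : 0 <= 2 * Mc * Ms by rewrite !mulr_ge0.
  rewrite !mulrA in h2; nra.
pose Q := 2 * p * B.
have Q0 : 0 <= Q by rewrite /Q !mulr_ge0.
(* This radius gives [Q * nc (m - lam) <= 1 / 2], so that [u] is bounded by [2 * My]. *)
exists (Q * (2 * My)), (2 * (Q + 1))^-1; split.
- by rewrite !mulr_ge0.
- by rewrite invr_gt0; lra.
move=> m u du hm hu hdu ua dua.
pose D x := u x - y x; pose dD x := du x - dy x.
have hD : cacp p D dD by exact: cacpB.
have hdD : cacp p dD (fun x => - lam * D x - (m - lam) * u x).
  by have := cacpB p0 hdu hdy; apply: eq_cacp => // t _; rewrite /D; ring.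
have Da : D a = 0 by rewrite /D ua subrr.
have dDa : dD a = 0 by rewrite /dD dua subrr.
have [Mu Mu0 hMu] := cacp_bounded p0 hu.
have e0 := nc_ge0 (m - lam).
have bound (M : R) : 0 <= M -> (forall t, 0 <= t <= p -> nc (u t) <= M) ->
    forall x, 0 <= x <= p -> nc (D x) <= Q * M * nc (m - lam) /\
      nc (dD x) <= Q * M * nc (m - lam).
  move=> M0 hM x xp.
  have eqQ : Q * M * nc (m - lam) = 2 * p * (nc (m - lam) * M * B).
    by rewrite /Q; ring.
  split.
    have hL := lagrange_identity p0 hD hdD (hg x) (hdg x).
    have := @cacp_dist_le _ _ _ (nc (m - lam) * M * B) a x _ hL ha xp _.
    rewrite /= Da dDa !mul0r !subr0 /g /dg => h.
    have -> : D x = - (D x * (- lam * s x * s x - c x * c x) -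
                     dD x * (s x * c x - c x * s x)).
      by rewrite -[LHS]mulr1 -(cs1 x xp); ring.
    rewrite ncN eqQ; apply: h; first by rewrite !mulr_ge0.
    move=> t tp; have -> : D t * (- lam * (s x * c t - c x * s t)) -
      (- lam * D t - (m - lam) * u t) * (s x * c t - c x * s t) =
      (m - lam) * u t * g x t by rewrite /g; ring.
    rewrite !ncM; apply: ler_pM; rewrite ?mulr_ge0 ?nc_ge0 //; last exact: hgB.
    by rewrite ler_wpM2l // hM.
  have hL := lagrange_identity p0 hD hdD (hk x) (hdk x).
  have := @cacp_dist_le _ _ _ (nc (m - lam) * M * B) a x _ hL ha xp _.
  rewrite /= Da dDa !mul0r !subr0 /k /dk => h.
  have -> : dD x = - (D x * (- lam * c x * s x + lam * s x * c x) -
                     dD x * (c x * c x + lam * s x * s x)).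
    by rewrite -[LHS]mulr1 -(cs1 x xp); ring.
  rewrite ncN eqQ; apply: h; first by rewrite !mulr_ge0.
  move=> t tp; have -> : D t * (- lam * (c x * c t + lam * s x * s t)) -
    (- lam * D t - (m - lam) * u t) * (c x * c t + lam * s x * s t) =
    (m - lam) * u t * k x t by rewrite /k; ring.
  rewrite !ncM; apply: ler_pM; rewrite ?mulr_ge0 ?nc_ge0 //; last exact: hkB.
  by rewrite ler_wpM2l // hM.
have Qm : Q * nc (m - lam) <= 1 / 2.
  have h : nc (m - lam) * (2 * (Q + 1)) <= 1.
    by rewrite -ler_pdivlMr ?div1r //; lra.
  nra.
have hu2 t : 0 <= t <= p -> nc (u t) <= 2 * My.
  pose A := [set r | exists2 t, 0 <= t <= p & r = nc (u t)]%classic.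
  have hA : has_sup A.
    split; first by exists (nc (u a)), a.
    by exists Mu => r [x xp ->]; exact: hMu.
  have subA x : 0 <= x <= p -> nc (u x) <= sup A.
    by move=> xp; apply: sup_upper_bound => //; exists x.
  have supA0 : 0 <= sup A by apply: le_trans (subA _ ha); exact: nc_ge0.
  have : sup A <= My + sup A / 2.
    apply: ge_sup; first by case: hA.
    move=> r [x xp ->]; have [h _] := bound _ supA0 subA x xp.
    have := ncD (D x) (y x); rewrite {1}/D subrK; have := hMy x xp; nra.
  move=> h /subA; lra.
by move=> x xp; apply: bound => //; rewrite mulr_ge0.
Qed.

End Solutions.

(** * Eigenfunctions and pointwise Fourier expansion *)

Section Eigenfunctions.
Variable R : realType.
Local Notation mu := (@lebesgue_measure R).
Local Notation itg A f := (mu.-integrable A (EFin \o f)).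
Local Notation I := `[0, pi]%classic.
Implicit Types (al be : bool) (u v z f g : R -> R) (n m N : nat) (x t a k : R).

(** Indices start at 0: the square is the unperturbed eigenvalue of number [n + 1]. *)
Definition freq al be n : R := n%:R + 1 - (al + be)%N%:R / 2.

Definition eigf al be n x : R :=
  if al then cos (freq al be n * x) else sin (freq al be n * x).

Definition deigf al be n x : R :=
  if al then - (freq al be n * sin (freq al be n * x))
  else freq al be n * cos (freq al be n * x).

Lemma racp_sin p k : 0 <= p -> racp p (fun x => sin (k * x)) (fun x => k * cos (k * x)).
Proof.
move=> p0; apply: racp_derive => // x.
  have h1 : is_derive x 1 (fun x => k * x) k.
    by have := is_deriveZ k (is_derive_id x 1); rewrite /GRing.scale /= mulr1.
  have := is_derive1_comp (is_derive_sin (k * x)) h1.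
  by rewrite /GRing.scale /= mulrC.
move=> y; apply: cvgM; first exact: cvg_cst.
apply: (@continuous_comp _ _ _ (fun x => k * x) cos); last exact: continuous_cos.
by apply: cvgM; [exact: cvg_cst | exact: cvg_id].
Qed.

Lemma racp_cos p k : 0 <= p -> racp p (fun x => cos (k * x)) (fun x => - (k * sin (k * x))).
Proof.
move=> p0; apply: racp_derive => // x.
  have h1 : is_derive x 1 (fun x => k * x) k.
    by have := is_deriveZ k (is_derive_id x 1); rewrite /GRing.scale /= mulr1.
  have := is_derive1_comp (is_derive_cos (k * x)) h1.
  by rewrite /GRing.scale /= mulrC mulrN.
move=> y; apply: cvgN; apply: cvgM; first exact: cvg_cst.
apply: (@continuous_comp _ _ _ (fun x => k * x) sin); last exact: continuous_sin.
by apply: cvgM; [exact: cvg_cst | exact: cvg_id].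
Qed.

Lemma racp_id p : 0 <= p -> racp p (fun x => x) (fun=> 1).
Proof.
by move=> p0; apply: racp_derive => // x; exact: cst_continuous.
Qed.

Lemma racpN p u f : 0 <= p -> racp p u f -> racp p (fun x => - u x) (fun x => - f x).
Proof.
by move=> p0 /(racpZ (-1)); apply: eq_racp => // x _; rewrite mulN1r.
Qed.

Lemma racp_eigf p al be n : 0 <= p -> racp p (eigf al be n) (deigf al be n).
Proof.
by move=> p0; rewrite /eigf /deigf; case: al; [exact: racp_cos|exact: racp_sin].
Qed.

Lemma racp_deigf p al be n : 0 <= p ->
  racp p (deigf al be n) (fun x => - (freq al be n ^+ 2 * eigf al be n x)).
Proof.
move=> p0; rewrite /eigf /deigf; case: al.
  have := racpN p0 (racpZ (freq true be n) (racp_sin (freq true be n) p0)).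
  by apply: eq_racp => // x _; ring.
have := racpZ (freq false be n) (racp_cos (freq false be n) p0).
by apply: eq_racp => // x _; ring.
Qed.

Lemma sin_natpi n : sin (n%:R * pi) = 0 :> R.
Proof.
elim: n => [|n IH]; first by rewrite mul0r sin0.
by rewrite -natr1 mulrDl mul1r sinDpi IH oppr0.
Qed.

Lemma cos_natpi n : cos (n%:R * pi) = (-1) ^+ n :> R.
Proof.
elim: n => [|n IH]; first by rewrite mul0r cos0 expr0.
by rewrite -natr1 mulrDl mul1r cosDpi IH exprS mulN1r.
Qed.

Lemma eigf_bc0 al be n : (if al then deigf al be n 0 else eigf al be n 0) = 0.
Proof. by rewrite /eigf /deigf; case: al; rewrite mulr0 sin0 ?mulr0 ?oppr0. Qed.

Lemma freq_half al be n : al != be -> freq al be n * pi = n%:R * pi + pi / 2 :> R.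
Proof.
rewrite /freq; case: al be => [] [] // _.
  by rewrite -[(true + false)%N]/1%N; field.
by rewrite -[(false + true)%N]/1%N; field.
Qed.

Lemma eigf_bcpi al be n : (if be then deigf al be n pi else eigf al be n pi) = 0.
Proof.
rewrite /eigf /deigf; case: al be => [] [].
- have -> : freq true true n = n%:R by rewrite /freq -[(true + true)%N]/2%N; field.
  by rewrite sin_natpi mulr0 oppr0.
- by rewrite freq_half // cosDpihalf sin_natpi oppr0.
- by rewrite freq_half // cosDpihalf sin_natpi oppr0 mulr0.
have -> : freq false false n = n.+1%:R by rewrite /freq -[(false + false)%N]/0%N mul0r subr0 natr1.
exact: sin_natpi.
Qed.

(** The reciprocal of the squared norm of the mode; the exception is the constant Neumann mode. *)
Definition weight al be n : R := (if [&& al, be & n == 0%N] then 1 else 2) / pi.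

Lemma racp_int p u f : 0 <= p -> racp p u f ->
  (\int[mu]_(x in `[0%R, p]) f x)%R = u p - u 0.
Proof. by move=> p0 [_ h]; rewrite (h p) ?lexx ?p0 //; ring. Qed.

Let pi0 : 0 <= pi :> R := pi_ge0 R.

Lemma wronskian_bc (a0 a1 b0 b1 : R) (c : bool) :
  (if c then a1 else a0) = 0 -> (if c then b1 else b0) = 0 -> a0 * b1 - a1 * b0 = 0.
Proof. by case: c => -> ->; rewrite !(mul0r, mulr0) subrr. Qed.

Lemma itg_eigf al be n : itg I (eigf al be n).
Proof. by apply: itg_cont; exact: racp_cont (racp_eigf al be n pi0). Qed.

Lemma itgM_eigf al be n u : itg I u -> itg I (fun x => u x * eigf al be n x).
Proof. by move=> hu; apply: itgM_cont => //; exact: racp_cont (racp_eigf al be n pi0). Qed.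

Lemma freq_inj al be m n : freq al be m ^+ 2 = freq al be n ^+ 2 -> m = n.
Proof.
move=> /eqP; rewrite eqf_sqr => /orP[] /eqP; rewrite /freq => E.
  by apply/eqP; rewrite -(eqr_nat R); apply/eqP; lra.
have h : (al + be)%N%:R <= 2 :> R by rewrite ler_nat; case: al be {E} => [] [].
have m0 : 0 <= m%:R :> R by []. have n0 : 0 <= n%:R :> R by [].
by apply/eqP; rewrite -(eqr_nat R); apply/eqP; lra.
Qed.

Lemma freq_ge0 al be n : 0 <= freq al be n.
Proof.
have h : (al + be)%N%:R <= 2 :> R by rewrite ler_nat; case: al be => [] [].
have n0 : 0 <= n%:R :> R by []. rewrite /freq; lra.
Qed.

Lemma freq_eq0 al be n : (freq al be n == 0) = [&& al, be & n == 0%N].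
Proof.
have n0 : 0 <= n%:R :> R by [].
rewrite /freq; case: al be => [] [] /=; rewrite ?addn0 ?add0n.
- rewrite -(eqr_nat R); apply/eqP/eqP => h; rewrite ?h; lra.
- by apply/eqP => h; lra.
- by apply/eqP => h; lra.
- by apply/eqP => h; lra.
Qed.

Lemma eigf_orth al be m n : m != n ->
  (\int[mu]_(x in I) (eigf al be m x * eigf al be n x))%R = 0.
Proof.
move=> mn.
have h := racpD (racpM pi0 (racp_eigf al be m pi0) (racp_deigf al be n pi0))
  (racpN pi0 (racpM pi0 (racp_deigf al be m pi0) (racp_eigf al be n pi0))).
have := racp_int pi0 h.
rewrite /= (wronskian_bc (eigf_bc0 al be m) (eigf_bc0 al be n)).
rewrite (wronskian_bc (eigf_bcpi al be m) (eigf_bcpi al be n)) subrr.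
rewrite (@eq_Rintegral _ _ _ mu _ (fun x => (freq al be m ^+ 2 - freq al be n ^+ 2) *
  (eigf al be m x * eigf al be n x))); last by move=> x _; ring.
rewrite RintegralZl //; last exact/itgM_eigf/itg_eigf.
move=> /eqP; rewrite mulf_eq0 => /orP[|/eqP //].
by rewrite subr_eq0 => /eqP/freq_inj/eqP; rewrite (negbTE mn).
Qed.

Lemma itg_pi_int : (\int[mu]_(x in I) 1)%R = pi.
Proof. by rewrite (racp_int pi0 (racp_id pi0)) subr0. Qed.

Lemma eigf_sqr al be n x :
  deigf al be n x ^+ 2 + freq al be n ^+ 2 * eigf al be n x ^+ 2 = freq al be n ^+ 2.
Proof.
rewrite /deigf /eigf; have := cos2Dsin2 (freq al be n * x).
by case: al => h; rewrite -[RHS]mulr1 -h; ring.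
Qed.

Lemma eigf_norm al be n :
  (\int[mu]_(x in I) (eigf al be n x * eigf al be n x))%R = (weight al be n)^-1.
Proof.
have pin0 : pi != 0 :> R by rewrite lt0r_neq0 // pi_gt0.
rewrite /weight; have := freq_eq0 al be n.
case: ifP => [/and3P[ha hb _] /eqP nu0|_ /negbT nu0].
  rewrite invf_div divr1 -[RHS]itg_pi_int; apply: eq_Rintegral => x _.
  by rewrite /eigf nu0 ha mul0r cos0 mulr1.
set nu := freq al be n in nu0 *.
(* With [e] the mode, [(e e')' = nu ^ 2 - 2 nu ^ 2 e ^ 2], and [e e'] vanishes at both ends. *)
have h := racpM pi0 (racp_eigf al be n pi0) (racp_deigf al be n pi0).
have := racp_int pi0 h.
have bz (a0 a1 : R) (c : bool) : (if c then a1 else a0) = 0 -> a0 * a1 = 0.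
  by case: c => ->; rewrite ?mul0r ?mulr0.
rewrite /= (bz _ _ _ (eigf_bc0 al be n)) (bz _ _ _ (eigf_bcpi al be n)) subrr.
rewrite (@eq_Rintegral _ _ _ mu _ (fun x => nu ^+ 2 * 1 -
   (2 * nu ^+ 2) * (eigf al be n x * eigf al be n x))); last first.
  move=> x _; rewrite mulr1 -[X in _ = X - _](eigf_sqr al be n x) -/nu; ring.
have i1 : itg I (fun=> 1) by exact: itg_cst.
have i2 : itg I (fun x => eigf al be n x * eigf al be n x) by exact/itgM_eigf/itg_eigf.
rewrite RintegralB //; last 2 first.
- by have := integrableZl _ (nu ^+ 2) i1; apply.
- by have := integrableZl _ (2 * nu ^+ 2) i2; apply.
rewrite (RintegralZl _ _ i1) // (RintegralZl _ _ i2) // itg_pi_int => E.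
apply: (mulfI (mulf_neq0 (_ : 2 != 0) (expf_neq0 2 nu0))); first by rewrite pnatr_eq0.
rewrite invf_div; have -> : 2 * nu ^+ 2 * (pi / 2) = nu ^+ 2 * pi by field.
by apply/esym/eqP; rewrite -subr_eq0 E.
Qed.

Definition l2fun u := itg I u /\ itg I (fun x => u x * u x).

Definition fcoef al be u n : R := (\int[mu]_(x in I) (u x * eigf al be n x))%R.

Definition resid al be u N x : R :=
  u x - \sum_(n < N) weight al be n * fcoef al be u n * eigf al be n x.

Lemma weight_gt0 al be n : 0 < weight al be n.
Proof. by rewrite /weight; case: ifP => _; rewrite divr_gt0 ?pi_gt0. Qed.

(** Orthogonal modes are removed one at a time: later coefficients do not change, and the squared
    norm drops by exactly the share of the removed mode. *)
Lemma resid_spec al be u N : l2fun u ->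
  [/\ itg I (resid al be u N), itg I (fun x => resid al be u N x * resid al be u N x),
   forall m, (N <= m)%N -> fcoef al be (resid al be u N) m = fcoef al be u m &
   (\int[mu]_(x in I) (resid al be u N x * resid al be u N x))%R =
   (\int[mu]_(x in I) (u x * u x))%R -
     \sum_(n < N) weight al be n * fcoef al be u n ^+ 2].
Proof.
move=> [hu hu2]; elim: N => [|N [h1 h2 h3 h4]].
  have -> : resid al be u 0 = u by apply/funext => x; rewrite /resid big_ord0 subr0.
  by split => //; rewrite big_ord0 subr0.
set k := weight al be N * fcoef al be u N.
pose r := resid al be u N; pose e := eigf al be N.
have rE : resid al be u N.+1 = (fun x => r x - k * e x).
  by apply/funext => x; rewrite /r /resid /k /e big_ord_recr /=; ring.
have mI : measurable (I : set (measurableTypeR R)) by exact: measurable_itv.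
have he : itg I e by exact: itg_eigf.
have hke : itg I (fun x => k * e x) by have := integrableZl mI k he; apply.
have hre : itg I (fun x => r x * e x) by exact: itgM_eigf.
have hee : itg I (fun x => e x * e x) by exact: itgM_eigf.
have hre' : itg I (fun x => 2 * k * (r x * e x)).
  by have := integrableZl mI (2 * k) hre; apply.
have hee' : itg I (fun x => k ^+ 2 * (e x * e x)).
  by have := integrableZl mI (k ^+ 2) hee; apply.
have hd : itg I (fun x => r x * r x - 2 * k * (r x * e x)).
  by have := integrableB mI h2 hre'; apply.
have sqE x : (r x - k * e x) * (r x - k * e x) =
    (r x * r x - 2 * k * (r x * e x)) + k ^+ 2 * (e x * e x) by ring.
rewrite rE; split.
- by have := integrableB mI h1 hke; apply.
- have := integrableD mI hd hee'; apply: eq_integrable => // x _ /=.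
  by rewrite sqE EFinD.
- move=> m Nm; rewrite -(h3 m (ltnW Nm)) /fcoef.
  have hem : itg I (fun x => e x * eigf al be m x) by exact: itgM_eigf.
  have hrm : itg I (fun x => r x * eigf al be m x) by exact: itgM_eigf.
  rewrite (@eq_Rintegral _ _ _ mu _ (fun x => r x * eigf al be m x -
     k * (e x * eigf al be m x))); last by move=> x _; ring.
  rewrite RintegralB //; last by have := integrableZl mI k hem; apply.
  by rewrite (RintegralZl _ _ hem) // eigf_orth ?mulr0 ?subr0 // ltn_eqF.
rewrite (@eq_Rintegral _ _ _ mu _ (fun x => (r x * r x - 2 * k * (r x * e x)) + k ^+ 2 * (e x * e x)));
  last by move=> x _; rewrite sqE.
rewrite (RintegralD _ hd hee') // (RintegralB _ h2 hre') // (RintegralZl _ _ hre) //.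
rewrite (RintegralZl _ _ hee) // eigf_norm -/(fcoef al be r N) h3 // h4 big_ord_recr /=.
by rewrite /k; field; rewrite lt0r_neq0 // weight_gt0.
Qed.

Lemma bessel al be u : l2fun u ->
  exists M, forall N, \sum_(n < N) weight al be n * fcoef al be u n ^+ 2 <= M.
Proof.
move=> hu; exists (\int[mu]_(x in I) (u x * u x))%R => N.
have [_ _ _ h] := resid_spec al be N hu; rewrite -subr_ge0 -h.
by apply: Rintegral_ge0 => x _; rewrite -expr2 sqr_ge0.
Qed.

Lemma fcoef_bseries al be u : l2fun u -> bseries (fun n => fcoef al be u n ^+ 2).
Proof.
move=> /(bessel al be) [M hM]; exists (pi * M) => N.
have p0 : 0 < pi :> R by exact: pi_gt0.
rewrite -ler_pdivrMl // mulr_sumr; apply: le_trans (hM N); apply: ler_sum => n _.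
apply: ler_wpM2r; first exact: sqr_ge0.
rewrite /weight -[X in X <= _]mul1r; apply: ler_wpM2r; first by rewrite invr_ge0 ltW.
by case: ifP => _; rewrite ?ler1n.
Qed.

(** The Riemann-Lebesgue lemma for square-integrable functions, as a consequence of Bessel's
    inequality. *)
Lemma fcoef_small al be u : l2fun u -> forall e, 0 < e ->
  exists N, forall n, (N <= n)%N -> `|fcoef al be u n| < e.
Proof.
move=> hu e e0.
have e2 : 0 < e ^+ 2 by exact: exprn_gt0.
have [|N hN] := bseries_tail _ (fcoef_bseries al be hu) e2.
  by move=> n; exact: sqr_ge0.
exists N => n Nn; have := hN n.+1; rewrite big_nat_recr //=.
have : 0 <= \sum_(N <= i < n) fcoef al be u i ^+ 2.
  by apply: sumr_ge0 => i _; exact: sqr_ge0.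
move=> h1 h2; rewrite -(ltr_pXn2r (n := 2)) ?nnegrE ?(ltW e0) //.
by rewrite real_normK ?num_real //; lra.
Qed.

End Eigenfunctions.

(** * Convergence of the Fourier series at one point *)

Section PointwiseFourier.
Variable R : realType.
Local Notation mu := (@lebesgue_measure R).
Local Notation itg A f := (mu.-integrable A (EFin \o f)).
Local Notation I := `[0, pi]%classic.
Local Notation weight := (weight R).
Implicit Types (al be : bool) (u v z f g : R -> R) (n m N : nat) (x t a k : R).

Let pi0 : 0 <= pi :> R := pi_ge0 R.

Lemma racp_lip p u f (M : R) s t : racp p u f -> 0 <= s <= p -> 0 <= t <= p ->
  (forall x, 0 <= x <= p -> `|f x| <= M) -> `|u t - u s| <= M * `|t - s|.
Proof.
move=> hu; wlog st : s t / s <= t.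
  move=> H hs ht hM; have [st|/ltW ts] := leP s t; first exact: H.
  by rewrite distrC [`|t - s|]distrC; exact: H.
move=> /andP[s0 sp] /andP[t0 tp] hM; rewrite (racp_diff hu) //.
have hf : itg `[s, t]%classic f by case: hu => hf _; exact: itg_sub hf _ _.
have hc : itg `[s, t]%classic (fun=> M) by exact: itg_sub (itg_cst p M) s0 tp.
apply: le_trans (le_normr_Rintegral _ hf) _ => //.
apply: (@le_trans _ _ (\int[mu]_(x in `[s, t]) M)%R).
  apply: le_Rintegral => //; first by have := integrable_norm hf; apply.
  move=> x; rewrite /= in_itv /= => /andP[sx xt]; apply: hM.
  by rewrite (le_trans s0) // (le_trans xt).
have -> : (\int[mu]_(x in `[s, t]) M)%R = M * (t - s).
  have h1 := racp_diff (racpZ M (racp_id (le_trans s0 sp))) s0 st tp.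
  rewrite mulrBr h1; apply: eq_Rintegral => x _; by rewrite mulr1.
by rewrite ger0_norm // subr_ge0.
Qed.

Lemma sin_ge_xcos x : 0 <= x <= pi -> x * cos x <= sin x.
Proof.
move=> /andP[x0 xp].
have h1 := racp_cos 1 pi0; have h2 := racp_sin 1 pi0.
have h := racpD h2 (racpN pi0 (racpM pi0 (racp_id pi0) h1)).
have [_ /(_ x)] := h; rewrite x0 xp !mul1r sin0 mul0r subr0 add0r => /(_ isT) E.
rewrite -subr_ge0 E; apply: Rintegral_ge0 => y /=; rewrite in_itv /= => /andP[y0 yx].
rewrite !mul1r; have -> : cos y - (cos y + y * - sin y) = y * sin y by ring.
by rewrite mulr_ge0 // sin_ge0_pi // y0 (le_trans yx).
Qed.

(** With [C = cos (x / 2)], [sin_ge_xcos] at [x / 2] and doubling give [sin x >= x * C ^ 2], while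
    [cos x >= 0] gives [C ^ 2 >= 1 / 2]. *)
Lemma sin_ge_half x : 0 <= x <= pi / 2 -> x / 2 <= sin x.
Proof.
move=> /andP[x0 xp].
have pg := pi_gt0 R.
have y0 : 0 <= x / 2 <= pi by apply/andP; split; lra.
have h1 := sin_ge_xcos y0.
have hc : 0 <= cos x by apply: cos_ge0_pihalf; apply/andP; split; lra.
have hc2 : 0 <= cos (x / 2) by apply: cos_ge0_pihalf; apply/andP; split; lra.
have E : x = (x / 2) *+ 2 by rewrite -mulr_natr; field.
have Es : sin x = cos (x / 2) * sin (x / 2) + cos (x / 2) * sin (x / 2).
  by rewrite {1}E sin_mulr2n.
have Ec : cos x = cos (x / 2) ^+ 2 + cos (x / 2) ^+ 2 - 1.
  by rewrite {1}E cos_mulr2n.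
rewrite Es; rewrite Ec in hc.
set C := cos (x / 2) in h1 hc hc2 *; set S := sin (x / 2) in h1 *.
have h2 : x / 2 * C * C <= S * C by apply: ler_wpM2r.
have h3 : x * (C ^+ 2 + C ^+ 2 - 1) >= 0 by apply: mulr_ge0.
lra.
Qed.

Lemma racp_comb al be N (k : nat -> R) :
  exists f, racp pi (fun x => \sum_(n < N) k n * eigf al be n x) f.
Proof.
elim: N => [|N [f hf]].
  exists (fun=> 0); apply: eq_racp (racp_cst pi 0) => // x _; by rewrite big_ord0.
exists (fun x => f x + k N * deigf al be N x).
have := racpD hf (racpZ (k N) (racp_eigf al be N pi0)).
by apply: eq_racp => // x _; rewrite big_ord_recr.
Qed.

Lemma fcoef_comb al be N (k : nat -> R) u : itg I u ->
  \sum_(n < N) k n * fcoef al be u n =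
  (\int[mu]_(x in I) (u x * (\sum_(n < N) k n * eigf al be n x)))%R.
Proof.
move=> hu; elim: N => [|N IH].
  rewrite big_ord0 (@eq_Rintegral _ _ _ mu _ (fun=> 0 : R)) ?Rintegral_cst ?mul0r //.
  by move=> x _; rewrite big_ord0 mulr0.
have [f /(racp_cont pi0) hc] := racp_comb al be N k.
have h1 := itgM_cont hu hc; have h2 := itgM_eigf al be N hu.
rewrite big_ord_recr /= IH /fcoef -(RintegralZl _ _ h2) // -RintegralD //; last first.
  by have := integrableZl _ (k N) h2; apply.
by apply: eq_Rintegral => x _; rewrite big_ord_recr /=; ring.
Qed.

(** The quotient [z / r] in a form that is visibly measurable; where [r] vanishes the factor [r]
    makes it 0. *)
Lemma measurable_quot (z r dz dr : R -> R) : racp pi z dz -> racp pi r dr ->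
  measurable_fun I (fun t => z t * r t * (r t ^+ 2) `^ (-1)).
Proof.
move=> hz hr.
have mc u f : racp pi u f -> measurable_fun I u.
  move=> /(racp_cont pi0) h; exact: subspace_continuous_measurable_fun.
apply: measurable_funM; first by apply: measurable_funM; [exact: mc hz | exact: mc hr].
have := measurableT_comp (@measurable_powR R (-1)) (measurable_funX 2 (mc _ _ hr)).
by apply.
Qed.

Lemma quotE (z r : R) : r != 0 -> z * r * (r ^+ 2) `^ (-1) = z / r.
Proof. by move=> r0; rewrite powR_inv1 ?sqr_ge0 //; field. Qed.

Lemma bounded_l2fun v (B : R) : measurable_fun I v ->
  (forall t, 0 <= t <= pi -> `|v t| <= B) -> l2fun v.
Proof.
move=> mv hB.
have mI : measurable (I : set (measurableTypeR R)) by exact: measurable_itv.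
have fin : (mu I < +oo)%E by rewrite lebesgue_measure_itv /=; case: ifP => _; rewrite -?EFinD ltry.
split.
  apply: measurable_bounded_integrable => //; exists B; split; rewrite ?num_real //.
  move=> y By t /=; rewrite in_itv /= => ht; exact: le_trans (hB t ht) (ltW By).
apply: measurable_bounded_integrable => //; first exact: measurable_funM.
exists (B * B); split; rewrite ?num_real //.
move=> y By t /=; rewrite in_itv /= => ht; apply: le_trans (ltW By).
by rewrite normrM; apply: ler_pM => //; exact: hB.
Qed.

(* Chernoff's argument: once [z] is a multiple of the lowest eigenfunction plus
   a multiple of [r], the partial sum at [a] telescopes to two Fourier
   coefficients of the quotient. *)
Lemma fourier_telescope al be be' a (z dz r dr : R -> R) k (B : R) (A A' : nat -> R) :
  0 <= B -> racp pi z dz -> racp pi r dr -> z a = k * eigf al be 0 a ->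
  (forall t, 0 <= t <= pi -> `|z t - k * eigf al be 0 t| <= B * `|r t|) ->
  (forall N, `|A N| <= 1 /\ `|A' N| <= 1) ->
  (forall N t, 0 <= t <= pi ->
     r t * (\sum_(n < N.+1) (weight al be n * eigf al be n a) * eigf al be n t) =
     A N * eigf al be' N t + A' N * eigf al be' N.+1 t) ->
  forall e, 0 < e -> exists N0, forall N, (N0 <= N)%N ->
    `|\sum_(n < N.+1) (weight al be n * eigf al be n a) * fcoef al be z n - z a| < e.
Proof.
move=> B0 hz hr za zB AA ker e e0.
pose y t := z t - k * eigf al be 0 t.
have hy : racp pi y (fun t => dz t - k * deigf al be 0 t).
  have := racpD hz (racpN pi0 (racpZ k (racp_eigf al be 0 pi0))).
  by apply: eq_racp.
pose v t := y t * r t * (r t ^+ 2) `^ (-1).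
have yE t : 0 <= t <= pi -> y t = r t * v t.
  move=> ht; rewrite /v; have [r0|r0] := eqVneq (r t) 0.
    by rewrite r0 mul0r; apply/eqP; rewrite -normr_le0; have := zB t ht; rewrite r0 normr0 mulr0.
  by rewrite quotE // mulrC divfK.
have vB t : 0 <= t <= pi -> `|v t| <= B.
  move=> ht; rewrite /v; have [r0|r0] := eqVneq (r t) 0.
    by rewrite r0 mulr0 mul0r normr0.
  by rewrite quotE // normrM normfV ler_pdivrMr ?normr_gt0 //; exact: zB.
have lv : l2fun v by apply: bounded_l2fun vB; exact: measurable_quot hy hr.
have e2 : 0 < e / 2 by lra.
have [N1 hN1] := fcoef_small al be' lv e2.
exists N1 => N hN.
have hy' : itg I y by apply: itg_cont; exact: racp_cont pi0 hy.
have E1 n : fcoef al be z n = k * fcoef al be (eigf al be 0) n + fcoef al be y n.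
  have i1 := itgM_eigf al be n (itg_eigf R al be 0); have i2 := itgM_eigf al be n hy'.
  rewrite /fcoef -(RintegralZl _ _ i1) // -RintegralD //; last first.
    by have := integrableZl _ k i1; apply.
  by apply: eq_Rintegral => x _; rewrite /y; ring.
under eq_bigr do rewrite E1 mulrDr.
(* By orthogonality only mode 0 contributes, and it gives [z a] by the choice of [k]; the error is
   the partial sum for [y], which vanishes at [a]. *)
have Ez : \sum_(n < N.+1) weight al be n * eigf al be n a *
    (k * fcoef al be (eigf al be 0) n) = z a.
  rewrite big_ord_recl big1 ?addr0 /=; last first.
    by move=> i _; rewrite /fcoef eigf_orth // !mulr0.
  rewrite /fcoef eigf_norm za; field.
  by rewrite lt0r_neq0 // weight_gt0.
rewrite big_split /= Ez.
rewrite addrAC subrr add0r (fcoef_comb al be N.+1 (fun n => weight al be n * eigf al be n a) hy').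
rewrite (@eq_Rintegral _ _ _ mu _ (fun t => A N * (v t * eigf al be' N t) +
  A' N * (v t * eigf al be' N.+1 t))); last first.
  move=> t; rewrite inE /= in_itv /= => ht; rewrite yE // mulrAC ker //; ring.
have [hv _] := lv.
have i1 := itgM_eigf al be' N hv; have i2 := itgM_eigf al be' N.+1 hv.
rewrite RintegralD //; last 2 first.
- by have := integrableZl _ (A N) i1; apply.
- by have := integrableZl _ (A' N) i2; apply.
rewrite (RintegralZl _ _ i1) // (RintegralZl _ _ i2) //.
have [a1 a2] := AA N; have h1 := hN1 N hN; have h2 := hN1 N.+1 (leqW hN).
apply: le_lt_trans (ler_normD _ _) _; rewrite !normrM -/(fcoef _ _ _ _) -/(fcoef _ _ _ _).
have := normr_ge0 (fcoef al be' v N); have := normr_ge0 (fcoef al be' v N.+1); nra.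
Qed.

End PointwiseFourier.

Section FourierAtPoint.
Variable R : realType.
Local Notation weight := (weight R).
Local Notation freq := (freq R).
Implicit Types (al be : bool) (u v z f g : R -> R) (n m N : nat) (x t a k : R).

Let pi0 : 0 <= pi :> R := pi_ge0 R.

Lemma freqS al be n : freq al be n.+1 = freq al be n + 1.
Proof. by rewrite /freq -natr1; ring. Qed.

Lemma eigf_rec al be n x :
  eigf al be n.+2 x = 2 * cos x * eigf al be n.+1 x - eigf al be n x.
Proof.
rewrite /eigf !freqS; move: (freq al be n) => f.
have -> : (f + 1 + 1) * x = (f + 1) * x + x by ring.
have -> : f * x = (f + 1) * x - x by ring.
by case: al; rewrite ?cosD ?sinD ?cosN ?sinN; ring.
Qed.

(** The recurrence of [eigf_rec] started at index -1: by parity the mode of index -1 is 0, plus or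
    minus mode 0, or, in the Neumann problem, mode 1. *)
Lemma eigf1 al be x : eigf al be 1 x =
  (if al && be then 1 else 2) * cos x * eigf al be 0 x +
  (if al == be then 0 else if al then - 1 else 1) * eigf al be 0 x.
Proof.
have x2 : x = x / 2 + x / 2 by field.
have C2 : cos x = cos (x / 2) * cos (x / 2) - sin (x / 2) * sin (x / 2).
  by rewrite {1}x2 cosD.
have S2 : sin x = sin (x / 2) * cos (x / 2) + cos (x / 2) * sin (x / 2).
  by rewrite {1}x2 sinD.
have CS := cos2Dsin2 (x / 2).
rewrite /eigf freqS mulrDl mul1r /freq; case: al be => [] [] /=.
- rewrite -[(true + true)%N]/2%N.
  have -> : (0 + 1 - 2 / 2) * x = 0 by field.
  by rewrite add0r cos0; ring.
- rewrite -[(true + false)%N]/1%N.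
  have -> : (0 + 1 - 1 / 2) * x = x / 2 by field.
  rewrite cosD S2; move: C2 CS; set C := cos (x / 2); set S := sin (x / 2).
  move=> -> CS; have -> : S * (S * C + C * S) = 2 * C * (S ^+ 2) by ring.
  by have -> : S ^+ 2 = 1 - C ^+ 2 by [rewrite -CS; ring]; have -> : S * S = 1 - C ^+ 2 by [rewrite -CS; ring]; ring.
- rewrite -[(false + true)%N]/1%N.
  have -> : (0 + 1 - 1 / 2) * x = x / 2 by field.
  rewrite sinD S2; move: C2 CS; set C := cos (x / 2); set S := sin (x / 2).
  move=> -> CS; have -> : C * (S * C + C * S) = 2 * S * (C ^+ 2) by ring.
  by have -> : C ^+ 2 = 1 - S ^+ 2 by [rewrite -CS; ring]; have -> : C * C = 1 - S ^+ 2 by [rewrite -CS; ring]; ring.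
- rewrite -[(false + false)%N]/0%N.
  have -> : (0 + 1 - 0 / 2) * x = x by field.
  by rewrite sinD; ring.
Qed.

(** The Christoffel-Darboux formula for the three-term recurrence in [cos]. The halved weight of the
    constant Neumann mode matches the coefficient 1 in [eigf1]. *)
Lemma kernel_interior al be a N t :
  (cos t - cos a) * (\sum_(n < N.+1) (weight al be n * eigf al be n a) * eigf al be n t) =
  (- (eigf al be N.+1 a / pi)) * eigf al be N t + eigf al be N a / pi * eigf al be N.+1 t.
Proof.
have pin0 : pi != 0 :> R by rewrite lt0r_neq0 // pi_gt0.
elim: N => [|N IH].
  rewrite big_ord_recr big_ord0 /= add0r !eigf1 /weight eqxx !andbT.
  by move: pi pin0 => p p0; case: (al && be); field.
rewrite big_ord_recr /= mulrDr IH !eigf_rec /weight !andbF /=.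
by move: pi pin0 {IH} => p p0; field.
Qed.

Lemma eigf_pi al n : eigf al true n pi = (-1) ^+ n :> R.
Proof.
rewrite /eigf; case: al.
  have -> : freq true true n = n%:R by rewrite /freq -[(true + true)%N]/2%N; field.
  exact: cos_natpi.
by rewrite freq_half // sinDpihalf cos_natpi.
Qed.

Lemma eigf_half al n t :
  2 * eigf al true n.+1 t * cos (t / 2) = eigf al false n.+1 t + eigf al false n t.
Proof.
rewrite /eigf !freqS.
have h : freq al true n = freq al false n - 1 / 2.
  rewrite /freq; case: al.
    by rewrite -[(true + true)%N]/2%N -[(true + false)%N]/1%N; field.
  by rewrite -[(false + true)%N]/1%N -[(false + false)%N]/0%N; field.
set f := freq al false n.
have -> : (freq al true n + 1) * t = (f + 1 / 2) * t by rewrite h -/f; field.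
have -> : (f + 1) * t = (f + 1 / 2) * t + t / 2 by field.
have -> : f * t = (f + 1 / 2) * t - t / 2 by field.
clear h; clearbody f; by case: al; rewrite ?cosD ?sinD ?cosN ?sinN; ring.
Qed.

(** At [a = pi] the factor [cos t - cos a] has a double zero, too strong for a Lipschitz numerator.
    [cos (t / 2)] has a simple zero there and telescopes the kernel into modes of the problem with
    the Dirichlet condition at [pi]. *)
Lemma kernel_end al N t :
  cos (t / 2) * (\sum_(n < N.+1) (weight al true n * eigf al true n pi) * eigf al true n t) =
  ((-1) ^+ N / pi) * eigf al false N t + 0 * eigf al false N.+1 t.
Proof.
have pin0 : pi != 0 :> R by rewrite lt0r_neq0 // pi_gt0.
elim: N => [|N IH].
  rewrite big_ord_recr big_ord0 /= add0r !eigf_pi /weight expr0 mulr1 mul0r addr0.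
  rewrite /eigf /freq; case: al.
    rewrite -[(true + true)%N]/2%N -[(true + false)%N]/1%N /=.
    have -> : (0 + 1 - 2 / 2) * t = 0 by field.
    have -> : (0 + 1 - 1 / 2) * t = t / 2 by field.
    by rewrite cos0; move: pi pin0 => p p0; field.
  rewrite -[(false + true)%N]/1%N -[(false + false)%N]/0%N /=.
  have -> : (0 + 1 - 1 / 2) * t = t / 2 by field.
  have -> : (0 + 1 - 0 / 2) * t = t / 2 + t / 2 by field.
  by rewrite sinD; move: pi pin0 => p p0; field.
rewrite big_ord_recr /= mulrDr IH eigf_pi /weight !andbF /=.
have h := eigf_half al N t.
have -> : eigf al false N.+1 t = 2 * eigf al true N.+1 t * cos (t / 2) - eigf al false N t.
  by rewrite h addrK.
by rewrite exprS; move: pi pin0 {IH} => p p0; field.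
Qed.

Lemma eigf_le1 al be n x : `|eigf al be n x| <= 1.
Proof. by rewrite /eigf; case: al; [exact: cos_max | exact: sin_max]. Qed.

Lemma deigf_le al be n x : `|deigf al be n x| <= freq al be n.
Proof.
have f0 := freq_ge0 R al be n.
rewrite /deigf; case: al f0 => f0; rewrite ?normrN normrM ger0_norm // -[leRHS]mulr1.
  by apply: ler_wpM2l => //; exact: sin_max.
by apply: ler_wpM2l => //; exact: cos_max.
Qed.

Lemma invpi_le1 : `|pi^-1| <= 1 :> R.
Proof.
have p0 := pi_gt0 R; rewrite ger0_norm ?invr_ge0 //.
by rewrite invf_le1 //; have := pi_ge2 R; lra.
Qed.

(** The lowest mode has no interior zero, so a multiple of it can be subtracted from [z] to make the
    difference vanish at [a]. *)
Lemma eigf0_neq0 al be a : 0 < a <= pi -> (a < pi) || be -> eigf al be 0 a != 0.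
Proof.
move=> /andP[a0 ap] h.
have [ae|ane] := eqVneq a pi.
  by move: h; rewrite ae ltxx /= => ->; rewrite eigf_pi expr0 oner_neq0.
have {}ap : a < pi by rewrite lt_neqAle ane.
have ch : cos (a / 2) != 0.
  by rewrite lt0r_neq0 // cos_gt0_pihalf //; apply/andP; split; lra.
have sh : sin (a / 2) != 0.
  by rewrite lt0r_neq0 // sin_gt0_pi //; apply/andP; split; lra.
rewrite /eigf /freq; case: al be {h} => [] [].
- rewrite -[(true + true)%N]/2%N.
  have -> : (0%:R + 1 - 2 / 2) * a = 0 by field.
  by rewrite cos0 oner_neq0.
- rewrite -[(true + false)%N]/1%N.
  by have -> : (0%:R + 1 - 1 / 2) * a = a / 2 by field.
- rewrite -[(false + true)%N]/1%N.
  by have -> : (0%:R + 1 - 1 / 2) * a = a / 2 by field.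
- rewrite -[(false + false)%N]/0%N.
  have -> : (0%:R + 1 - 0%:R / 2) * a = a by field.
  by rewrite lt0r_neq0 // sin_gt0_pi // a0.
Qed.

(** In [cos t - cos a = - 2 sin((t + a) / 2) sin((t - a) / 2)] the first sine stays away from 0
    because [a] is interior; the zero at [a] is therefore simple. *)
Lemma dist_le_cos a t : 0 < a < pi -> 0 <= t <= pi ->
  `|t - a| <= 2 / Num.min (a / 4) ((pi - a) / 4) * `|cos t - cos a|.
Proof.
move=> /andP[a0 ap] /andP[t0 tp].
set m := Num.min _ _.
have m0 : 0 < m by rewrite lt_min !divr_gt0 ?subr_gt0.
have ma : m <= a / 4 by rewrite ge_min lexx.
have mpa : m <= (pi - a) / 4 by rewrite ge_min lexx orbT.
have hs : m <= sin ((t + a) / 2).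
  have [h|h] := leP ((t + a) / 2) (pi / 2).
    have h1 : 0 <= (t + a) / 2 <= pi / 2 by apply/andP; split; lra.
    have := sin_ge_half h1; lra.
  have -> : sin ((t + a) / 2) = sin (pi - (t + a) / 2).
    by rewrite sinB sinpi cospi; ring.
  have h1 : 0 <= pi - (t + a) / 2 <= pi / 2 by apply/andP; split; lra.
  have := sin_ge_half h1; lra.
have hd : `|t - a| / 4 <= `|sin ((t - a) / 2)|.
  have [ta|ta] := leP a t.
    have h1 : 0 <= (t - a) / 2 <= pi / 2 by apply/andP; split; lra.
    have h2 := sin_ge_half h1.
    rewrite ger0_norm ?subr_ge0 // ger0_norm; lra.
  have h1 : 0 <= (a - t) / 2 <= pi / 2 by apply/andP; split; lra.
  have h2 := sin_ge_half h1.
  have -> : (t - a) / 2 = - ((a - t) / 2) by field.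
  rewrite sinN normrN ltr0_norm ?subr_lt0 // ger0_norm; lra.
have -> : cos t - cos a = - 2 * sin ((t + a) / 2) * sin ((t - a) / 2).
  have {1}-> : t = (t + a) / 2 + (t - a) / 2 by field.
  have {3}-> : a = (t + a) / 2 - (t - a) / 2 by field.
  by rewrite cosD cosB; ring.
rewrite !normrM normrN [`|2|]ger0_norm // [`|sin ((t + a) / 2)|]ger0_norm; last by lra.
rewrite mulrAC ler_pdivlMr //.
set X := `|t - a| in hd *; set Y := `|sin _| in hd *; set Z := sin _ in hs *.
have X0 : 0 <= X by exact: normr_ge0.
have Y0 : 0 <= Y by exact: normr_ge0.
nra.
Qed.

(** Three situations: [a] interior; [a = pi] with the derivative condition, which takes
    [kernel_end]; and [a = pi] with the Dirichlet condition, where [z] and every mode vanish. *)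
Lemma fourier_real al be a (z dz : R -> R) (M : R) : 0 < a <= pi -> racp pi z dz ->
  (forall x, 0 <= x <= pi -> `|dz x| <= M) -> (~~ be -> z pi = 0) ->
  forall e, 0 < e -> exists N0, forall N, (N0 <= N)%N ->
    `|\sum_(n < N) (weight al be n * eigf al be n a) * fcoef al be z n - z a| < e.
Proof.
move=> ha hz hM zpi e e0; have [a0 ap] := andP ha.
suff [N0 hN0] : exists N0, forall N, (N0 <= N)%N ->
    `|\sum_(n < N.+1) (weight al be n * eigf al be n a) * fcoef al be z n - z a| < e.
  by exists N0.+1 => -[//|N] hN; exact: hN0.
have [hab|] := boolP ((a < pi) || be); last first.
  rewrite negb_or -leNgt => /andP[pa nbe].
  have -> : a = pi by apply/eqP; rewrite eq_le ap.
  have ez n : eigf al be n pi = 0 :> R.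
    by have := eigf_bcpi R al be n; rewrite (negbTE nbe).
  exists 0%N => N _; rewrite zpi // big1 ?subr0 ?normr0 // => i _.
  by rewrite ez mulr0 mul0r.
have e0n := eigf0_neq0 al ha hab.
pose k := z a / eigf al be 0 a.
have za : z a = k * eigf al be 0 a by rewrite /k divfK.
have M0 : 0 <= M by apply: le_trans (hM 0 _); rewrite ?lexx.
pose M' := M + `|k| * freq al be 0.
have M'0 : 0 <= M' by rewrite addr_ge0 // mulr_ge0 // freq_ge0.
have ha' : 0 <= a <= pi by rewrite ltW.
have lip t : 0 <= t <= pi -> `|z t - k * eigf al be 0 t| <= M' * `|t - a|.
  move=> ht.
  have hD := racpD hz (racpN pi0 (racpZ k (racp_eigf al be 0 pi0))).
  have := racp_lip (M := M') hD ha' ht; rewrite /= za subrr subr0; apply.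
  move=> x hx; apply: le_trans (ler_normD _ _) _; apply: lerD; first exact: hM.
  by rewrite normrN normrM ler_wpM2l // deigf_le.
have [alt|] := ltP a pi.
  have ha2 : 0 < a < pi by rewrite a0.
  have hr : racp pi (fun t => cos t - cos a) (fun t => - sin t).
    have := racpD (racp_cos 1 pi0) (racp_cst pi (- cos a)).
    by apply: eq_racp => // x _; rewrite ?mul1r ?addr0.
  have m0 : 0 < Num.min (a / 4) ((pi - a) / 4) by rewrite lt_min !divr_gt0 ?subr_gt0.
  apply: (@fourier_telescope _ al be be a z dz _ _ k (M' * (2 / Num.min (a / 4) ((pi - a) / 4)))
    (fun N => - (eigf al be N.+1 a / pi)) (fun N => eigf al be N a / pi) _ hz hr za) => //.
  - by rewrite mulr_ge0 // divr_ge0 // ltW.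
  - move=> t ht; apply: le_trans (lip t ht) _; rewrite -mulrA ler_wpM2l //.
    exact: dist_le_cos.
  - move=> N; rewrite normrN !normrM; split; rewrite -[leRHS]mulr1;
      by apply: ler_pM => //; [exact: eigf_le1 | exact: invpi_le1].
  by move=> N t _; exact: kernel_interior.
move=> pa; have ae : a = pi by apply/eqP; rewrite eq_le ap.
have be1 : be by move: hab; rewrite ae ltxx.
have hr : racp pi (fun t => cos (t / 2)) (fun t => - (1 / 2 * sin (1 / 2 * t))).
  by have := racp_cos (1 / 2) pi0; apply: eq_racp => // x _; congr cos; field.
rewrite be1 ae in za lip *.
apply: (@fourier_telescope _ al true false pi z dz _ _ k (M' * 4)
   (fun N => (-1) ^+ N / pi) (fun=> 0) _ hz hr za) => //.
- by rewrite mulr_ge0.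
- move=> t ht; apply: le_trans (lip t ht) _; rewrite -mulrA ler_wpM2l //.
  have [t0 tp] := andP ht.
  have h1 : 0 <= (pi - t) / 2 <= pi / 2 by apply/andP; split; lra.
  have h2 := sin_ge_half h1.
  have -> : cos (t / 2) = sin ((pi - t) / 2).
    have -> : (pi - t) / 2 = - (t / 2 - pi / 2) by field.
    by rewrite sinN sinBpihalf opprK.
  by rewrite distrC ger0_norm ?subr_ge0 // ger0_norm; lra.
- move=> N; rewrite normr0 normrM normrX normrN1 expr1n mul1r; split => //.
  exact: invpi_le1.
by move=> N t _; exact: kernel_end.
Qed.

End FourierAtPoint.

(** * Product formulas *)

Section Wallis.
Variable R : realType.
Local Notation mu := (@lebesgue_measure R).
Local Notation itg A f := (mu.-integrable A (EFin \o f)).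

Lemma ccvg_of_ratio (P r : nat -> R[i]) (k : R[i]) :
  (forall N, k = P N * r N) -> ccvg r 1 -> ccvg P k.
Proof.
move=> h hr e e0.
have k0 := nc_ge0 k.
have e1 : 0 < e / (2 * nc k + 1) by rewrite divr_gt0 //; lra.
have e2 : 0 < 1 / 2 :> R by lra.
have [N1 h1] := hr _ e1; have [N2 h2] := hr _ e2.
exists (maxn N1 N2) => n; rewrite geq_max => /andP[/h1 hn1 /h2 hn2].
have rn : 1 / 2 <= nc (r n).
  by have := nc_subr_ge 1 (1 - r n); rewrite nc1 subKr (ncBC 1); lra.
have Pn : nc (P n) <= 2 * nc k by rewrite (h n) ncM; have := nc_ge0 (P n); nra.
have -> : P n - k = P n * (1 - r n) by rewrite {1}(h n); ring.
rewrite ncM (ncBC 1); apply: le_lt_trans (_ : 2 * nc k * nc (r n - 1) < _).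
  by apply: ler_wpM2r => //; exact: nc_ge0.
by move: hn1; rewrite ltr_pdivlMr; [have := nc_ge0 (r n - 1); nra | lra].
Qed.

Variable l : R.
Hypothesis l0 : 0 < l.
(** With this frequency [C] falls from 1 at 0 to 0 at [l]: boundary terms at [l] vanish, and high
    powers of [C] concentrate at 0, where [c] equals 1. *)
Let om := pi / (2 * l).
Let C x := cos (om * x).
Let S x := sin (om * x).

Let l0' : 0 <= l := ltW l0.
Let om0 : 0 < om. Proof. by rewrite /om divr_gt0 ?pi_gt0 // mulr_gt0. Qed.
Let oml : om * l = pi / 2.
Proof. by rewrite /om; move: (pi : R) => p; field; rewrite lt0r_neq0. Qed.
Let Cl : C l = 0. Proof. by rewrite /C oml cos_pihalf. Qed.
Let Sl : S l = 1. Proof. by rewrite /S oml sin_pihalf. Qed.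
Let S0 : S 0 = 0. Proof. by rewrite /S mulr0 sin0. Qed.
Let hC : racp l C (fun x => - (om * S x)) := racp_cos om l0'.
Let hS : racp l S (fun x => om * C x) := racp_sin om l0'.
Let CS x : S x ^+ 2 = 1 - C x ^+ 2.
Proof. by rewrite -(cos2Dsin2 (om * x)) /C /S; ring. Qed.

Lemma racpX p (u f : R -> R) n : 0 <= p -> racp p u f ->
  racp p (fun x => u x ^+ n.+1) (fun x => n.+1%:R * u x ^+ n * f x).
Proof.
move=> p0 hu; elim: n => [|n IH].
  by apply: eq_racp hu => // x _; rewrite ?expr1 // expr0; ring.
have := racpM p0 IH hu; apply: eq_racp => // x _; first by rewrite [RHS]exprS mulrC.
by rewrite -[n.+2%:R]natr1 !exprS; ring.
Qed.

(* Wallis integrals of [c]: [wint c n / wint 1 n] satisfies a two-step recurrence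
   with factor [1 - lam / (n om)^2] and tends to 1. *)
Definition wint (c : R -> R[i]) n := cint `[0, l] (fun x => c x * (C x ^+ n)%:C%C).

Lemma racp_Cn n : exists f, racp l (fun x => C x ^+ n) f.
Proof.
case: n => [|n]; last by eexists; exact: racpX l0' hC.
by exists (fun=> 0); exact: racp_cst.
Qed.

Lemma citg_wint (c dc : R -> R[i]) n : cacp l c dc ->
  citg `[0, l] (fun x => c x * (C x ^+ n)%:C%C).
Proof.
move=> hc; have [f hf] := racp_Cn n.
have [h1 h2] := cacp_cont l0' hc.
by apply: citgM (cacp_real hf) => //; split; apply: itg_cont.
Qed.

(** The pair for [lam = 0]; the results on [wint] applied to it become those on [wnorm]. *)
Lemma trig_cst : trig_pair l 0 (fun=> 1) (fun x => x%:C%C).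
Proof.
split; first exact: cacp_real (racp_id l0').
split; last by [].
by apply: eq_cacp (cacp_cst l 1) => // x _; rewrite oppr0 mul0r.
Qed.

Section Pair.
Variables (lam : R[i]) (c s : R -> R[i]).
Hypothesis tcs : trig_pair l lam c s.

(** Lagrange's identity for [c] and the power [n + 2] of [C]; the boundary terms vanish because
    [C l], [S 0] and [s 0] are 0. *)
Lemma wint_rec n :
  ((n.+2%:R * om) ^+ 2)%:C%C * wint c n.+2 - lam * wint c n.+2 =
  (n.+2%:R * n.+1%:R * om ^+ 2)%:C%C * wint c n.
Proof.
have [hs [hc [c0 s0]]] := tcs.
have hdc : cacp l (fun x => - lam * s x) (fun x => - lam * c x) by exact: cacpZ.
have h1 := racpX n.+1 l0' hC.
have h2 : racp l (fun x => n.+2%:R * C x ^+ n.+1 * - (om * S x))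
   (fun x => (n.+2%:R * n.+1%:R * om ^+ 2) * C x ^+ n - (n.+2%:R * om) ^+ 2 * C x ^+ n.+2).
  have := racpZ (- (n.+2%:R * om)) (racpM l0' (racpX n l0' hC) hS).
  apply: eq_racp => // x _; first by ring.
  have -> : C x ^+ n.+2 = C x ^+ n * C x ^+ 2 by rewrite -exprD addn2.
  have -> : n.+1%:R * C x ^+ n * - (om * S x) * S x = - (n.+1%:R * C x ^+ n * om * S x ^+ 2) by ring.
  by rewrite CS [C x ^+ n.+1]exprS -[n.+2%:R]natr1; ring.
have hL := lagrange_identity l0' hc hdc (cacp_real h1) (cacp_real h2).
have := cacp_val hL (x := l); rewrite lexx l0' => /(_ isT).
rewrite /= Cl S0 s0 exprS !(mul0r, mulr0, oppr0, subr0) => E.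
have iw m := citg_wint m hc.
have : cint `[0, l] (fun x => (n.+2%:R * n.+1%:R * om ^+ 2)%:C%C * (c x * (C x ^+ n)%:C%C) -
   (((n.+2%:R * om) ^+ 2)%:C%C - lam) * (c x * (C x ^+ n.+2)%:C%C)) = 0.
  transitivity (0 - - lam * s l * (0 ^+ n.+2)%:C%C); last by rewrite expr0n /= mulr0 subr0.
  rewrite E; apply: eq_cint => x _.
  have split (A B X Y : R) : (A * X - B * Y)%:C%C = A%:C%C * X%:C%C - B%:C%C * Y%:C%C :> R[i].
    by rewrite rmorphB !rmorphM.
  by rewrite split; ring.
rewrite cintB //; try exact: citgZ.
rewrite !cintZ // -/(wint c n) -/(wint c n.+2) => /eqP; rewrite subr_eq0 => /eqP ->.
by ring.
Qed.

Lemma wint0 : wint c 0 = s l.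
Proof.
have [hs [hc [c0 s0]]] := tcs.
have := cacp_val hs (x := l); rewrite lexx l0' s0 subr0 => /(_ isT) ->.
by apply: eq_cint => x _; rewrite expr0 mulr1.
Qed.

Lemma wint1 : (om ^+ 2)%:C%C * wint c 1 - lam * wint c 1 = om%:C%C * c l.
Proof.
have [hs [hc [c0 s0]]] := tcs.
have hdc : cacp l (fun x => - lam * s x) (fun x => - lam * c x) by exact: cacpZ.
have h2 : racp l (fun x => - (om * S x)) (fun x => - (om ^+ 2 * C x)).
  have := racpZ (- om) hS; apply: eq_racp => // x _; ring.
have hL := lagrange_identity l0' hc hdc (cacp_real hC) (cacp_real h2).
have := cacp_val hL (x := l); rewrite lexx l0' => /(_ isT).
rewrite /= Cl S0 Sl s0 !mulr1 !(mulr0, oppr0, mul0r, subr0) => E.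
have iw m := citg_wint m hc.
have : cint `[0, l] (fun x => (lam - (om ^+ 2)%:C%C) * (c x * (C x ^+ 1)%:C%C)) =
   c l * (- om)%:C%C.
  rewrite E; apply: eq_cint => x _.
  by rewrite expr1 rmorphN rmorphM /=; ring.
rewrite cintZ // -/(wint c 1) rmorphN /= mulrN => E2.
have -> : om%:C%C * c l = - - (c l * om%:C%C) by ring.
by rewrite -E2; ring.
Qed.

End Pair.

Definition wnorm n : R := (\int[mu]_(x in `[0, l]) C x ^+ n)%R.

Lemma wint_cst n : wint (fun=> 1) n = (wnorm n)%:C%C.
Proof.
rewrite /wint /cint /wnorm; congr Complex.
  by apply: eq_Rintegral => x _; rewrite mul1r.
rewrite (@eq_Rintegral _ _ _ mu _ (fun=> 0 : R)) ?Rintegral_cst ?mul0r // => x _.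
by rewrite mul1r.
Qed.

Lemma wnorm_rec n : n.+2%:R * wnorm n.+2 = n.+1%:R * wnorm n.
Proof.
have := wint_rec trig_cst n; rewrite !wint_cst mul0r subr0 -!rmorphM /= => -[] E.
have o0 : om != 0 by rewrite lt0r_neq0.
apply: (mulfI (mulf_neq0 (_ : n.+2%:R != 0) (expf_neq0 2 o0))); first by rewrite pnatr_eq0.
by rewrite -[LHS]mulrA; transitivity ((n.+2%:R * om) ^+ 2 * wnorm n.+2); [ring | rewrite E; ring].
Qed.

Lemma wnorm_gt0 n : 0 < wnorm n.
Proof.
have wn0 m : wnorm m != 0 -> wnorm m.+2 != 0.
  move=> h; have := wnorm_rec m; apply: contra_eq_neq => ->.
  by rewrite mulr0 eq_sym mulf_neq0 // pnatr_eq0.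
rewrite lt_neqAle eq_sym; apply/andP; split; last first.
  apply: Rintegral_ge0 => x /=; rewrite in_itv /= => /andP[x0 xl].
  apply: exprn_ge0; apply: cos_ge0_pihalf; apply/andP; split.
    by apply: le_trans (_ : 0 <= _); rewrite ?oppr_le0 ?divr_ge0 ?pi_ge0 // mulr_ge0 // ltW.
  by rewrite -oml ler_wpM2l // ltW.
suff : wnorm n != 0 /\ wnorm n.+1 != 0 by case.
elim: n => [|n [h1 h2]]; last by split => //; exact: wn0.
split.
  have := wint0 trig_cst; rewrite wint_cst => -[->].
  by rewrite lt0r_neq0.
have := wint1 trig_cst; rewrite wint_cst mul0r subr0 mulr1 -rmorphM /= => -[] E.
by apply: contraTneq om0 => h; rewrite -E h mulr0 ltxx.
Qed.

Section Limit.
Variables (lam : R[i]) (c s : R -> R[i]).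
Hypothesis tcs : trig_pair l lam c s.

Definition wratio n : R[i] := wint c n / (wnorm n)%:C%C.

Lemma wratio_rec n :
  wratio n = (1 - lam / ((n.+2%:R * om) ^+ 2)%:C%C) * wratio n.+2.
Proof.
have n2 : ((n.+2%:R * om) ^+ 2)%:C%C != 0 :> R[i].
  by rewrite -nc_eq0 nc_real normr_eq0 expf_neq0 // mulf_neq0 ?pnatr_eq0 ?lt0r_neq0.
have w0 m : (wnorm m)%:C%C != 0 :> R[i].
  by rewrite -nc_eq0 nc_real normr_eq0 lt0r_neq0 // wnorm_gt0.
have h1 := wint_rec tcs n; have h2 := wnorm_rec n.
rewrite /wratio.
have -> : (1 - lam / ((n.+2%:R * om) ^+ 2)%:C%C) * (wint c n.+2 / (wnorm n.+2)%:C%C) =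
   (((n.+2%:R * om) ^+ 2)%:C%C * wint c n.+2 - lam * wint c n.+2) /
   (((n.+2%:R * om) ^+ 2)%:C%C * (wnorm n.+2)%:C%C).
  have gen (A B w : R[i]) : A != 0 -> B != 0 ->
      (1 - lam / A) * (w / B) = (A * w - lam * w) / (A * B).
    by move=> A0 B0; field; rewrite A0 B0.
  exact: gen.
have -> : ((n.+2%:R * om) ^+ 2)%:C%C * (wnorm n.+2)%:C%C =
    (n.+2%:R * n.+1%:R * om ^+ 2)%:C%C * (wnorm n)%:C%C :> R[i].
  rewrite -[LHS](rmorphM (real_complex R)) -[RHS](rmorphM (real_complex R)) /=.
  congr (_%:C%C).
  by transitivity (n.+2%:R * om ^+ 2 * (n.+2%:R * wnorm n.+2)); [ring | rewrite h2; ring].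
rewrite h1.
have k0 : (n.+2%:R * n.+1%:R * om ^+ 2)%:C%C != 0 :> R[i].
  have o2 : om ^+ 2 != 0 by rewrite expf_neq0 // lt0r_neq0.
  by rewrite -nc_eq0 nc_real normr_eq0 mulf_neq0 // mulf_neq0 ?pnatr_eq0.
have gen (A B w : R[i]) : A != 0 -> B != 0 -> w / B = A * w / (A * B).
  by move=> A0 B0; field; rewrite A0 B0.
exact: gen.
Qed.

Lemma wratio0 : wratio 0 = s l / l%:C%C.
Proof.
rewrite /wratio (wint0 tcs); have := wint0 trig_cst.
by rewrite wint_cst => ->.
Qed.

Lemma wratio1 : c l = (1 - lam / (om ^+ 2)%:C%C) * wratio 1.
Proof.
have o0 : om%:C%C != 0 :> R[i] by rewrite -nc_eq0 nc_real normr_eq0 lt0r_neq0.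
have h1 := wint1 tcs; have := wint1 trig_cst.
rewrite wint_cst mul0r subr0 mulr1 -rmorphM /= => -[] E.
have w1 : (wnorm 1)%:C%C = om%:C%C^-1 :> R[i].
  rewrite -fmorphV /=; congr (_%:C%C).
  have o1 : om != 0 by rewrite lt0r_neq0.
  by apply: (mulfI (expf_neq0 2 o1)); rewrite E; field.
rewrite /wratio w1 invrK; apply: (mulfI o0).
rewrite -h1 rmorphXn /=; field; exact: o0.
Qed.

(** Both [c - 1] and [S ^ 2 = 1 - C ^ 2] vanish to second order at 0. Against the [n]th power of [C]
    the latter integrates to [wnorm n - wnorm n.+2], which is [wnorm n / (n + 2)]. *)
Lemma c_sub1 : exists2 M, 0 <= M & forall x, 0 <= x <= l -> nc (c x - 1) <= M * S x ^+ 2.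
Proof.
have [hs [hc [c0 s0]]] := tcs.
have [Mc Mc0 hMc] := cacp_bounded l0' hc.
have ll := nc_ge0 lam.
exists (4 * nc lam * Mc * (2 / om) ^+ 2).
  by rewrite mulr_ge0 ?sqr_ge0 // mulr_ge0 // mulr_ge0.
move=> x /andP[x0 xl].
have hx : (0 : R) <= 0 <= x by apply/andP.
have hx' : 0 <= x <= x by apply/andP.
have sB t : 0 <= t <= x -> nc (s t) <= 2 * x * Mc.
  move=> /andP[t0 tx]; have ht : (0 : R) <= 0 <= t by apply/andP.
  have ht' : 0 <= t <= t by apply/andP.
  have := cacp_dist_le Mc0 (cacp_sub (le_trans tx xl) hs) ht ht'.
  rewrite s0 subr0 => h; apply: le_trans (h _) _.
    move=> y /andP[y0 yt]; apply: hMc; rewrite y0 (le_trans yt) //.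
    exact: le_trans tx xl.
  by rewrite ler_wpM2r // ler_wpM2l.
have B0 : 0 <= nc lam * (2 * x * Mc) by rewrite !mulr_ge0.
have := cacp_dist_le B0 (cacp_sub xl hc) hx hx'; rewrite c0 => h.
apply: le_trans (h _) _.
  by move=> t /sB ht; rewrite ncM ncN; apply: ler_wpM2l.
have ox : 0 <= om * x <= pi / 2.
  by rewrite mulr_ge0 ?(ltW om0) //= -oml ler_wpM2l // ltW.
have := sin_ge_half ox; rewrite -/(S x) => hSx.
have xS : x <= 2 / om * S x by rewrite mulrAC ler_pdivlMr //; lra.
have x2 : x ^+ 2 <= (2 / om) ^+ 2 * S x ^+ 2.
  rewrite -exprMn; apply: lerXn2r => //; rewrite nnegrE //.
  exact: le_trans x0 xS.
have -> : 2 * x * (nc lam * (2 * x * Mc)) = 4 * nc lam * Mc * x ^+ 2 by ring.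
rewrite -[leRHS]mulrA; apply: ler_wpM2l => //.
by rewrite !mulr_ge0.
Qed.

Lemma wratio_le : exists2 M, 0 <= M & forall n, nc (wratio n - 1) <= M / n.+2%:R.
Proof.
have [M M0 hM] := c_sub1; exists (2 * M); first by rewrite mulr_ge0.
move=> n; have w0 := wnorm_gt0 n.
have w0c : (wnorm n)%:C%C != 0 :> R[i] by rewrite -nc_eq0 nc_real normr_eq0 lt0r_neq0.
have [hs [hc [c0 s0]]] := tcs.
have -> : wratio n - 1 = (wint c n - wint (fun=> 1) n) / (wnorm n)%:C%C.
  by rewrite wint_cst /wratio; field.
rewrite ncM ncV nc_real gtr0_norm // ler_pdivrMr //.
have i1 := citg_wint n hc; have i2 := citg_wint n (cacp_cst l 1).
rewrite /wint -cintB //.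
have itC m : itg `[0, l]%classic (fun x => C x ^+ m).
  by have [f hf] := racp_Cn m; apply: itg_cont; exact: racp_cont hf.
have iD : itg `[0, l]%classic (fun x => C x ^+ n - C x ^+ n.+2).
  by have := integrableB _ (itC n) (itC n.+2); apply.
have iMD : itg `[0, l]%classic (fun x => M * (C x ^+ n - C x ^+ n.+2)).
  by have := integrableZl _ M iD; apply.
have iB : citg `[0, l] (fun x => c x * (C x ^+ n)%:C%C - 1 * (C x ^+ n)%:C%C).
  have -> : (fun x => c x * (C x ^+ n)%:C%C - 1 * (C x ^+ n)%:C%C) =
    (fun x => c x * (C x ^+ n)%:C%C + (-1) * (1 * (C x ^+ n)%:C%C)).
    by apply/funext => x; rewrite mulN1r.
  by apply: citgD => //; exact: citgZ.
apply: le_trans (nc_cint_le iB iMD _) _.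
  move=> x xl; have [x0 xl'] := andP xl.
  have Cx : 0 <= C x.
    apply: cos_ge0_pihalf; apply/andP; split.
      by apply: le_trans (_ : 0 <= _); rewrite ?oppr_le0 ?divr_ge0 ?pi_ge0 // mulr_ge0 // ltW.
    by rewrite -oml ler_wpM2l // ltW.
  rewrite -mulrBl ncM nc_real ger0_norm ?exprn_ge0 //.
  apply: le_trans (ler_wpM2r (exprn_ge0 n Cx) (hM x xl)) _.
  have -> : C x ^+ n.+2 = C x ^+ n * C x ^+ 2 by rewrite -exprD addn2.
  by rewrite CS le_eqVlt; apply/orP; left; apply/eqP; ring.
rewrite (RintegralZl _ _ iD) // (RintegralB _ (itC n) (itC n.+2)) // -/(wnorm n) -/(wnorm n.+2).
have h := wnorm_rec n.
have n2 : n.+2%:R != 0 :> R by rewrite pnatr_eq0.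
have -> : wnorm n.+2 = n.+1%:R / n.+2%:R * wnorm n.
  by apply: (mulfI n2); rewrite h; field.
have -> : n.+1%:R = n.+2%:R - 1 :> R by rewrite -[n.+2%:R]natr1 addrK.
by rewrite le_eqVlt; apply/orP; left; apply/eqP; field.
Qed.

Lemma wratio_ccvg : ccvg wratio 1.
Proof.
have [M M0 hM] := wratio_le; apply: ccvg_le hM _ => e e0.
exists (Num.truncn (M / e)) => n hn.
have h := truncnS_gt (M / e).
have : (Num.truncn (M / e)).+1%:R <= n.+2%:R :> R by rewrite ler_nat; lia.
move=> h2; rewrite ltr_pdivrMr // mulrC -ltr_pdivrMr //; lra.
Qed.

(** Euler's product: the chain of even ratios starts at [s l / l] and tends to 1. The odd chain
    gives [cos_product]. *)
Lemma sin_product : ccvg (fun N => l%:C%C *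
  \prod_(j < N) (1 - lam / ((j.*2.+2%:R * om) ^+ 2)%:C%C)) (s l).
Proof.
have lc : l%:C%C != 0 :> R[i] by rewrite -nc_eq0 nc_real normr_eq0 lt0r_neq0.
apply: (@ccvg_of_ratio _ (fun N => wratio N.*2)); last first.
  by move=> e /wratio_ccvg [N hN]; exists N => n hn; apply: hN; rewrite -addnn; lia.
elim=> [|N IH].
  by rewrite big_ord0 mulr1 wratio0; field.
by rewrite big_ord_recr /= IH wratio_rec; ring.
Qed.

Lemma cos_product : ccvg (fun N =>
  \prod_(j < N) (1 - lam / ((j.*2.+1%:R * om) ^+ 2)%:C%C)) (c l).
Proof.
apply/(ccvg_shift _ _ 1).
apply: (@ccvg_of_ratio _ (fun N => wratio N.*2.+1)); last first.
  by move=> e /wratio_ccvg [N hN]; exists N => n hn; apply: hN; rewrite -addnn; lia.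
elim=> [|N IH].
  by rewrite add0n big_ord_recr big_ord0 /= !mul1r wratio1.
by rewrite IH addSn big_ord_recr /= wratio_rec addn1 doubleS; ring.
Qed.

Lemma nonreal_factor (x : R) : complex.Im lam != 0 -> 1 - lam / x%:C%C != 0.
Proof.
move=> hI; have [->|x0] := eqVneq x 0; first by rewrite invr0 mulr0 subr0 oner_neq0.
have xc : x%:C%C != 0 :> R[i] by rewrite -nc_eq0 nc_real normr_eq0.
apply: contra_neq hI => /eqP; rewrite subr_eq0 => /eqP h.
have -> : lam = x%:C%C by rewrite -[LHS](divfK xc) -h mul1r.
by [].
Qed.

(** Ratios far out are close to 1, and each step down the recurrence multiplies by a factor that can
    vanish only for real [lam]. *)
Lemma wratio_neq0 n : complex.Im lam != 0 -> wratio n != 0.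
Proof.
move=> hI.
have e0 : 0 < 1 / 2 :> R by lra.
have [N hN] := wratio_ccvg e0.
have H k : wratio (n + k.*2) != 0 -> wratio n != 0.
  elim: k => [|k IH]; first by rewrite addn0.
  rewrite doubleS !addnS => h; apply: IH.
  by rewrite wratio_rec mulf_neq0 // nonreal_factor.
apply: (H N); have := hN (n + N.*2)%N; rewrite -addnn => /(_ (leq_trans (leq_addl _ _) (leq_addl _ _))).
move=> h; rewrite -nc_gt0; have := nc_subr_ge 1 (1 - wratio (n + (N + N))).
by rewrite nc1 subKr (ncBC 1); lra.
Qed.

Lemma sin_neq0 : complex.Im lam != 0 -> s l != 0.
Proof.
move=> /(wratio_neq0 0); rewrite wratio0; apply: contra_neq => ->.
by rewrite mul0r.
Qed.

Lemma cos_neq0 : complex.Im lam != 0 -> c l != 0.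
Proof. by move=> hI; rewrite wratio1 mulf_neq0 ?nonreal_factor ?wratio_neq0. Qed.

End Limit.
End Wallis.

(** * The characteristic function *)

Section DeltaIdentity.
Variable R : realType.
Local Notation weight := (weight R).
Local Notation freq := (freq R).
Implicit Types (al be : bool).

Let pi0 : 0 <= pi :> R := pi_ge0 R.

Definition ccoef al be (z : R -> R[i]) n : R[i] :=
  cint `[0, pi] (fun x => z x * (eigf al be n x)%:C%C).

Lemma ccoefE al be z n : ccoef al be z n =
  Complex (fcoef al be (fun x => complex.Re (z x)) n) (fcoef al be (fun x => complex.Im (z x)) n).
Proof.
rewrite /ccoef /cint /fcoef; congr Complex; apply: eq_Rintegral => x _.
  by case: (z x) => u v /=; rewrite mulr0 subr0.
by case: (z x) => u v /=; rewrite mulr0 add0r.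
Qed.

Lemma fourier_complex al be a (z dz ddz : R -> R[i]) : 0 < a <= pi ->
  cacp pi z dz -> cacp pi dz ddz -> (~~ be -> z pi = 0) ->
  ccvg (fun N => \sum_(n < N) (weight al be n * eigf al be n a)%:C%C * ccoef al be z n) (z a).
Proof.
move=> ha [hz1 hz2] hdz zpi e e0.
have [M M0 hM] := cacp_bounded pi0 hdz.
have e2 : 0 < e / 2 by lra.
have [N1 h1] := fourier_real al ha hz1 (fun x xp => le_trans (nc_geRe _) (hM x xp))
  (fun b => congr1 (@complex.Re R) (zpi b)) e2.
have [N2 h2] := fourier_real al ha hz2 (fun x xp => le_trans (nc_geIm _) (hM x xp))
  (fun b => congr1 (@complex.Im R) (zpi b)) e2.
exists (maxn N1 N2) => N; rewrite geq_max => /andP[/h1 hN1 /h2 hN2].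
apply: le_lt_trans (nc_leD _) _.
have ER : complex.Re (\sum_(n < N) (weight al be n * eigf al be n a)%:C%C * ccoef al be z n) =
  \sum_(n < N) (weight al be n * eigf al be n a) * fcoef al be (fun x => complex.Re (z x)) n.
  rewrite raddf_sum; apply: eq_bigr => n _.
  by rewrite ccoefE /= mul0r subr0.
have EI : complex.Im (\sum_(n < N) (weight al be n * eigf al be n a)%:C%C * ccoef al be z n) =
  \sum_(n < N) (weight al be n * eigf al be n a) * fcoef al be (fun x => complex.Im (z x)) n.
  rewrite raddf_sum; apply: eq_bigr => n _.
  by rewrite ccoefE /= mul0r addr0.
rewrite !raddfB /= ER EI; lra.
Qed.

Lemma ccoef_bseries al be q : L2_0pi q ->
  bseries (fun n => nc (ccoef al be q n) ^+ 2).
Proof.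
move=> hq; have [h1 h2] := L2_Re hq; have [h3 h4] := L2_Im hq.
have l1 : l2fun (fun x => complex.Re (q x)).
  by split => //; apply: eq_integrable h1 => // x _ /=; rewrite expr2.
have l2 : l2fun (fun x => complex.Im (q x)).
  by split => //; apply: eq_integrable h3 => // x _ /=; rewrite expr2.
have := bseriesD (fcoef_bseries al be l1) (fcoef_bseries al be l2).
by apply: bseries_le => n; rewrite nc_sqr ccoefE.
Qed.

Lemma wronskian_bcC (a0 a1 b0 b1 : R[i]) (c : bool) :
  (if c then a1 else a0) = 0 -> (if c then b1 else b0) = 0 -> a0 * b1 - a1 * b0 = 0.
Proof. by case: c => -> ->; rewrite !(mul0r, mulr0) subrr. Qed.

Lemma bc_complex (c : bool) (a0 a1 : R) : (if c then a1 else a0) = 0 ->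
  (if c then a1%:C%C else a0%:C%C) = 0 :> R[i].
Proof. by case: c => ->. Qed.

(** Lagrange's identity against the mode: [z] and the mode satisfy the same conditions, so the
    Wronskian vanishes at both ends. *)
Lemma ccoef_bvp al be (lam k : R[i]) (q z dz : R -> R[i]) n : citg `[0, pi] q ->
  cacp pi z dz -> cacp pi dz (fun x => k * q x - lam * z x) ->
  (if al then dz 0 else z 0) = 0 -> (if be then dz pi else z pi) = 0 ->
  (lam - (freq al be n ^+ 2)%:C%C) * ccoef al be z n = k * ccoef al be q n.
Proof.
move=> hq hz hdz bc0 bcpi.
have he := racp_eigf al be n pi0; have hde := racp_deigf al be n pi0.
have hL := lagrange_identity pi0 hz hdz (cacp_real he) (cacp_real hde).
have := cacp_val hL (x := pi); rewrite lexx pi0 => /(_ isT) /=.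
rewrite (wronskian_bcC bc0 (bc_complex (eigf_bc0 R al be n))).
rewrite (wronskian_bcC bcpi (bc_complex (eigf_bcpi R al be n))) subrr => E.
have iz : citg `[0, pi] (fun x => z x * (eigf al be n x)%:C%C).
  by apply: citgM (cacp_real he) => //; split; apply: itg_cont; case: (cacp_cont pi0 hz).
have iq : citg `[0, pi] (fun x => q x * (eigf al be n x)%:C%C).
  exact: citgM (cacp_real he).
apply/eqP; rewrite -subr_eq0 /ccoef -!cintZ // -cintB; try exact: citgZ.
apply/eqP; rewrite [RHS]E; apply: eq_cint => x _.
by rewrite rmorphN rmorphM /=; ring.
Qed.

Section Fixed.
Variables (al be : bool) (a : R) (lam : R[i]) (q C dC S dS : R -> R[i]).
Hypothesis ha : 0 < a <= pi.
Hypothesis hq : L2_0pi q.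
Hypothesis hC : cacp pi C dC.
Hypothesis hdC : cacp pi dC (fun x => q x - lam * C x).
Hypothesis hS : cacp pi S dS.
Hypothesis hdS : cacp pi dS (fun x => - lam * S x).
Hypothesis Ca : C a = 1.
Hypothesis Sa : S a = 0.
Hypothesis dSa : dS a = 1.

Let c x := dS x * dS 0 + lam * S x * S 0.
Let s x := S x * dS 0 - S 0 * dS x.

Let ha' : 0 <= a <= pi. Proof. by case/andP: ha => /ltW -> ->. Qed.
Let tcs : trig_pair pi lam c s := trig_pair_of_solution pi0 ha' hS hdS Sa dSa.

Definition hsol x := if al then c x else s x.
Definition dhsol x := if al then - lam * s x else c x.
Definition hend := if be then dhsol pi else hsol pi.

Let Delta := char_fun al be (fun=> C) (fun=> dC) (fun=> S) (fun=> dS) lam.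
Let eps : R[i] := if al then -1 else 1.

(* [lam] is nonreal to ensure [hsol a <> 0]; the remaining [lam] follow by
   continuity. *)
Lemma char_fun_secular b : complex.Im lam != 0 ->
  csum (fun n => (weight al be n * eigf al be n a)%:C%C * ccoef al be q n /
          ((freq al be n ^+ 2)%:C%C - lam)) b ->
  Delta = eps * hend * (1 + b).
Proof.
move=> hI hb; have [hs [hc [c0 s0]]] := tcs.
have hh : cacp pi hsol dhsol by rewrite /hsol /dhsol; case: (al).
have hdh : cacp pi dhsol (fun x => - lam * hsol x).
  by rewrite /hsol /dhsol; case: (al) => //; exact: cacpZ.
have hbc0 : (if al then dhsol 0 else hsol 0) = 0.
  by rewrite /hsol /dhsol; case: (al); rewrite s0 ?mulr0.
pose Ca0 := if al then dC 0 else C 0; pose Sa0 := if al then dS 0 else S 0.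
pose y x := Ca0 * S x - Sa0 * C x; pose dy x := Ca0 * dS x - Sa0 * dC x.
have hy : cacp pi y dy by apply: cacpB => //; exact: cacpZ.
have hdy : cacp pi dy (fun x => - Sa0 * q x - lam * y x).
  have := cacpB pi0 (cacpZ Ca0 pi0 hdS) (cacpZ Sa0 pi0 hdC).
  by apply: eq_cacp => // x _; rewrite /y; ring.
have ya : y a = - Sa0 by rewrite /y Sa Ca; ring.
have ybc0 : (if al then dy 0 else y 0) = 0.
  by rewrite /y /dy /Ca0 /Sa0; case: (al); ring.
have ybcpi : (if be then dy pi else y pi) = Delta.
  by rewrite /Delta /char_fun /y /dy /Ca0 /Sa0; case: (be).
pose z x := hend * y x - Delta * hsol x; pose dz x := hend * dy x - Delta * dhsol x.
have hz : cacp pi z dz by apply: cacpB => //; exact: cacpZ.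
have hdz : cacp pi dz (fun x => hend * - Sa0 * q x - lam * z x).
  have := cacpB pi0 (cacpZ hend pi0 hdy) (cacpZ Delta pi0 hdh).
  by apply: eq_cacp => // x _; rewrite /z; ring.
have zbc0 : (if al then dz 0 else z 0) = 0.
  move: ybc0 hbc0; rewrite /z /dz; case: (al) => -> ->; ring.
have zbcpi : (if be then dz pi else z pi) = 0.
  by move: ybcpi; rewrite /z /dz /hend; case: (be) => ->; ring.
have zpi : ~~ be -> z pi = 0 by move: zbcpi; case: (be).
(* Both [z a] and the source term of [z] carry the factor [Sa0]; being [hsol a] up to sign, it is
   nonzero and can be cancelled. *)
have hSa0 : hsol a = - eps * Sa0.
  by rewrite /hsol /c /s /Sa0 /eps; case: (al); rewrite Sa dSa; ring.
have eps2 : eps * eps = 1 by rewrite /eps; case: (al); ring.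
have [hsa hca] : s a != 0 /\ c a != 0.
  have [a0 ap] := andP ha.
  have tcsa : trig_pair a lam c s.
    by split; [exact: cacp_sub ap hs | split; first exact: cacp_sub ap hc].
  by split; [exact: (sin_neq0 a0 tcsa hI) | exact: (cos_neq0 a0 tcsa hI)].
have Sa0n : Sa0 != 0.
  have : hsol a != 0 by rewrite /hsol; case: (al).
  by rewrite hSa0; apply: contra_neq => ->; rewrite mulr0.
have za : z a = - Sa0 * (hend - eps * Delta).
  by rewrite /z ya hSa0; ring.
have lamn n : lam - (freq al be n ^+ 2)%:C%C != 0.
  by apply: contra_neq hI => /eqP; rewrite subr_eq0 => /eqP ->.
have h1 := fourier_complex al ha hz hdz zpi.
have h2 : ccvg (fun N => \sum_(n < N) (weight al be n * eigf al be n a)%:C%C * ccoef al be z n)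
    (hend * Sa0 * b).
  have := ccvgZ (hend * Sa0) hb; apply: eq_ccvg => N.
  rewrite mulr_sumr; apply: eq_bigr => n _.
  have E := ccoef_bvp n (L2_citg hq) hz hdz zbc0 zbcpi.
  have l1 := lamn n; have l2 : (freq al be n ^+ 2)%:C%C - lam != 0 by rewrite -opprB oppr_eq0.
  have -> : ccoef al be z n = hend * - Sa0 * ccoef al be q n / (lam - (freq al be n ^+ 2)%:C%C).
    by rewrite -E mulrC mulKf.
  rewrite -[lam - _]opprB invrN; ring.
have := ccvg_unique h1 h2; rewrite za => E.
have {}E : - (hend - eps * Delta) = hend * b.
  by apply: (mulfI Sa0n); move: E => E; rewrite mulrN -mulNr E; ring.
have -> : Delta = eps * (eps * Delta) by rewrite mulrA eps2 mul1r.
rewrite -mulrA; congr (_ * _).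
have -> : eps * Delta = hend + - (hend - eps * Delta) by ring.
by rewrite E; ring.
Qed.

(* The Neumann problem has frequency 0 for [n = 0]; its factor is not normalised. *)
Definition dnorm n : R := if freq al be n == 0 then 1 else freq al be n ^+ 2.

Lemma dnorm_neq0 n : dnorm n != 0.
Proof.
rewrite /dnorm; have [_|h] := eqVneq (freq al be n) 0; first exact: oner_neq0.
exact: expf_neq0.
Qed.

(** The factor [pi] is the length [l] in [sin_product], which enters exactly when both boundary
    conditions are of the same kind. *)
Lemma hend_product : ccvg (fun N => (if al == be then pi else 1)%:C%C *
  \prod_(n < N) (((freq al be n ^+ 2)%:C%C - lam) / (dnorm n)%:C%C)) hend.
Proof.
have pg := pi_gt0 R.
have hs := sin_product pg tcs; have hc := cos_product pg tcs.
have half (x : R) : x * (pi / (2 * pi)) = x / 2.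
  by congr (_ * _); move: (pi : R) pg => p pg; field; rewrite lt0r_neq0.
have fac n : freq al be n != 0 ->
   ((freq al be n ^+ 2)%:C%C - lam) / (dnorm n)%:C%C = 1 - lam / (freq al be n ^+ 2)%:C%C.
  move=> h; rewrite /dnorm (negbTE h) mulrBl divff //.
  by rewrite -nc_eq0 nc_real normr_eq0 expf_neq0.
move: fac; rewrite /hend /hsol /dhsol /dnorm; case: al be => [] [] /= fac.
(* Neumann case: [hend] is [- lam * s pi], and the unnormalised factor for [n = 0] supplies the
   [- lam]. *)
- apply/(ccvg_shift _ _ 1).
  have := ccvgZ (- lam) hs; apply: eq_ccvg => N.
  rewrite addn1 big_ord_recl /=.
  have -> : freq true true 0 = 0 by apply/eqP; rewrite freq_eq0.
  rewrite eqxx divr1 expr0n /= sub0r mulrCA; congr (_ * _); congr (_ * _).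
  apply: eq_bigr => i _.
  have hi : freq true true (bump 0 i) != 0 by rewrite freq_eq0.
  rewrite (fac _ hi); congr (1 - lam / (_ ^+ 2)%:C%C).
  by rewrite half /freq -[(true + true)%N]/2%N /bump /= add1n -natr1 -!muln2 -!natr1 natrM; field.
- apply: eq_ccvg hc => N; rewrite mul1r; apply: eq_bigr => i _.
  have hi : freq true false i != 0 by rewrite freq_eq0.
  rewrite (fac _ hi); congr (1 - lam / (_ ^+ 2)%:C%C).
  by rewrite half /freq -[(true + false)%N]/1%N -!muln2 -!natr1 natrM; field.
- apply: eq_ccvg hc => N; rewrite mul1r; apply: eq_bigr => i _.
  have hi : freq false true i != 0 by rewrite freq_eq0.
  rewrite (fac _ hi); congr (1 - lam / (_ ^+ 2)%:C%C).
  by rewrite half /freq -[(false + true)%N]/1%N -!muln2 -!natr1 natrM; field.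
- apply: eq_ccvg hs => N; congr (_ * _); apply: eq_bigr => i _.
  have hi : freq false false i != 0 by rewrite freq_eq0.
  rewrite (fac _ hi); congr (1 - lam / (_ ^+ 2)%:C%C).
  by rewrite half /freq -[(false + false)%N]/0%N -!muln2 -!natr1 natrM; field.
Qed.

End Fixed.
End DeltaIdentity.

(** * From the secular equation to the eigenvalues *)

Section Assembly.
Variable R : realType.
Local Notation freq := (freq R).
Local Notation weight := (weight R).
Implicit Types (al be : bool).

Let pi0 : 0 <= pi :> R := pi_ge0 R.

(** The difference of squares has the cofactor [m + n + 2 - (al + be)], which is at least [n]. *)
Lemma freq_gap al be (m n : nat) :
  `|m%:R - n%:R| * n%:R <= `|freq al be m ^+ 2 - freq al be n ^+ 2|.
Proof.
have h : (al + be)%N%:R <= 2 :> R by rewrite ler_nat; case: al be => [] [].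
have -> : freq al be m ^+ 2 - freq al be n ^+ 2 =
  (m%:R - n%:R) * (m%:R + n%:R + (2 - (al + be)%N%:R)) by rewrite /freq; field.
rewrite normrM; apply: ler_wpM2l => //.
have m0 : 0 <= m%:R :> R by []. have n0 : 0 <= n%:R :> R by [].
by rewrite ger0_norm; lra.
Qed.

Lemma freq_ge_pred al be n : n%:R <= freq al be n.
Proof.
have h : (al + be)%N%:R <= 2 :> R by rewrite ler_nat; case: al be => [] [].
rewrite /freq; lra.
Qed.

Lemma dnorm_bseries al be : bseries (fun n => `|dnorm R al be n|^-1).
Proof.
apply: (bseries_near (N0 := 1) (w := fun n => invdist R 0 n ^+ 2)).
- by move=> n; exact: sqr_ge0.
- move=> n n1; have n0 : 0 < n%:R :> R by rewrite ltr0n.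
  have fn := freq_ge_pred al be n.
  rewrite /dnorm gt_eqF; last exact: lt_le_trans fn.
  rewrite /invdist gtn_eqF // subr0 ger0_norm ?sqr_ge0 // ger0_norm ?ler0n //.
  rewrite exprVn lef_pV2 ?posrE ?exprn_gt0 //; last exact: lt_le_trans fn.
  by apply: lerXn2r => //; rewrite nnegrE ?ler0n // (le_trans _ fn).
by exists 4 => N; exact: sum_invdist_sqr.
Qed.

Lemma dnorm_dist al be n : `|freq al be n ^+ 2 - dnorm R al be n| <= 1.
Proof.
rewrite /dnorm; have [->|_] := eqVneq (freq al be n) 0.
  by rewrite expr0n /= sub0r normrN normr1.
by rewrite subrr normr0.
Qed.

Lemma weight_eigf_le1 al be n a : `|weight al be n * eigf al be n a| <= 1.
Proof.
have pg := pi_ge2 R.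
rewrite normrM -[leRHS]mulr1; apply: ler_pM => //; last exact: eigf_le1.
rewrite gtr0_norm ?weight_gt0 // /weight ler_pdivrMr ?pi_gt0 //.
by case: ifP => _; lra.
Qed.

Lemma ccontD (f g : R[i] -> R[i]) z0 : ccontinuous_at f z0 -> ccontinuous_at g z0 ->
  ccontinuous_at (fun z => f z + g z) z0.
Proof.
move=> hf hg e e0; have e2 : 0 < e / 2 by lra.
have [d d0 hd] := hf _ e2; have [d' d0' hd'] := hg _ e2.
exists (Num.min d d'); first by rewrite lt_min d0.
move=> z; rewrite lt_min => /andP[/hd h1 /hd' h2].
rewrite opprD addrACA; apply: le_lt_trans (ncD _ _) _; lra.
Qed.

Lemma ccontB (f g : R[i] -> R[i]) z0 : ccontinuous_at f z0 -> ccontinuous_at g z0 ->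
  ccontinuous_at (fun z => f z - g z) z0.
Proof.
move=> hf hg; apply: ccontD => //.
by apply: (eq_ccont (f := fun z => (-1) * g z)) => [z|]; [rewrite mulN1r | exact: ccontM (ccont_cst _ _) hg].
Qed.

(** The half-plane keeps the root away from [- freq], so that in [kappa_exists] the modulus of
    [rho n + freq] is at least [freq]. *)
Lemma sqrt_halfplane (z : R[i]) : exists2 r : R[i], r ^+ 2 = z & 0 <= complex.Re r.
Proof.
have h := sqr_sqrtc z.
have [h0|h0] := leP 0 (complex.Re (sqrtc z)); first by exists (sqrtc z).
exists (- sqrtc z); first by rewrite sqrrN.
by rewrite raddfN /= oppr_ge0 ltW.
Qed.

Section Family.
Variables (q : R -> R[i]) (a : R) (Y dY : R[i] -> R -> R[i]) (y0 y1 : R[i]).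
Variables (Sf dS : R[i] -> R -> R[i]).
Hypothesis ha : 0 < a <= pi.
Hypothesis hq : L2_0pi q.
Hypothesis hY : forall lam, is_solution q a lam (Y lam) (dY lam) /\
  Y lam a = y0 /\ dY lam a = y1.
Hypothesis hS : forall lam, is_solution q a lam (Sf lam) (dS lam) /\
  Sf lam a = 0 /\ dS lam a = 1.

Let ha' : 0 <= a <= pi. Proof. by case/andP: ha => /ltW -> ->. Qed.

Lemma family_cacp lam : cacp pi (Y lam) (dY lam) /\
  cacp pi (dY lam) (fun x => q x * y0 - lam * Y lam x).
Proof.
have [h1 [h2 h3]] := hY lam; have [h4 h5] := solution_cacp hq ha' h1.
by split => //; rewrite -h2.
Qed.

(** [Y] stands for either [Cf] or [Sf]; in both cases [Sf] provides the trigonometric pair for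
    [solution_lip]. *)
Lemma family_cont x lam : 0 <= x <= pi ->
  ccontinuous_at (fun z => Y z x) lam /\ ccontinuous_at (fun z => dY z x) lam.
Proof.
move=> xp.
have [hs [s0 s1]] := hS lam; have [hs1 hs2] := solution_cacp hq ha' hs.
have hs2' : cacp pi (dS lam) (fun x => - lam * Sf lam x).
  by apply: eq_cacp hs2 => // t _; rewrite s0; ring.
have tcs := trig_pair_of_solution pi0 ha' hs1 hs2' s0 s1.
have [h1 h2] := family_cacp lam; have [_ [e1 e2]] := hY lam.
have [K [d [K0 d0 hK]]] := solution_lip pi0 ha' tcs h1 h2.
split; apply: (@ccont_lip _ _ _ K d) => // z hz;
  have [g1 g2] := family_cacp z; have [_ [f1 f2]] := hY z;
  have := hK z _ _ hz g1 g2; rewrite f1 f2 e1 e2 => /(_ erefl erefl x xp) [] //.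
Qed.

End Family.

Lemma char_fun_cont al be q a (Cf dC Sf dS : R[i] -> R -> R[i]) lam :
  0 < a <= pi -> L2_0pi q ->
  (forall lam, is_solution q a lam (Cf lam) (dC lam) /\ Cf lam a = 1 /\ dC lam a = 0) ->
  (forall lam, is_solution q a lam (Sf lam) (dS lam) /\ Sf lam a = 0 /\ dS lam a = 1) ->
  ccontinuous_at (char_fun al be Cf dC Sf dS) lam.
Proof.
move=> ha hq hC hS.
have x0 : (0 : R) <= 0 <= (pi : R) by apply/andP; split => //; exact: pi_ge0.
have x1 : (0 : R) <= (pi : R) <= (pi : R) by apply/andP; split => //; exact: pi_ge0.
have [c1 c2] := family_cont ha hq hC hS lam x0.
have [c3 c4] := family_cont ha hq hC hS lam x1.
have [s1 s2] := family_cont ha hq hS hS lam x0.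
have [s3 s4] := family_cont ha hq hS hS lam x1.
by apply: ccontB; apply: ccontM; case: al; case: be.
Qed.

Lemma eigenvalue_zeros al be q a (Cf dC Sf dS : R[i] -> R -> R[i]) :
  0 < a <= pi -> L2_0pi q ->
  (forall lam, is_solution q a lam (Cf lam) (dC lam) /\ Cf lam a = 1 /\ dC lam a = 0) ->
  (forall lam, is_solution q a lam (Sf lam) (dS lam) /\ Sf lam a = 0 /\ dS lam a = 1) ->
  exists l : nat -> R[i],
    [/\ forall n, eigf al be n a = 0 -> l n = (freq al be n ^+ 2)%:C%C,
        bseries (fun n => nc (l n - (freq al be n ^+ 2)%:C%C) ^+ 2) &
        forall z0, exists m, zero_order (char_fun al be Cf dC Sf dS) z0 m /\
          exists s : seq nat, [/\ uniq s, size s = m & forall n, n \in s <-> l n = z0]].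
Proof.
move=> ha hq hC hS.
have ha' : 0 <= a <= pi by case/andP: ha => /ltW -> ->.
pose b n : R[i] := (weight al be n * eigf al be n a)%:C%C * ccoef al be q n.
pose eps : R[i] := if al then -1 else 1.
pose k : R[i] := (if al == be then pi else 1)%:C%C.
have b2 : bseries (fun n => nc (b n) ^+ 2).
  apply: bseries_le (ccoef_bseries al be hq) => n.
  rewrite /b ncM nc_real exprMn ler_piMl ?sqr_ge0 //.
  by rewrite expr_le1 ?weight_eigf_le1.
have k0 : eps * k != 0.
  rewrite mulf_neq0 //; first by rewrite /eps; case: (al); rewrite ?oppr_eq0 oner_neq0.
  rewrite /k -nc_eq0 nc_real normr_eq0; case: ifP => _; last exact: oner_neq0.
  by rewrite lt0r_neq0 // pi_gt0.
have [|l [l1 l2 l3]] := secular_zeros (freq_gap al be) b2 (dnorm_neq0 R al be)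
  (dnorm_bseries al be) (dnorm_dist al be) k0
  (fun z => char_fun_cont al be z ha hq hC hS).
  move=> z s hI hs.
  have [hc [c0 c1]] := hC z; have [hc1 hc2] := solution_cacp hq ha' hc.
  have [hs0 [s0 s1]] := hS z; have [hs1 hs2] := solution_cacp hq ha' hs0.
  have hc2' : cacp pi (dC z) (fun x => q x - z * Cf z x).
    by apply: eq_cacp hc2 => // x _; rewrite c0 mulr1.
  have hs2' : cacp pi (dS z) (fun x => - z * Sf z x).
    by apply: eq_cacp hs2 => // x _; rewrite s0; ring.
  have := char_fun_secular ha hq hc1 hc2' hs1 hs2' c0 s0 s1 hI hs.
  rewrite -/eps => E.
  have -> : char_fun al be Cf dC Sf dS z = eps * hend al be z (Sf z) (dS z) * (1 + s).
    exact: E.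
  have hp := hend_product al be ha hs1 hs2' s0 s1.
  have := ccvgZ (1 + s) (ccvgZ eps hp).
  rewrite mulrC; apply: eq_ccvg => N; rewrite mulrC; congr (_ * _).
  by rewrite mulrA.
exists l; split => // n e0; apply: l1.
by rewrite /b e0 mulr0 mul0r.
Qed.

End Assembly.

(** * Numbering and asymptotics of the eigenvalues *)

Section Enumeration.
Variable R : realType.
Local Notation freq := (freq R).
Implicit Types (al be : bool).

(** Moves the numbering from 0 to 1; the repeated value at index 0 is discarded by the clause
    [0 < n] of [zeros_with_mult]. *)
Lemma zeros_shift (f : R[i] -> R[i]) (l : nat -> R[i]) :
  (forall z0, exists m, zero_order f z0 m /\
     exists s : seq nat, [/\ uniq s, size s = m & forall n, n \in s <-> l n = z0]) ->
  zeros_with_mult f (fun n => l n.-1).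
Proof.
move=> h z0; have [m [hm [s [us ss hs]]]] := h z0.
exists m; split => //; exists (map S s); split.
- by rewrite map_inj_uniq //; exact: succn_inj.
- by rewrite size_map.
case=> [|n]; first by split=> [/mapP[]|[]].
by rewrite mem_map; [rewrite hs; split=> [|[]] | exact: succn_inj].
Qed.

Lemma freq_complex al be n : (freq al be n)%:C%C = n.+1%:R - (al + be)%N%:R / 2 :> R[i].
Proof. by rewrite /freq natr1 rmorphB /= fmorph_div !rmorph_nat. Qed.

(** With [nu = freq n], [rho - nu = (l - nu ^ 2) / (rho + nu)] and [rho + nu] has modulus at least
    [n]. Multiplying by [n + 1 <= 2 n] costs the factor 4 after squaring; index 0 is set aside. *)
Lemma kappa_exists al be (l : nat -> R[i]) :
  bseries (fun n => nc (l n - (freq al be n ^+ 2)%:C%C) ^+ 2) ->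
  exists kappa : nat -> R[i], in_l2 kappa /\ forall n, (0 < n)%N ->
    l n.-1 = (n%:R - (al + be)%N%:R / 2 + kappa n / n%:R) ^+ 2.
Proof.
move=> hl.
have [n|rho hrho] := @choice _ _ (fun n r => r ^+ 2 = l n /\ 0 <= complex.Re r).
  by have [r h1 h2] := sqrt_halfplane (l n); exists r.
pose kappa n : R[i] := n%:R * (rho n.-1 - (freq al be n.-1)%:C%C).
exists kappa; split; last first.
  case=> // n _; rewrite /kappa /= -freq_complex mulrAC divff ?pnatr_eq0 // mul1r.
  by rewrite addrC subrK; have [] := hrho n.
have [M hM] : bseries (fun n => nc (kappa n.+1) ^+ 2).
  apply: (bseries_near (N0 := 1) _ _ (bseriesZ (ler0n R 4) hl)) => [n|n n1].
    by rewrite mulr_ge0 ?sqr_ge0.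
  have [h1 h2] := hrho n.
  set nu := freq al be n; set d := rho n - nu%:C%C.
  have fn : n%:R <= nu by exact: freq_ge_pred.
  have n1R : 1 <= n%:R :> R by rewrite ler1n.
  have hp : n%:R <= nc (rho n + nu%:C%C).
    apply: le_trans (nc_geRe _); rewrite raddfD /= ger0_norm; lra.
  have E : nc (l n - (nu ^+ 2)%:C%C) = nc d * nc (rho n + nu%:C%C).
    by rewrite -ncM -h1 rmorphXn /= /d; congr nc; ring.
  rewrite E /kappa ncM nc_nat /= -/nu -/d -natr1.
  have d0 := nc_ge0 d.
  have -> : 4 * (nc d * nc (rho n + nu%:C%C)) ^+ 2 = (2 * (nc d * nc (rho n + nu%:C%C))) ^+ 2.
    by ring.
  apply: lerXn2r; rewrite ?nnegrE ?mulr_ge0 ?nc_ge0 ?addr_ge0 //.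
  nra.
exists M => N; case: N => [|N].
  by rewrite big_geq //; have := hM 0%N; rewrite big_ord0.
by rewrite big_add1 /= big_mkord.
Qed.

End Enumeration.

Theorem theorem3p1 (R : realType) (k : nat) (alpha beta : bool) (q : R -> R[i])
  (Cf dC Sf dS : R[i] -> R -> R[i]) :
  (0 < k)%N -> L2_0pi q ->
  (forall lam : R[i], is_solution q (pi / k%:R) lam (Cf lam) (dC lam) /\
      Cf lam (pi / k%:R) = 1 /\ dC lam (pi / k%:R) = 0) ->
  (forall lam : R[i], is_solution q (pi / k%:R) lam (Sf lam) (dS lam) /\
      Sf lam (pi / k%:R) = 0 /\ dS lam (pi / k%:R) = 1) ->
  exists (lam kappa : nat -> R[i]),
    zeros_with_mult (char_fun alpha beta Cf dC Sf dS) lam /\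
        in_l2 kappa /\
        (forall n : nat, (0 < n)%N ->
           lam n = (n%:R - (alpha + beta)%N%:R / 2 + kappa n / n%:R) ^+ 2) /\
        (~~ alpha && ~~ beta ->
           forall n : nat, (0 < n)%N -> lam (k * n)%N = ((k * n)%N%:R) ^+ 2) /\
        (alpha && ~~ beta && odd k ->
           forall n : nat, (0 < n)%N ->
             lam (k * n - k./2)%N = (k%:R * (n%:R - 1 / 2)) ^+ 2) /\
        (alpha && beta && ~~ odd k ->
           forall n : nat, (0 < n)%N ->
             lam (k * n - k./2 + 1)%N = (k%:R * (n%:R - 1 / 2)) ^+ 2).
Proof.
move=> k0 hq hC hS.
have kR : 0 < k%:R :> R by rewrite ltr0n.
have kn0 : k%:R != 0 :> R by rewrite lt0r_neq0.
(* For [k = 1] the point is [pi] itself, so the right end is included. *)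
have ha : (0 : R) < (pi : R) / k%:R <= (pi : R).
  apply/andP; split; first by rewrite divr_gt0 ?pi_gt0.
  by rewrite ler_pdivrMr // ler_peMr ?pi_ge0 // ler1n.
have [l [l0 l2 lz]] := eigenvalue_zeros alpha beta ha hq hC hS.
have [kappa [hk1 hk2]] := kappa_exists l2.
exists (fun n => l n.-1), kappa; split; first exact: zeros_shift.
split => //; split => //; split; last split.
(* In each case the mode of the stated index vanishes at [pi / k]: here because [sin (n pi) = 0], in
   the other two because [cos (n pi - pi / 2) = 0]. *)
- move=> /andP[/negbTE aE /negbTE bE] n n0; rewrite aE bE in l0.
  have fE : freq R false false (k * n).-1 = k%:R * n%:R.
    rewrite /freq -[(false + false)%N]/0%N natr1 prednK ?muln_gt0 ?k0 // natrM.
    by rewrite mul0r subr0.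
  rewrite l0; first by rewrite fE rmorphXn rmorphM !rmorph_nat natrM.
  rewrite /eigf fE; have -> : k%:R * n%:R * (pi / k%:R) = n%:R * pi :> R.
    by move: (pi : R) => p; field.
  exact: sin_natpi.
(* For odd [k], [k./2] is [(k - 1) / 2], so the index is [k (n - 1 / 2) + 1 / 2]. *)
- move=> /andP[/andP[aE /negbTE bE] ok] n n0; rewrite aE bE in l0.
  have kE := odd_double_half k; rewrite ok in kE.
  have kER : k%:R = 1 + 2 * (k./2)%:R :> R by rewrite -[in LHS]kE natrD -muln2 natrM mulrC.
  have knE : (k * n - k./2).-1.+1 = (k * n - k./2)%N.
    by rewrite prednK // subn_gt0; nia.
  have fE : freq R true false (k * n - k./2).-1 = k%:R * (n%:R - 1 / 2).
    rewrite /freq -[(true + false)%N]/1%N natr1 knE natrB ?natrM; last by nia.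
    by rewrite kER; field.
  rewrite l0; first by rewrite fE rmorphXn rmorphM rmorphB /= fmorph_div !rmorph_nat rmorph1.
  rewrite /eigf fE; have -> : k%:R * (n%:R - 1 / 2) * (pi / k%:R) = n%:R * pi - pi / 2 :> R.
    by move: (pi : R) => p; field.
  by rewrite cosBpihalf sin_natpi.
(* For even [k], [k./2] is exactly half of [k], and the [+ 1] is undone by the predecessor in the
   numbering. *)
move=> /andP[/andP[aE bE] /negbTE ok] n n0; rewrite aE bE in l0.
have kE := odd_double_half k; rewrite ok in kE.
have kER : k%:R = 2 * (k./2)%:R :> R by rewrite -[in LHS]kE add0n -muln2 natrM mulrC.
have fE : freq R true true (k * n - k./2 + 1).-1 = k%:R * (n%:R - 1 / 2).
  rewrite /freq -[(true + true)%N]/2%N addn1 /= natrB ?natrM; last by nia.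
  by rewrite kER; field.
rewrite l0; first by rewrite fE rmorphXn rmorphM rmorphB /= fmorph_div !rmorph_nat rmorph1.
rewrite /eigf fE; have -> : k%:R * (n%:R - 1 / 2) * (pi / k%:R) = n%:R * pi - pi / 2 :> R.
  by move: (pi : R) => p; field.
by rewrite cosBpihalf sin_natpi.
Qed.
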